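(* Let $N\in\mathbb N$ and assume $1<q<\frac N2$, $1<p<q^*$, $p\ne q$, $q\ne p^*$. Let $0\le\eta<\overline\eta:=2+\frac{N}{q'}$. Then the space $\mathcal V=D^{1,p}(\mathbb R^N)\cap L^{q^{**}}(\mathbb R^N)$ is continuously embedded into $L^r_\eta(\mathbb R^N)$ for every $r\ge1$ with $r\in(p^*_\eta,q^{**}_\eta)$; that is, for every such $r$ there exists a constant $C=C(N,p,q,\eta,r)>0$ such that $$\|u\|_{L^r_\eta}\le C\|u\|_{\mathcal V}\qquad\text{for all }u\in\mathcal V.$$ Moreover, if $\eta>0$, then the embedding $\mathcal V\hookrightarrow L^r_\eta(\mathbb R^N)$ is compact for every $r\ge1$ with $r\in(p^*_\eta,q^{**}_\eta)$.
   Context: $q'=\frac{q}{q-1}$, $p^*=\frac{Np}{N-p}$, $q^*=\frac{Nq}{N-q}$, $q^{**}=\frac{Nq}{N-2q}$, $p^*_\eta=\frac{p(N-\eta)}{N-p}$, $q^{**}_\eta=\frac{q(N-\eta)}{N-2q}$. $D^{1,p}(\mathbb R^N)=\{u\in L^{p^*}(\mathbb R^N):|\nabla u|\in L^p(\mathbb R^N)\}$. $\mathcal V$ has norm $\|u\|_{\mathcal V}=\|\nabla u\|_p+\|u\|_{q^{**}}$. $L^r_\eta(\mathbb R^N)$ is the weighted Lebesgue space of measurable $u$ with norm $\|u\|_{L^r_\eta}=\big(\int_{\mathbb R^N}|u|^r|x|^{-\eta}dx\big)^{1/r}<\infty$. *)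

(* Defs.v *)
From HB Require Import structures.
From mathcomp Require Import all_boot all_order all_algebra.
From mathcomp Require Import all_classical all_reals all_analysis.

Set Implicit Arguments.
Unset Strict Implicit.
Unset Printing Implicit Defensive.

Import Order.TTheory GRing.Theory Num.Theory.
Import numFieldNormedType.Exports.

Local Open Scope classical_set_scope.
Local Open Scope ring_scope.

Definition measure_rV_display : measure_display.
Proof. exact: default_measure_display. Qed.

(* ['rV[R]_n] carries the product sigma-algebra, i.e. the one generated by the
   coordinate functions (as the library does for tuples). *)
Section measurable_rV.
Context {R : realType} (n : nat).

Let coord (i : 'I_n) (x : 'rV[R]_n) : measurableTypeR R := x ord0 i.

Let rV_set0 : g_sigma_preimage coord set0.
Proof. exact: sigma_algebra0. Qed.

Let rV_setC A : g_sigma_preimage coord A -> g_sigma_preimage coord (~` A).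
Proof. exact: sigma_algebraC. Qed.

Let rV_bigcup (F : _^nat) : (forall i, g_sigma_preimage coord (F i)) ->
  g_sigma_preimage coord (\bigcup_i (F i)).
Proof. exact: sigma_algebra_bigcup. Qed.

HB.instance Definition _ := @isMeasurable.Build measure_rV_display
  'rV[R]_n (g_sigma_preimage coord) rV_set0 rV_setC rV_bigcup.

Lemma measurable_coord (i : 'I_n) :
  measurable_fun [set: 'rV[R]_n] (fun x : 'rV[R]_n => x ord0 i).
Proof.
move=> _ Y mY; rewrite setTI; apply: sub_sigma_algebra => /=.
rewrite -bigcup_seq/=; exists i => /=; first by rewrite mem_index_enum.
by exists Y => //; rewrite setTI.
Qed.

Lemma measurable_fun_rV d (T : measurableType d) (f : T -> 'rV[R]_n) :
  (forall i, measurable_fun [set: T] (fun x => f x ord0 i)) ->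
  measurable_fun [set: T] f.
Proof.
move=> mf; apply: (@measurability _ _ _ _ setT f
  (\big[setU/set0]_(i < n) preimage_set_system setT (coord i) measurable)) => //.
move=> _ [A + <-]; rewrite -bigcup_seq => -[i _ [B mB <-]].
by rewrite !setTI -comp_preimage -[X in measurable X]setTI; exact: mf.
Qed.

End measurable_rV.

Section lebesgue_measure_rV.
Context {R : realType}.

Definition rV_cons n (x : measurableTypeR R * 'rV[R]_n) : 'rV[R]_n.+1 :=
  row_mx (x.1 : R)%:M x.2.

Definition rV_uncons n (x : 'rV[R]_n.+1) : measurableTypeR R * 'rV[R]_n :=
  (x ord0 ord0, rsubmx (x : 'rV[R]_(1 + n))).

Lemma rV_consK n : cancel (@rV_cons n) (@rV_uncons n).
Proof.
case=> a x; rewrite /rV_uncons /rV_cons row_mxKr; congr pair.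
rewrite (_ : ord0 = lshift n (ord0 : 'I_1)); last exact/val_inj.
by rewrite [LHS](@row_mxEl _ 1 1 n) mxE mulr1n.
Qed.

Lemma measurable_rV_cons n : measurable_fun setT (@rV_cons n).
Proof.
apply: (@measurable_fun_rV _ (1 + n)) => i; case: (split_ordP i) => j ->.
  rewrite [X in measurable_fun _ X](_ : _ = fst); first exact: measurable_fst.
  by apply/funext => x /=; rewrite row_mxEl mxE !ord1 mulr1n.
rewrite [X in measurable_fun _ X](_ : _ = (fun x : 'rV[R]_n => x ord0 j) \o snd).
  by apply: measurableT_comp; [exact: measurable_coord|exact: measurable_snd].
by apply/funext => x /=; rewrite row_mxEr.
Qed.

Lemma measurable_rV_uncons n : measurable_fun setT (@rV_uncons n).
Proof.
apply: measurable_fun_pair; first exact: measurable_coord.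
apply: measurable_fun_rV => i.
rewrite [X in measurable_fun _ X](_ : _ =
  fun x : 'rV[R]_n.+1 => x ord0 (rshift 1 i)).
  exact: measurable_coord.
by apply/funext => x; rewrite /= mxE.
Qed.

Section one_more_coordinate.
Context n (mu : {sigma_finite_measure set 'rV[R]_n -> \bar R}).

Definition lebesgue_rV_cons : set 'rV[R]_n.+1 -> \bar R :=
  pushforward (lebesgue_measure \x mu)%E (@rV_cons n).

HB.instance Definition _ := Measure.copy lebesgue_rV_cons
  (measure_function_pushforward__canonical__measure_function_Measure
    (lebesgue_measure \x mu)%E (@measurable_rV_cons n)).

Let lebesgue_rV_cons_sigma_finite : sigma_finite setT lebesgue_rV_cons.
Proof.
have /sigma_finiteP[F [TF ndF Foo]] :=
  sigma_finiteT (lebesgue_measure : sigma_finite_measure (measurableTypeR R) R).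
have /sigma_finiteP[G [TG ndG Goo]] := sigma_finiteT mu.
exists (fun k => @rV_uncons n @^-1` (F k `*` G k)).
  rewrite -preimage_bigcup (_ : \bigcup_k _ = setT) ?preimage_setT//.
  rewrite -subTset -setXTT TF TG => -[x y] [/= [k _ Fkx] [l _ Gly]].
  exists (maxn k l) => //; split => /=.
    by move: x Fkx; exact/subsetPset/ndF/leq_maxl.
  by move: y Gly; exact/subsetPset/ndG/leq_maxr.
move=> k; have [mF Fk] := Foo k; have [mG Gk] := Goo k; split.
  rewrite -[X in measurable X]setTI; apply: measurable_rV_uncons => //.
  exact: measurableX.
rewrite /lebesgue_rV_cons /pushforward -comp_preimage.
rewrite (_ : _ \o _ = id) ?preimage_id; last first.
  by apply/funext => x /=; rewrite rV_consK.
by rewrite product_measure1E// lte_mul_pinfty// ge0_fin_numE.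
Qed.

HB.instance Definition _ := Measure_isSigmaFinite.Build _ _ _
  lebesgue_rV_cons lebesgue_rV_cons_sigma_finite.

End one_more_coordinate.

(* Lebesgue measure on R^n as an n-fold product of Lebesgue measure on R. *)
Fixpoint lebesgue_measure_rV n :
    {sigma_finite_measure set 'rV[R]_n -> \bar R} :=
  match n with
  | 0 => dirac (0 : 'rV[R]_0)
  | n.+1 => lebesgue_rV_cons (lebesgue_measure_rV n)
  end.

End lebesgue_measure_rV.

Section exponents.
Context {R : realType}.
Implicit Types (N : nat) (p q eta : R).

(* q', p^*, q^{**}, p^*_eta and q^{**}_eta, respectively. *)
Definition conj_exp q := q / (q - 1).
Definition star N p := N%:R * p / (N%:R - p).
Definition star2 N q := N%:R * q / (N%:R - 2 * q).
Definition wstar N eta p := p * (N%:R - eta) / (N%:R - p).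
Definition wstar2 N eta q := q * (N%:R - eta) / (N%:R - 2 * q).

End exponents.

Section weak_gradient.
Context {R : realType} {N : nat}.
Local Notation leb := (@lebesgue_measure_rV R N).
Implicit Types (u phi : 'rV[R]_N -> R) (G : 'rV[R]_N -> 'rV[R]_N).

(* The Euclidean norm; the library's [`|x|] on row vectors is the sup norm. *)
Definition enorm (x : 'rV[R]_N) : R := Num.sqrt (\sum_i x ord0 i ^+ 2).

Definition partial (i : 'I_N) phi (x : 'rV[R]_N) : R :=
  'D_(delta_mx ord0 i) phi x.

Fixpoint class_C (k : nat) phi : Prop :=
  match k with
  | 0 => continuous phi
  | k.+1 => continuous phi /\ forall i,
      (forall x, derivable phi x (delta_mx ord0 i)) /\ class_C k (partial i phi)
  end.

(* [phi] is smooth with compact support. *)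
Definition test_function phi : Prop :=
  (forall k, class_C k phi) /\ compact (closure [set x | phi x != 0]).

Definition locally_integrable_rV u : Prop := measurable_fun setT u /\
  forall K, compact K -> (\int[leb]_(x in K) `|u x|%:E < +oo)%E.

Definition is_weak_grad u G : Prop :=
  locally_integrable_rV u /\
  forall i, locally_integrable_rV (fun x => G x ord0 i) /\
    forall phi, test_function phi ->
      \int[leb]_x (u x * partial i phi x) =
      - \int[leb]_x (G x ord0 i * phi x).

(* Weak gradients are only determined up to a null set, so one is chosen; the
   value is meaningful only when [u] has a weak gradient. *)
Definition weak_grad u : 'rV[R]_N -> 'rV[R]_N :=
  xget (fun=> 0) [set G | is_weak_grad u G].

Definition norm_grad u (x : 'rV[R]_N) : R := enorm (weak_grad u x).

End weak_gradient.

(* Function spaces are sets of everywhere defined measurable representatives;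
   norms are extended-real valued and vanish on functions that are null almost
   everywhere. *)
Section function_spaces.
Context {R : realType} {N : nat}.
Local Notation leb := (@lebesgue_measure_rV R N).
Implicit Types (p q r eta : R) (u : 'rV[R]_N -> R).

Definition D1 p : set ('rV[R]_N -> R) :=
  [set u | [/\ u \in Lfun leb (star N p)%:E,
               (exists G, is_weak_grad u G) &
               norm_grad u \in Lfun leb p%:E]].

Definition spaceV p q : set ('rV[R]_N -> R) :=
  D1 p `&` [set u | u \in Lfun leb (star2 N q)%:E].

Definition normV p q u : \bar R :=
  ('N[leb]_(p%:E) [EFin \o norm_grad u] +
   'N[leb]_((star2 N q)%:E) [EFin \o u])%E.

(* For [eta != 0] the weight [enorm x `^ (- eta)] is 0 rather than infinite at
   the origin, which is a null set as soon as [0 < N]. *)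
Definition wLnorm eta r u : \bar R :=
  ((\int[leb]_x (`|u x| `^ r * enorm x `^ (- eta))%:E) `^ r^-1)%E.

Definition wLspace eta r : set ('rV[R]_N -> R) :=
  [set u | measurable_fun setT u /\ (wLnorm eta r u < +oo)%E].

End function_spaces.

Section embeddings.
Context {R : realType} {E : zmodType}.
Variables (X : set E) (nX : E -> \bar R) (Y : set E) (nY : E -> \bar R).

Definition continuously_embedded : Prop :=
  X `<=` Y /\
  exists C : R, 0 < C /\ forall u, X u -> (nY u <= C%:E * nX u)%E.

(* Bounded sequences of [X] have subsequences converging in [Y]. *)
Definition compactly_embedded : Prop :=
  continuously_embedded /\
  forall u_ : nat -> E, (forall n, X (u_ n)) ->
    (exists M : R, forall n, (nX (u_ n) <= M%:E)%E) ->
    exists (sigma : nat -> nat) (v : E),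
      [/\ {homo sigma : m n / (m < n)%N}, Y v &
          nY (u_ (sigma n) - v) @[n --> \oo] --> 0%E].

End embeddings.

(* Main.v *)
(* Write P = p^* and Q = q^{**}. Testing the weak gradient G of u against smooth
   approximations of indicators of boxes shows that
   u(x + t e_i) - u(x) = \int_0^t G_i(x + s e_i) ds for almost all x, whence
   ||u(. + y) - u||_p <= C |y| ||G||_p. Let E_h u be the average of u over the
   cells of the grid of mesh h. By Jensen, ||u - E_h u||_p <= C h ||G||_p, and
   telescoping over h, 2h, 4h, ... (E_h u tends to 0 because u is in L^P) gives
   |E_h u| <= C h^(1 - N/p) ||G||_p everywhere. Comparing |u(x)| with the levels
   h^(1 - N/p), h = 2^k, one bounds ||u||_s by C ||u||_V for P < s < Q; this is
   the case eta = 0.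
   For eta > 0, Young's inequality t^r w <= L^(r-s) t^s + L^r w^(s/(s-r)) with
   w = |x|^-eta, taking s = Q near the origin and a smaller s at infinity,
   yields the embedding and makes the mass near 0 and infinity small uniformly
   in the unit ball of V. For compactness, a diagonal argument makes all
   averages E_{2^-j} u_n converge pointwise; then u_n is Cauchy in L^1 of every
   cube, hence, by interpolation with L^Q, Cauchy in the weighted space, which
   is complete. *)
Require Import Defs.
From HB Require Import structures.
From mathcomp Require Import all_boot all_order all_algebra.
From mathcomp Require Import all_classical all_reals all_analysis.
From mathcomp Require Import measurable_realfun.
From mathcomp Require Import ring lra zify.

Set Implicit Arguments.
Unset Strict Implicit.
Unset Printing Implicit Defensive.

Import Order.TTheory GRing.Theory Num.Theory.
Import numFieldNormedType.Exports.

Local Open Scope classical_set_scope.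
Local Open Scope ring_scope.

(** * Lebesgue measure on R^n *)

Section boxes.
Context {R : realType}.
Implicit Types n : nat.

(** The range of exponents is open, and this is what makes the dyadic method effective. The sup
    bound for the averages at scale 2^k decays like theta^k with theta = 2^(1 - N/p) < 1, while the
    oscillation of u at that scale, raised to the power p, grows like 2^(p k). Scale k thus
    contributes to the integral of |u|^s a term of order rho^k with rho = theta^(s - p) 2^p, and rho
    < 1 means precisely s > p^*. The scales are summed upwards from 1; what lies above the top level
    is paid for by the L^Q norm together with scale 1. At the start, the obstacle is that a weak
    gradient is known only through signed integrals against smooth functions, while Tonelli's
    theorem and the comparison of functions through their integrals over boxes are applied to
    nonnegative functions. The integrated identity is therefore split into positive and negative
    parts, and every negative part is moved to the other side. Boxes appear in three ways: as a
    generating pi-system, as limits of tensor products of smooth functions, which are differentiated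
    one factor at a time, and as grid cells. *)

Definition box n (a b : 'rV[R]_n) : set 'rV[R]_n :=
  [set x | forall i, a ord0 i <= x ord0 i < b ord0 i].

Definition boxes n : set (set 'rV[R]_n) :=
  [set A | exists a b, A = box a b].

Lemma measurable_slab n (i : 'I_n) (c d : R) :
  measurable [set x : 'rV[R]_n | c <= x ord0 i < d].
Proof.
rewrite [X in measurable X](_ : _ =
    (fun x : 'rV[R]_n => x ord0 i) @^-1` `[c, d[%classic); last first.
  by apply/seteqP; split=> x /=; rewrite in_itv.
rewrite -[X in measurable X]setTI; apply: measurable_coord => //.
Qed.

Lemma measurable_forall_ord d (T : measurableType d) n (A : 'I_n -> set T) :
  (forall i, measurable (A i)) -> measurable [set x | forall i, A i x].
Proof.
move=> mA; rewrite [X in measurable X](_ : _ = \big[setI/setT]_(i < n) A i).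
  by apply: bigsetI_measurable => i _; exact: mA.
by rewrite -bigcap_seq; apply/seteqP; split=> x h i; [move=> _; exact: h|
  apply: h => /=; rewrite mem_index_enum].
Qed.

Lemma measurable_box n (a b : 'rV[R]_n) : measurable (box a b).
Proof. by apply: measurable_forall_ord => i; exact: measurable_slab. Qed.

Lemma setI_boxes n : setI_closed (@boxes n).
Proof.
move=> _ _ [a [b ->]] [c [d ->]].
exists (\row_i Num.max (a ord0 i) (c ord0 i)),
  (\row_i Num.min (b ord0 i) (d ord0 i)).
apply/seteqP; split=> x /=.
  move=> [ab cd] i; rewrite !mxE ge_max lt_min.
  by have /andP[-> ->] := ab i; have /andP[-> ->] := cd i.
move=> h; split=> i; have := h i; rewrite !mxE ge_max lt_min;
  by move=> /andP[/andP[? ?] /andP[? ?]]; apply/andP; split.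
Qed.

Lemma rV_natbound n (x : 'rV[R]_n) :
  exists k : nat, forall i, `|x ord0 i| < k%:R.
Proof.
exists (\sum_i (Num.truncn `|x ord0 i|).+1)%N => i.
apply: lt_le_trans (truncnS_gt _) _; rewrite ler_nat.
by rewrite (bigD1 i) //= leq_addr.
Qed.

Lemma bigcup_box n :
  \bigcup_k box (\row_i - k%:R) (\row_i k%:R) = [set: 'rV[R]_n].
Proof.
rewrite -subTset => x _; have [k hk] := rV_natbound x; exists k => // i.
by rewrite !mxE; have := hk i; rewrite ltr_norml => /andP[/ltW -> ->].
Qed.

(** Coordinate half-spaces are countable unions of boxes whose other sides are opened up to -k and
    k. *)
Lemma measurable_boxesE n : @measurable _ 'rV[R]_n = <<s @boxes n >>.
Proof.
apply/seteqP; split; last first.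
  apply: smallest_sub; first exact: sigma_algebra_measurable.
  by move=> _ [a [b ->]]; exact: measurable_box.
apply: smallest_sub; first exact: smallest_sigma_algebra.
rewrite -bigcup_seq => A [i _ /= [B mB <-]]; rewrite setTI.
pose G := g_sigma_algebraType (@boxes n).
suff mf : @measurable_fun _ _ G (measurableTypeR R) setT
    (fun x : G => (x : 'rV[R]_n) ord0 i).
  by have := mf measurableT _ mB; rewrite setTI.
apply: (measurability _ (measurable_realfun.RGenCInfty.measurableE R)) => //.
move=> _ [_ [c ->] <-]; rewrite setTI.
rewrite (_ : _ @^-1` _ = \bigcup_k box
   (\row_j if j == i then c else - k%:R) (\row_j k%:R)).
  apply: bigcupT_measurable => k; apply: sub_sigma_algebra.
  by do 2 eexists.
apply/seteqP; split=> x /=; rewrite in_itv/= andbT.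
  move=> cx; have [k hk] := rV_natbound x; exists k => // j.
  rewrite !mxE; have := hk j; rewrite ltr_norml => /andP[/ltW h ->].
  by case: eqP => [->|]; rewrite ?cx ?h.
by move=> [k _ /(_ i)]; rewrite !mxE eqxx => /andP[].
Qed.

Local Notation leb := (@lebesgue_measure_rV R).

Lemma lebesgue_measure_box n (a b : 'rV[R]_n) :
  leb n (box a b) = (\prod_i Num.max 0 (b ord0 i - a ord0 i))%:E.
Proof.
elim: n => [|n IH] in a b *.
  rewrite big_ord0 /= diracE mem_set// => -[]//.
rewrite big_ord_recl /= /lebesgue_rV_cons /pushforward.
pose t (x : 'rV[R]_n.+1) : 'rV[R]_n := \row_i x ord0 (lift ord0 i).
rewrite (_ : _ @^-1` _ = `[a ord0 ord0, b ord0 ord0[%classic `*` box (t a) (t b)).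
  rewrite product_measure1E//; last exact: measurable_box.
  rewrite IH EFinM; congr (_ * _)%E.
    apply: (etrans (lebesgue_measure_itv _)); rewrite /= lte_fin; case: ltP => ab.
      by rewrite -EFinB max_r// subr_ge0 ltW.
    by rewrite max_l// subr_le0.
  by congr EFin; apply: eq_bigr => i _; rewrite !mxE.
have tE (x : 'rV[R]_n.+1) i : t x ord0 i = x ord0 (lift ord0 i) by rewrite mxE.
have e0 (x : R * 'rV[R]_n) : rV_cons x ord0 ord0 = x.1.
  by have /(congr1 fst) := rV_consK x.
have eS (x : R * 'rV[R]_n) i : rV_cons x ord0 (lift ord0 i) = x.2 ord0 i.
  rewrite (_ : lift ord0 i = rshift 1 i); last exact/val_inj.
  by rewrite [LHS](@row_mxEr _ 1 1 n).
apply/seteqP; split=> x /=.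
  move=> h; split; first by rewrite in_itv/=; have := h ord0; rewrite e0.
  by move=> i; rewrite !tE -eS; exact: h.
move=> [+ h] i; rewrite in_itv/= => h0; case: (unliftP ord0 i) => [j ->|->].
  by have := h j; rewrite !tE eS.
by rewrite e0.
Qed.

Lemma lebesgue_measure_box_lty n (a b : 'rV[R]_n) : (leb n (box a b) < +oo)%E.
Proof. by rewrite lebesgue_measure_box ltry. Qed.

Lemma measurable_rV_shift n (y : 'rV[R]_n) :
  measurable_fun setT (fun x : 'rV[R]_n => x + y).
Proof.
apply: measurable_fun_rV => i.
under eq_fun do rewrite mxE.
by apply: measurable_funD => //; exact: measurable_coord.
Qed.

Section shift.
Context n (y : 'rV[R]_n).

Definition shifted_lebesgue : set 'rV[R]_n -> \bar R :=
  pushforward (leb n) (fun x : 'rV[R]_n => x + y).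

HB.instance Definition _ := Measure.copy shifted_lebesgue
  (measure_function_pushforward__canonical__measure_function_Measure
    (leb n) (@measurable_rV_shift n y)).

Lemma shifted_lebesgue_box (a b : 'rV[R]_n) :
  shifted_lebesgue (box a b) = leb n (box (a - y) (b - y)).
Proof.
by congr (leb n _); apply/seteqP; split=> x /= h i; have := h i;
  rewrite !mxE lerBlDr ltrBrDr.
Qed.

(** The measure is an iterated product, so invariance is read off from boxes and extended by
    uniqueness of measures on a pi-system containing an exhausting sequence of sets of finite
    measure. *)
Lemma shifted_lebesgueE (A : set 'rV[R]_n) : measurable A ->
  shifted_lebesgue A = leb n A.
Proof.
move=> mA; apply: (measure_unique (@boxes n)
  (fun k => box (\row_i - k%:R) (\row_i k%:R))) => //.
- exact: measurable_boxesE.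
- exact: setI_boxes.
- by move=> k; do 2 eexists.
- exact: bigcup_box.
- move=> _ [a [b ->]]; apply: (etrans (shifted_lebesgue_box _ _)).
  rewrite lebesgue_measure_box; apply: esym.
  apply: (etrans (lebesgue_measure_box _ _)).
  congr EFin; apply: eq_bigr => i _.
  by rewrite !mxE opprB addrA subrK.
- move=> k; apply: (le_lt_trans (y := leb n (box (\row_i - k%:R - y) (\row_i k%:R - y)))).
    by rewrite -shifted_lebesgue_box.
  exact: lebesgue_measure_box_lty.
Qed.

Lemma ge0_integral_shift (f : 'rV[R]_n -> \bar R) :
  measurable_fun setT f -> (forall x, 0 <= f x)%E ->
  (\int[leb n]_x f (x + y)%R = \int[leb n]_x f x)%E.
Proof.
move=> mf f0.
rewrite [RHS](@eq_measure_integral _ _ _ _ (shifted_lebesgue)); last first.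
  by move=> A mA _; exact: esym (shifted_lebesgueE mA).
have := @ge0_integral_pushforward _ _ _ _ _ _ (@measurable_rV_shift n y)
  (leb n) setT f measurableT mf (fun x _ => f0 x).
by rewrite preimage_setT => <-.
Qed.

End shift.
End boxes.

(** * Almost everywhere equality from integrals over a pi-system *)

Section pi_system.
Local Open Scope ereal_scope.
Context d (T : measurableType d) {R : realType} (mu : {measure set T -> \bar R}).
Variables (G : set (set T)) (g : (set T)^nat).
Hypotheses (mG : measurable = <<s G >>) (setIG : setI_closed G).
Hypotheses (Gg : forall k, G (g k)) (g_cover : \bigcup_k g k = setT).

(** The weak gradient yields identities integrated over boxes; this turns them into an identity at
    almost every point. *)
Lemma ge0_ae_eq_pi_system (f1 f2 : T -> \bar R) :
  measurable_fun setT f1 -> measurable_fun setT f2 ->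
  (forall x, 0 <= f1 x) -> (forall x, 0 <= f2 x) ->
  (forall A, G A -> \int[mu]_(x in A) f1 x = \int[mu]_(x in A) f2 x) ->
  (forall k, \int[mu]_(x in g k) f1 x < +oo) ->
  {ae mu, forall x, f1 x = f2 x}.
Proof.
move=> mf1 mf2 f10 f20 f12 f1oo.
have mGG A : G A -> measurable A by move=> GA; rewrite mG; exact: sub_sigma_algebra.
have mg k : measurable (g k) by exact: mGG.
have E k S : measurable S ->
    \int[mu]_(x in S `&` g k) f1 x = \int[mu]_(x in S `&` g k) f2 x.
  move=> mS; have : <<s G >> S by rewrite -mG.
  move: S {mS}; apply: (dynkin_induction (G := G)) => //.
  - by rewrite setTI; exact: f12.
  - by move=> A GA; apply: f12; exact: setIG.
  (* Closure under complements subtracts the integral over [S] inside [g k], which must be finite: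
     hence the restriction to the sets [g k]. *)
  - move=> S mS IH.
    have split f : measurable_fun setT f -> (forall x, 0 <= f x) ->
        \int[mu]_(x in g k) f x =
        \int[mu]_(x in S `&` g k) f x + \int[mu]_(x in ~` S `&` g k) f x.
      move=> mf f0; rewrite -ge0_integral_setU//.
      - by rewrite -setIUl setUv setTI.
      - exact: measurableI.
      - by apply: measurableI => //; exact: measurableC.
      - exact: measurable_funS mf.
      - by rewrite disj_set2E setIACA setICr set0I.
    have := split _ mf1 f10; rewrite (f12 _ (Gg k)) (split _ mf2 f20) IH.
    have fin : \int[mu]_(x in S `&` g k) f2 x \is a fin_num.
      rewrite ge0_fin_numE; last exact: integral_ge0.
      rewrite -IH; apply: le_lt_trans (f1oo k).
      by apply: ge0_subset_integral => //; [exact: measurableI|exact: measurable_funS mf1].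
    by move=> /(congr1 (fun z => z - \int[mu]_(x in S `&` g k) f2 x));
      rewrite !(addeC (\int[mu]_(x in S `&` g k) f2 x)) !addeK.
  - move=> F mF tF IH.
    rewrite setI_bigcupl !ge0_integral_bigcup//.
    + by apply: eq_eseriesr => n _; exact: IH.
    + by move=> n; exact: measurableI.
    + exact: measurable_funS mf2.
    + exact: trivIset_setIr.
    + by move=> n; exact: measurableI.
    + exact: measurable_funS mf1.
    + exact: trivIset_setIr.
have ae k : ae_eq mu (g k) f1 f2.
  apply: integral_ae_eq => //.
  - apply/integrableP; split; first exact: measurable_funS mf1.
    by under eq_integral => x _ do rewrite gee0_abs//.
  - exact: measurable_funS mf2.
  - by move=> A Ag mA; have := E k _ mA; rewrite setIidl.
have : {ae mu, forall x k, g k x -> f1 x = f2 x} by exact/ae_foralln.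
apply: filterS => x h; have : setT x by [].
by rewrite -g_cover => -[k _]; exact: h.
Qed.

End pi_system.

(** * Smooth test functions *)

Section flat.
Context {R : realType}.
Implicit Types (P : {poly R}) (s : R) (f g : R -> R).

(* The functions [P(1/s) exp(-1/s)], extended by 0 for [s <= 0]: a family of
   smooth functions that is closed under differentiation. *)
Definition flat P s : R := if 0 < s then P.[s^-1] * expR (- s^-1) else 0.

(** With X standing for 1/s, this represents the derivative of P(1/s) exp(-1/s): both terms carry
    the factor 1/s^2 of the chain rule. *)
Definition flat_deriv P : {poly R} := 'X^2 * (P - P^`()).

(** Half of the exponential absorbs one factor x, since exp(y) >= 1 + y gives x exp(-a x / 2) <= 2 /
    a; the other half serves the polynomial of lower degree. *)
Lemma poly_expR_bounded P (a : R) : 0 < a ->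
  exists2 C, 0 <= C & forall x, 0 <= x -> `|P.[x]| * expR (- (a * x)) <= C.
Proof.
elim/poly_ind: P a => [|P c IH] a a0.
  by exists 0 => // x _; rewrite horner0 normr0 mul0r.
have a20 : 0 < a / 2 by rewrite divr_gt0.
have [C C0 hC] := IH _ a20.
have c0 : 0 <= 2 / a by rewrite divr_ge0// ltW.
exists (C * (2 / a) + `|c|); first by rewrite addr_ge0// mulr_ge0.
move=> x x0; rewrite hornerD hornerMX hornerC.
have e1 : expR (- (a * x)) <= 1.
  by rewrite -expR0 ler_expR oppr_le0 mulr_ge0// ltW.
have -> : expR (- (a * x)) = expR (- (a / 2 * x)) * expR (- (a / 2 * x)).
  by rewrite -expRD; congr expR; field.
set E := expR (- (a / 2 * x)).
have E0 : 0 <= E by exact: expR_ge0.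
have xE : x * E <= 2 / a.
  rewrite /E expRN ler_pdivrMr ?expR_gt0//.
  apply: le_trans (_ : 2 / a * (1 + a / 2 * x) <= _).
    rewrite mulrDr mulr1 (_ : 2 / a * (a / 2 * x) = x) ?lerDr//.
    by field; rewrite gt_eqF.
  by rewrite ler_wpM2l// expR_ge1Dx.
have E1 : E <= 1.
  by rewrite -expR0 ler_expR oppr_le0 mulr_ge0// ltW.
apply: le_trans (_ : (`|P.[x]| * x + `|c|) * (E * E) <= _).
  apply: ler_wpM2r; first exact: mulr_ge0.
  by rewrite (le_trans (ler_normD _ _))// normrM (ger0_norm x0).
rewrite mulrDl lerD//; last by rewrite ler_piMr// mulr_ile1.
rewrite mulrACA.
by apply: ler_pM; [exact: mulr_ge0|exact: mulr_ge0|exact: hC|exact: xE].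
Qed.

(** Quadratic decay makes the difference quotient at 0 tend to 0. It comes from the boundedness of
    x^2 P(x) exp(-x) at x = 1/s. *)
Lemma flat_quadratic P : exists2 C, 0 <= C & forall s, `|flat P s| <= C * s ^+ 2.
Proof.
have [C C0 hC] := poly_expR_bounded ('X^2 * P) (@ltr01 R).
exists C => // s; rewrite /flat; case: ifPn => s0; last first.
  by rewrite normr0 mulr_ge0// sqr_ge0.
have s10 : 0 <= s^-1 by rewrite invr_ge0 ltW.
have := hC _ s10; rewrite mul1r hornerM hornerXn normrM (ger0_norm (exprn_ge0 _ _))//.
rewrite normrM (ger0_norm (expR_ge0 _)) -mulrA exprVn mulrC.
by rewrite ler_pdivrMr// exprn_gt0.
Qed.

Lemma is_derive_flat P s : is_derive s 1 (flat P) (flat (flat_deriv P) s).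
Proof.
have [s0|s0|->] := ltgtP s 0.
- rewrite {2}/flat ltNge (ltW s0)/=.
  apply: (@near_eq_is_derive _ _ _ (cst 0)) => //.
  near=> x; rewrite /flat ifN// -leNgt; near: x.
  by apply: filterS (lt_nbhsl s0) => x /ltW.
- rewrite {2}/flat s0.
  pose F (x : R) := P.[x^-1] * expR (- x^-1).
  apply: (@near_eq_is_derive _ _ _ F) => //.
    by near=> x; rewrite /flat ifT//; near: x; exact: lt_nbhsr.
  have s_neq0 : s != 0 by rewrite gt_eqF.
  have dV : is_derive s 1 (fun x : R => x^-1) (- s ^- 2 *: (1 : R)).
    exact: (@is_deriveV _ id s 1 1).
  have dP := @is_derive1_comp _ (horner P) (fun x : R => x^-1) s _ _
    (is_derive_poly P s^-1) dV.
  have dN : is_derive s 1 (fun x : R => - x^-1) (- (- s ^- 2 *: (1 : R))).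
    exact: is_deriveN.
  have dE := @is_derive1_comp _ expR (fun x : R => - x^-1) s _ _
    (is_derive_expR (- s^-1)) dN.
  have dM := is_deriveM dP dE.
  apply: is_derive_eq dM _.
  rewrite /= /flat_deriv !hornerE /GRing.scale/=; field.
  exact: s_neq0.
- rewrite {2}/flat ltxx; apply/is_derive1_caratheodory.
  (* Caratheodory's slope at 0; the convention 0^-1 = 0 gives it the value 0 there, which is the
     derivative. *)
  exists (fun z => flat P z / z); split.
  + move=> z; rewrite {2}/flat ltxx !subr0.
    have [->|z0] := eqVneq z 0; last by rewrite divfK.
    by rewrite invr0 !mulr0 /flat ltxx.
  + have [C C0 hC] := flat_quadratic P.
    change (flat P z / z @[z --> (0 : R)] --> flat P 0 / 0).
    rewrite invr0 mulr0.
    have Cz : C * `|z| @[z --> (0 : R)] --> (0 : R).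
      rewrite -[X in _ --> X](mulr0 C) -[X in _ --> C * X](@normr0 _ R).
      by apply: (cvgM (cvg_cst C)); apply: cvg_norm; exact: cvg_id.
    apply: (@squeeze_cvgr _ _ _ _ (fun z => - (C * `|z|)) (fun z => C * `|z|)).
    * near=> z; rewrite -ler_norml normrM.
      have [->|z0] := eqVneq z 0; first by rewrite invr0 normr0 !mulr0.
      by rewrite normfV ler_pdivrMr ?normr_gt0// -mulrA -expr2 real_normK ?num_real.
    * by rewrite -[X in _ --> X]oppr0; exact: cvgN Cz.
    * exact: Cz.
  + by rewrite invr0 mulr0.
Unshelve. all: by end_near. Qed.

(** Differentiation does not leave this class, so derivatives of every order are obtained by
    induction. *)
Inductive flat_algebra : (R -> R) -> Prop :=
| flat_algebra_flat P (a b : R) : flat_algebra (fun s => flat P (a * s + b))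
| flat_algebraD f g : flat_algebra f -> flat_algebra g ->
    flat_algebra (fun s => f s + g s)
| flat_algebraM f g : flat_algebra f -> flat_algebra g ->
    flat_algebra (fun s => f s * g s)
| flat_algebraZ k f : flat_algebra f -> flat_algebra (fun s => k * f s).

Definition has_flat_deriv f :=
  exists2 f', flat_algebra f' & forall s, is_derive s 1 f (f' s).

Lemma flat_algebra_deriv f : flat_algebra f -> has_flat_deriv f.
Proof.
elim => [P a b|{}f g _ [f' af' df] _ [g' ag' dg]|
  {}f g af [f' af' df] ag [g' ag' dg]|k {}f _ [f' af' df]].
- exists (fun s => a * flat (flat_deriv P) (a * s + b)).
    by apply: flat_algebraZ; exact: flat_algebra_flat.
  move=> s.
  have da : is_derive s 1 (fun x : R => a * x + b) a.
    have dZ : is_derive s 1 (fun x : R => a * x) (a *: (1 : R)).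
      exact: (@is_deriveZ _ _ _ id a).
    have := is_deriveD dZ (is_derive_cst b s 1).
    by move=> h; apply: is_derive_eq h _; rewrite addr0 /GRing.scale/= mulr1.
  have := @is_derive1_comp _ (flat P) _ s _ _ (is_derive_flat P (a * s + b)) da.
  by move=> h; apply: is_derive_eq h _; rewrite mulrC.
- exists (fun s => f' s + g' s); first exact: flat_algebraD.
  by move=> s; exact: is_deriveD.
- exists (fun s => f s * g' s + g s * f' s).
    by apply: flat_algebraD; exact: flat_algebraM.
  by move=> s; exact: is_deriveM.
- exists (fun s => k * f' s); first exact: flat_algebraZ.
  by move=> s; exact: is_deriveZ.
Qed.

Lemma has_flat_deriv_continuous f : has_flat_deriv f -> continuous f.
Proof.
move=> [f' _ df] s; apply/differentiable_continuous/derivable1_diffP.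
by have [] := df s.
Qed.

Lemma flat_algebra_continuous f : flat_algebra f -> continuous f.
Proof. by move=> /flat_algebra_deriv/has_flat_deriv_continuous. Qed.

(* Tends to the indicator of [a, b[ as [n] grows: the first factor vanishes
   exactly for [s <= a - 1 / n.+1], the second exactly for [s >= b]. *)
Definition smooth_indic (a b : R) (n : nat) (s : R) : R :=
  flat 1 (n.+1%:R ^+ 2 * s + (n.+1%:R - n.+1%:R ^+ 2 * a)) *
  flat 1 (- n.+1%:R ^+ 2 * s + n.+1%:R ^+ 2 * b).

Lemma flat1_itv s : 0 <= flat 1 s <= 1.
Proof.
rewrite /flat; case: ifPn => s0; last by rewrite lexx ler01.
rewrite !hornerE expR_ge0/= -expR0 ler_expR oppr_le0 invr_ge0 ltW//.
Qed.

Lemma flat_algebra_smooth_indic a b n : flat_algebra (smooth_indic a b n).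
Proof. by apply: flat_algebraM; exact: flat_algebra_flat. Qed.

Lemma smooth_indic_itv a b n s : 0 <= smooth_indic a b n s <= 1.
Proof.
have /andP[? ?] := flat1_itv (n.+1%:R ^+ 2 * s + (n.+1%:R - n.+1%:R ^+ 2 * a)).
have /andP[? ?] := flat1_itv (- n.+1%:R ^+ 2 * s + n.+1%:R ^+ 2 * b).
by rewrite /smooth_indic mulr_ge0//= mulr_ile1.
Qed.

Lemma smooth_indic_supp a b n s : smooth_indic a b n s != 0 -> a - 1 < s < b.
Proof.
have n0 : (0 : R) < n.+1%:R by [].
have n1 : (1 : R) <= n.+1%:R by rewrite ler1n.
rewrite /smooth_indic /flat; case: ifPn; last by rewrite mul0r eqxx.
case: ifPn; last by rewrite mulr0 eqxx.
set m := (n.+1%:R : R) in n0 n1 *; move=> h1 h2 _.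
have m20 : 0 < m ^+ 2 by rewrite exprn_gt0.
apply/andP; split.
  have : 0 < m * (m * (s - a) + 1).
    by rewrite (_ : m * _ = m ^+ 2 * s + (m - m ^+ 2 * a)); last ring.
  rewrite pmulr_rgt0// => h.
  rewrite ltNge; apply/negP => sa.
  have : m * (s - a) <= m * (- 1) by rewrite ler_wpM2l ?(ltW n0)//; lra.
  lra.
have : 0 < m ^+ 2 * (b - s).
  by rewrite (_ : m ^+ 2 * _ = - m ^+ 2 * s + m ^+ 2 * b); last ring.
by rewrite pmulr_rgt0// subr_gt0.
Qed.

Lemma flat1_cvg1 (x : nat -> R) :
  x n @[n --> \oo] --> +oo -> flat 1 (x n) @[n --> \oo] --> (1 : R).
Proof.
move=> xoo.
have : expR (- (x n)^-1) @[n --> \oo] --> expR (0 : R).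
  apply: continuous_cvg; first exact: continuous_expR.
  by rewrite -oppr0; apply: cvgN; apply/gtr0_cvgV0 => //;
    move/cvgryPgt: xoo; exact.
rewrite expR0; apply: cvg_trans; apply: near_eq_cvg.
have /cvgryPgt/(_ 0) h := xoo.
by near=> n; rewrite /flat ifT ?hornerE ?mul1r//; near: n.
Unshelve. all: by end_near. Qed.

(** Two scales are at work. With m = [n.+1], the first argument is m + m^2 (s - a): at s = a it is m
    and tends to infinity, while for s < a the quadratic term wins. Hence convergence to the
    half-open indicator holds at every point, endpoints included. *)
Lemma smooth_indic_cvg a b s :
  smooth_indic a b n s @[n --> \oo] --> (\1_(`[a, b[%classic) s : R).
Proof.
have noo : (n.+1%:R : R) @[n --> \oo] --> +oo
  by rewrite (cvg_shiftS (fun n : nat => (n%:R : R))); exact: cvgr_idn.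
have [sa|sa] := ltP s a.
  rewrite indicE memNset; last by rewrite /= in_itv/= leNgt sa.
  (* After this shift m exceeds 1/(a - s) for every n, so that m + m^2 (s - a) is nonpositive. *)
  rewrite -(@cvg_shiftn (Num.truncn (a - s)^-1)).
  apply: cvg_near_cst; near=> n.
  rewrite /= /smooth_indic {1}/flat ifN ?mul0r// -leNgt.
  set m := ((n + _).+1%:R : R).
  have m0 : 0 < m by [].
  have : (a - s)^-1 < m.
    by apply: lt_le_trans (truncnS_gt _) _; rewrite ler_nat ltnS leq_addl.
  rewrite invf_plt ?posrE ?subr_gt0// => h.
  have : m * m^-1 < m * (a - s) by rewrite ltr_pM2l.
  rewrite divff ?gt_eqF// => h1.
  have : 0 <= m * (m * (a - s) - 1) by rewrite mulr_ge0 ?ltW//; lra.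
  by nra.
have [sb|sb] := ltP s b; last first.
  rewrite indicE memNset; last by rewrite /= in_itv/= ltNge sb andbF.
  apply: cvg_near_cst; near=> n.
  rewrite /= /smooth_indic mulrC {1}/flat ifN ?mul0r// -leNgt.
  rewrite mulNr addrC subr_le0 ler_wpM2l// exprn_ge0//.
rewrite indicE mem_set; last by rewrite /= in_itv/= sa sb.
rewrite -[X in _ --> X](mulr1 (1 : R)).
apply: cvgM; apply: flat1_cvg1.
  apply: (@ger_cvgy _ _ _ _ (fun n => n.+1%:R)) => //; near=> n.
  rewrite (_ : _ + _ = n.+1%:R + n.+1%:R ^+ 2 * (s - a)); last by ring.
  by rewrite lerDl mulr_ge0// ?subr_ge0// exprn_ge0.
apply: (@ger_cvgy _ _ _ _ (fun n => n.+1%:R * (b - s))); last first.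
  have bs : 0 < b - s by rewrite subr_gt0.
  apply/cvgryPge => A; move/cvgryPge : noo => /(_ (A / (b - s))).
  by apply: filterS => n; rewrite ler_pdivrMr.
near=> n.
rewrite [leRHS](_ : _ = n.+1%:R * (n.+1%:R * (b - s))); last by ring.
by rewrite ler_peMl ?ler1n// mulr_ge0// subr_ge0 ltW.
Unshelve. all: by end_near. Qed.

End flat.

Section primitive.
Context {R : realType}.
Notation mu := (@lebesgue_measure R).

Lemma continuous_primitive (f : R -> R) (L : R) : continuous f ->
  (forall s, s <= L -> f s = 0) ->
  exists B : R -> R, forall s : R, is_derive s 1 B (f s).
Proof.
move=> cf f0.
(* Starting at L - 1 keeps every s >= L in the interior, where the fundamental theorem of calculus
   applies; near a point s < L the primitive is constantly 0. *)
pose B (x : R) := (\int[mu]_(t in `[L - 1, x]) f t)%R.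
exists B => s; have [sL|sL] := ltP s L.
  rewrite f0 ?(ltW sL)//.
  apply: (@near_eq_is_derive _ _ _ (cst 0)) => //.
  near=> x; rewrite /B (_ : \int[mu]_(t in `[L - 1, x]) f t = 0)%R//.
  rewrite (@eq_Rintegral _ _ _ _ _ (cst 0)).
    by rewrite /Rintegral integral0.
  move=> y; rewrite inE/= in_itv/= => /andP[_ yx]; apply: f0.
  apply: (le_trans yx); near: x.
  by apply: filterS (lt_nbhsl sL) => x /ltW.
have intf : mu.-integrable `[L - 1, s + 1] (EFin \o f).
  apply: continuous_compact_integrable; first exact: segment_compact.
  exact: continuous_subspaceT.
have s1 : s < s + 1 by rewrite ltrDl.
have Ls : L - 1 < s by lra.
have [dB <-] := @continuous_FTC1_closed _ f (L - 1) s (s + 1) s1 intf Ls (cf s).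
by apply: DeriveDef => //; rewrite derive1E.
Unshelve. all: by end_near. Qed.

Lemma integral_reversed_primitive (f B : R -> R) (s t : R) :
  (forall s : R, is_derive s 1 B (f s)) -> continuous f -> 0 <= t ->
  (\int[mu]_(r in `[0%R, t]) f (s - r) = B s - B (s - t))%R.
Proof.
move=> dB cf t0.
have dF (x : R) : is_derive x 1 (fun r => - B (s - r)) (f (s - x)).
  have d1 : is_derive x 1 (fun r : R => s - r) (0 - 1).
    exact: (is_deriveB (is_derive_cst s x 1) (is_derive_id x 1)).
  have d2 := @is_derive1_comp _ B (fun r => s - r) x _ _ (dB (s - x)) d1.
  have d3 := is_deriveN d2.
  by apply: is_derive_eq d3 _; rewrite sub0r mulrN1 opprK.
have cg : continuous (fun r => f (s - r)).
  move=> x; apply: continuous_comp; last exact: cf.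
  by apply: cvgB; [exact: cvg_cst|exact: cvg_id].
have [->|t_neq0] := eqVneq t 0.
  by rewrite set_itv1 Rintegral_set1 subr0 subrr.
have tp : 0 < t by rewrite lt_neqAle eq_sym t_neq0.
rewrite /Rintegral (@continuous_FTC2 _ _ (fun r => - B (s - r)) _ _ tp).
- by rewrite /= subr0; ring.
- exact: continuous_subspaceT.
- have cB x : {for x, continuous (fun r => - B (s - r))}.
    by apply/differentiable_continuous/derivable1_diffP; have [] := dF x.
  split.
  + by move=> x _; have [] := dF x.
  + by apply: cvg_at_right_filter; exact: cB.
  + by apply: cvg_at_left_filter; exact: cB.
- by move=> x _; rewrite derive1E; have [_ ->] := dF x.
Qed.

End primitive.

(** * Tensor products of functions of one variable *)

Section tensor.
Context {R : realType} {N : nat}.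
Implicit Types (f : 'I_N -> R -> R) (x : 'rV[R]_N).

Definition tensor f x : R := \prod_i f i (x ord0 i).

Lemma continuous_tensor f : (forall i, continuous (f i)) -> continuous (tensor f).
Proof.
move=> cf; rewrite /tensor; elim: (index_enum _) => [|i r IH].
  by under eq_fun do rewrite big_nil; exact: cst_continuous.
under eq_fun do rewrite big_cons.
move=> x; apply: continuousM; last exact: IH.
apply: (@continuous_comp _ _ _ (fun x : 'rV[R]_N => x ord0 i) (f i)).
  exact: coord_continuous.
exact: cf.
Qed.

Lemma is_derive_tensor f (i : 'I_N) (f' : R -> R) x :
  (forall s : R, is_derive s 1 (f i) (f' s)) ->
  is_derive x (delta_mx ord0 i) (tensor f)
    (tensor (fun j => if j == i then f' else f j) x).
Proof.
move=> df.
pose c := \prod_(j < N | j != i) f j (x ord0 j).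
(* Along the i-th axis all other factors are frozen, so the difference quotient is that of a
   multiple of [f i]. *)
have E (h : R) : tensor f (h *: delta_mx ord0 i + x) = c * f i (h + x ord0 i).
  rewrite /tensor (bigD1 i)//= !mxE !eqxx mulr1 mulrC; congr (_ * _).
  apply: eq_bigr => j ji; rewrite !mxE (negbTE ji) andbF mulr0 add0r//.
have dc : is_derive (x ord0 i) 1 (fun s => c * f i s) (c *: f' (x ord0 i)).
  exact: is_deriveZ.
have G : (fun h : R => h^-1 *: ((tensor f \o shift x) (h *: delta_mx ord0 i) - tensor f x))
  = (fun h : R => h^-1 *: (((fun s => c * f i s) \o shift (x ord0 i)) (h *: 1) - c * f i (x ord0 i))).
  apply/funext => h; rewrite /= E; congr (_ *: (_ - _)).
    by rewrite [h *: 1]mulr1.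
  by have := E 0; rewrite scale0r !add0r.
have -> : tensor (fun j => if j == i then f' else f j) x = c *: f' (x ord0 i).
  rewrite /tensor (bigD1 i)//= eqxx mulrC; congr (_ * _).
  by apply: eq_bigr => j /negbTE ->.
case: dc => dc1 dc2; apply: DeriveDef.
  by rewrite /derivable G.
by rewrite /derive G.
Qed.

Lemma partial_tensor f (i : 'I_N) (f' : R -> R) :
  (forall s : R, is_derive s 1 (f i) (f' s)) ->
  partial i (tensor f) = tensor (fun j => if j == i then f' else f j).
Proof.
by move=> df; apply/funext => x; have [] := is_derive_tensor x df.
Qed.

Lemma class_C_tensor k f : (forall i, has_flat_deriv (f i)) -> class_C k (tensor f).
Proof.
elim: k f => [|k IH] f hf /=.
  by apply: continuous_tensor => i; exact: has_flat_deriv_continuous.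
split; first by apply: continuous_tensor => i; exact: has_flat_deriv_continuous.
move=> i; have [f' af' df] := hf i; split.
  by move=> x; have [] := is_derive_tensor x df.
rewrite (partial_tensor df); apply: IH => j.
by case: eqP => // _; exact: flat_algebra_deriv.
Qed.

Lemma test_function_tensor f (l u : R) : (forall i, has_flat_deriv (f i)) ->
  (forall i s, f i s != 0 -> l <= s <= u) -> test_function (tensor f).
Proof.
move=> hf lu; split; first by move=> k; exact: class_C_tensor.
pose K := [set x : 'rV[R]_N | forall i, `[l, u]%classic (x ord0 i)].
have cK : compact K.
  by apply: (@rV_compact _ N (fun=> `[l, u]%classic)) => i; exact: segment_compact.
apply: (subclosed_compact _ cK); first exact: closed_closure.
rewrite [X in _ `<=` X](closure_id K).1; last first.
  by apply: compact_closed => //; exact: norm_hausdorff.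
apply: closure_subset => x /= xn0 i; rewrite /= in_itv/=.
apply: (lu i); apply: contra_neq xn0 => fi0.
by rewrite /tensor (bigD1 i)//= fi0 mul0r.
Qed.

End tensor.

(** * Integrals against locally integrable functions *)

Section locally_integrable.
Context {R : realType} {N : nat}.
Local Notation leb := (@lebesgue_measure_rV R N).
Implicit Types (v h : 'rV[R]_N -> R) (K : set 'rV[R]_N).

Lemma integrable_loc_mul v h K (C : R) : locally_integrable_rV v ->
  compact K -> measurable K -> measurable_fun setT h ->
  (forall x, `|h x| <= C * \1_K x) ->
  leb.-integrable setT (fun x => (v x * h x)%:E).
Proof.
move=> [mv iv] cK mK mh hC.
have iK : leb.-integrable setT (fun x => (`|v x| * \1_K x)%:E).
  have : leb.-integrable K (EFin \o v).
    apply/integrableP; split; last exact: iv.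
    by apply/measurable_EFinP; exact: measurable_funS mv.
  move=> /integrable_abse /(integrable_mkcond _ mK); apply: eq_integrable => //.
  by move=> x _; rewrite /= patchE indicE; case: ifPn => _; rewrite ?mulr1 ?mulr0.
apply: (@le_integrable _ _ _ _ setT measurableT _
  (fun x => C%:E * (`|v x| * \1_K x)%:E)%E); last exact: integrableZl.
- by apply/measurable_EFinP; exact: measurable_funM.
- move=> x _; rewrite -EFinM /= lee_fin normrM.
  have C0 : 0 <= C * \1_K x by apply: le_trans (hC x).
  rewrite mulrCA normrM normr_id ler_wpM2l//.
  by rewrite (le_trans (hC x))// ler_norm.
Qed.

Lemma measurable_fun_cvgr (h_ : nat -> 'rV[R]_N -> R) h :
  (forall n, measurable_fun setT (h_ n)) ->
  (forall x, h_ n x @[n --> \oo] --> h x) -> measurable_fun setT h.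
Proof.
move=> mh hh; apply/measurable_EFinP.
apply: (emeasurable_fun_cvg (fun n => EFin \o h_ n)).
- by move=> n; exact/measurable_EFinP.
- by move=> x _; apply: cvg_EFin; [exact: nearW|exact: hh].
Qed.

Lemma Rintegral_loc_cvg v (h_ : nat -> 'rV[R]_N -> R) h K (C : R) :
  locally_integrable_rV v -> compact K -> measurable K ->
  (forall n, measurable_fun setT (h_ n)) ->
  (forall n x, `|h_ n x| <= C * \1_K x) ->
  (forall x, h_ n x @[n --> \oo] --> h x) ->
  \int[leb]_x (v x * h_ n x) @[n --> \oo] --> \int[leb]_x (v x * h x).
Proof.
move=> lv cK mK mh hC hh.
have mhl := measurable_fun_cvgr mh hh.
have hlC x : `|h x| <= C * \1_K x.
  apply: (ler_cvg_to (cvg_norm (hh x)) (cvg_cst (C * \1_K x))).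
  by apply: nearW => n; exact: hC.
have mv : measurable_fun setT v by case: lv.
have mg : measurable_fun setT (fun x => C * \1_K x) by exact: measurable_funM.
have gC x : `|C * \1_K x| <= C * \1_K x.
  by rewrite ger0_norm// (le_trans _ (hlC x)).
have [] // := @dominated_convergence _ _ _ leb setT measurableT
  (fun n x => (v x * h_ n x)%:E) (fun x => (v x * h x)%:E)
  (fun x => (`|v x * (C * \1_K x)|)%:E).
- by move=> n; apply/measurable_EFinP; exact: measurable_funM.
- by apply/measurable_EFinP; exact: measurable_funM.
- apply: aeW => x _; apply: cvg_EFin; first exact: nearW.
  by apply: cvgM; [exact: cvg_cst|exact: hh].
- exact: integrable_abse (integrable_loc_mul lv cK mK mg gC).
- apply: aeW => x n _; rewrite /= lee_fin !normrM ler_wpM2l//.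
  by rewrite -normrM (le_trans (hC n x))// ler_norm.
move=> _ _ H; apply: fine_cvg => /=; rewrite fineK//.
exact: integrable_fin_num (integrable_loc_mul lv cK mK mhl hlC).
Qed.

(** The bridge between the signed integrals in the definition of a weak gradient and the nonnegative
    ones to which Tonelli's theorem and the comparison on boxes apply. *)
Lemma Rintegral_posneg v h K (C : R) : locally_integrable_rV v ->
  compact K -> measurable K -> measurable_fun setT h ->
  (forall x, 0 <= h x <= C * \1_K x) ->
  let vp x := (Num.max (v x) 0 * h x)%:E in
  let vn x := (Num.max (- v x) 0 * h x)%:E in
  [/\ (\int[leb]_x vp x \is a fin_num)%E, (\int[leb]_x vn x \is a fin_num)%E &
  \int[leb]_x (v x * h x) =
  fine (\int[leb]_x vp x) - fine (\int[leb]_x vn x)].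
Proof.
move=> lv cK mK mh hC vp vn.
have hn x : `|h x| <= C * \1_K x by have /andP[/ger0_norm ->] := hC x.
have mv : measurable_fun setT v by case: lv.
have intv := integrable_loc_mul lv cK mK mh hn.
have ip : leb.-integrable setT vp.
  apply: (le_integrable _ _ _ intv) => //.
    apply/measurable_EFinP; apply: measurable_funM => //.
    exact: measurable_funrpos.
  move=> x _; rewrite /vp /= lee_fin !normrM ler_wpM2r//.
  case: (leP (v x) 0) => v0; last by rewrite lexx.
  by rewrite normr0.
have iN : leb.-integrable setT vn.
  apply: (le_integrable _ _ _ intv) => //.
    apply/measurable_EFinP; apply: measurable_funM => //.
    exact: measurable_funrneg.
  move=> x _; rewrite /vn /= lee_fin !normrM ler_wpM2r//.
  case: (leP (- v x) 0) => v0; last by rewrite normrN lexx.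
  by rewrite normr0.
split; [exact: integrable_fin_num|exact: integrable_fin_num|].
rewrite /Rintegral (_ : (fun x => (v x * h x)%:E) = (fun x => (vp x - vn x)%E)).
  by rewrite integralB//= fineB//; exact: integrable_fin_num.
apply/funext => x; rewrite /vp /vn /= -EFinB -mulrBl; congr (_ * _)%:E.
by case: (leP (v x) 0) => v0; case: (leP (- v x) 0) => v1; lra.
Qed.

End locally_integrable.

(** * Translates of functions with a weak gradient *)

Section weak_shift.
Context {R : realType} {N : nat}.
Local Notation leb := (@lebesgue_measure_rV R N).
Notation mu := (@lebesgue_measure R).
Implicit Types (i j : 'I_N) (x y : 'rV[R]_N).

Lemma measurable_tensor (f : 'I_N -> R -> R) :
  (forall j, measurable_fun setT (f j)) -> measurable_fun setT (tensor f).
Proof.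
move=> mf; rewrite /tensor; elim: (index_enum _) => [|j r IH].
  by under eq_fun do rewrite big_nil; exact: measurable_cst.
under eq_fun do rewrite big_cons.
by apply: measurable_funM => //; apply: measurableT_comp => //; exact: measurable_coord.
Qed.

Lemma cvg_tensor (f_ : nat -> 'I_N -> R -> R) (f : 'I_N -> R -> R) x :
  (forall j s, f_ n j s @[n --> \oo] --> f j s) ->
  tensor (f_ n) x @[n --> \oo] --> tensor f x.
Proof.
move=> ff; rewrite /tensor; elim: (index_enum _) => [|j r IH].
  by rewrite big_nil; under eq_fun do rewrite big_nil; exact: cvg_cst.
rewrite big_cons; under eq_fun do rewrite big_cons.
by apply: cvgM => //; exact: ff.
Qed.

Lemma tensor_indic (a b : 'rV[R]_N) x :
  tensor (fun j => \1_(`[a ord0 j, b ord0 j[%classic)) x = \1_(box a b) x.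
Proof.
rewrite /tensor [RHS]indicE; have [xA|xA] := boolP (x \in box a b).
  rewrite big1// => j _; rewrite indicE mem_set// /= in_itv/=.
  by move: xA; rewrite inE; exact.
have [j hj] : exists j, ~ (a ord0 j <= x ord0 j < b ord0 j).
  by apply/existsNP => h; move/negP: xA; apply; rewrite inE.
by rewrite (bigD1 j)//= indicE memNset ?mul0r//= in_itv.
Qed.

Definition smooth_box (a b : 'rV[R]_N) n :=
  tensor (fun j => smooth_indic (a ord0 j) (b ord0 j) n).

Lemma smooth_box_cvg (a b : 'rV[R]_N) x :
  smooth_box a b n x @[n --> \oo] --> (\1_(box a b) x : R).
Proof.
rewrite -tensor_indic.
by apply: (@cvg_tensor (fun n j => smooth_indic (a ord0 j) (b ord0 j) n)) => j s;
  exact: smooth_indic_cvg.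
Qed.

Lemma smooth_box_itv (a b : 'rV[R]_N) n x : 0 <= smooth_box a b n x <= 1.
Proof.
rewrite /smooth_box /tensor; apply/andP; split.
  by apply: prodr_ge0 => j _; have /andP[] := smooth_indic_itv (a ord0 j) (b ord0 j) n (x ord0 j).
apply: prodr_ile1 => j _; exact: smooth_indic_itv.
Qed.

Lemma smooth_box_supp (a b : 'rV[R]_N) n x : smooth_box a b n x != 0 ->
  forall j, a ord0 j - 1 < x ord0 j < b ord0 j.
Proof.
move=> h j; apply: (@smooth_indic_supp _ _ _ n); apply: contra_neq h => h.
by rewrite /smooth_box /tensor (bigD1 j)//= h mul0r.
Qed.

Lemma measurable_smooth_box (a b : 'rV[R]_N) n :
  measurable_fun setT (smooth_box a b n).
Proof.
apply: measurable_tensor => j; apply: continuous_measurable_fun.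
exact/flat_algebra_continuous/flat_algebra_smooth_indic.
Qed.

Definition cube (M : R) : set 'rV[R]_N :=
  [set x | forall j, `[- M, M]%classic (x ord0 j)].

Lemma compact_cube M : compact (cube M).
Proof.
apply: (@rV_compact _ N (fun=> `[- M, M]%classic)) => j.
exact: segment_compact.
Qed.

Lemma measurable_cube M : measurable (cube M).
Proof.
apply: measurable_forall_ord => j.
by rewrite -[X in measurable X]setTI; exact: measurable_coord.
Qed.

Lemma measurable_line i x : measurable_fun setT
  (fun r : measurableTypeR R => x + (r : R) *: delta_mx ord0 i).
Proof.
apply: measurable_fun_rV => j; under eq_fun do rewrite !mxE.
by apply: measurable_funD => //; exact: measurable_funM.
Qed.

Lemma measurable_lines i : measurable_fun setT
  (fun z : 'rV[R]_N * measurableTypeR R => z.1 + (z.2 : R) *: delta_mx ord0 i).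
Proof.
apply: measurable_fun_rV => j; under eq_fun do rewrite !mxE.
apply: measurable_funD.
  exact: (measurableT_comp (measurable_coord j) measurable_fst).
by apply: measurable_funM => //; exact: measurable_snd.
Qed.

(* A tensor test function whose [i]-th partial derivative is the difference
   between [f] and its translate by [t] in direction [i], when [f] is a tensor
   of smooth functions. *)
Definition sweep i (t : R) (f : 'rV[R]_N -> R) x : R :=
  (\int[mu]_(r in `[0%R, t]) f (x - r *: delta_mx ord0 i))%R.

Section sweep.
Variables (i : 'I_N) (t : R) (a b : 'rV[R]_N).
Hypothesis t0 : 0 <= t.
Let e : 'rV[R]_N := delta_mx ord0 i.

Let coordB x r j : (x - r *: e) ord0 j = x ord0 j - (if j == i then r else 0).
Proof. by rewrite !mxE /=; case: eqP; rewrite ?mulr1 ?mulr0. Qed.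

Lemma mu_itv0t : mu `[0%R, t]%classic = t%:E.
Proof.
rewrite lebesgue_measure_itv/= lte_fin; case: ltP => [_|t_le0].
  by rewrite -EFinB subr0.
by congr EFin; apply/eqP; rewrite eq_le t0 t_le0.
Qed.

Lemma measurable_line_comp (f : 'rV[R]_N -> R) x : measurable_fun setT f ->
  measurable_fun setT (fun r : measurableTypeR R => f (x - (r : R) *: e)).
Proof.
move=> mf; apply: (measurableT_comp mf).
apply: measurable_fun_rV => j; under eq_fun do rewrite coordB.
by apply: measurable_funB => //; case: eqP.
Qed.

Lemma sweep_bounded (f : 'rV[R]_N -> R) x : measurable_fun setT f ->
  (forall y, 0 <= f y <= 1) ->
  mu.-integrable `[0%R, t] (fun r => (f (x - r *: e))%:E) /\
  0 <= sweep i t f x <= t.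
Proof.
move=> mf f01.
have fin : (mu `[0%R, t]%classic < +oo)%E by rewrite mu_itv0t ltry.
have int1 : mu.-integrable `[0%R, t] (EFin \o (cst 1 : R -> R)).
  by apply: measurable_bounded_integrable => //; exact: bounded_cst.
have intf : mu.-integrable `[0%R, t] (fun r => (f (x - r *: e))%:E).
  apply: (le_integrable _ _ _ int1) => //.
    apply/measurable_EFinP; apply: measurable_funS (measurable_line_comp x mf) => //.
  move=> r _ /=; rewrite lee_fin normr1; have /andP[? ?] := f01 (x - r *: e).
  by rewrite ger0_norm.
split => //; rewrite /sweep; apply/andP; split.
  by apply: Rintegral_ge0 => r _; have /andP[] := f01 (x - r *: delta_mx ord0 i).
apply: le_trans (_ : \int[mu]_(r in `[0%R, t]) (1 : R) <= _).
  apply: le_Rintegral => // r _; have /andP[_] := f01 (x - r *: delta_mx ord0 i) => //.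
by rewrite Rintegral_cst// mul1r -[leRHS]/(fine t%:E) -mu_itv0t.
Qed.

Lemma sweep_smooth_box_cvg x :
  sweep i t (smooth_box a b n) x @[n --> \oo] --> sweep i t \1_(box a b) x.
Proof.
have m1 : measurable_fun setT (\1_(box a b) : 'rV[R]_N -> R).
  by apply: measurable_indic; exact: measurable_box.
have fin : (mu `[0%R, t]%classic < +oo)%E by rewrite mu_itv0t ltry.
have [] // := @dominated_convergence _ _ _ mu `[0%R, t]%classic (measurable_itv _)
  (fun n r => (smooth_box a b n (x - r *: e))%:E)
  (fun r => (\1_(box a b) (x - r *: e))%:E) (cst 1%:E).
- move=> n; apply/measurable_EFinP.
  apply: measurable_funS (measurable_line_comp x _) => //.
  exact: measurable_smooth_box.
- by apply/measurable_EFinP; apply: measurable_funS (measurable_line_comp x _).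
- apply: aeW => r _; apply: cvg_EFin; first exact: nearW.
  exact: smooth_box_cvg.
- apply: (@measurable_bounded_integrable _ _ _ _ (cst 1)) => //; exact: bounded_cst.
- apply: aeW => r n _; rewrite /= lee_fin.
  by have /andP[? ?] := smooth_box_itv a b n (x - r *: e); rewrite ger0_norm.
move=> _ _ H; apply: fine_cvg => /=; rewrite fineK//.
apply: integrable_fin_num => //.
apply: (sweep_bounded x m1 _).1 => y.
by rewrite indicE; case: (_ \in _); rewrite lexx ler01.
Qed.

(** Only the i-th factor changes: it becomes c(s) = B(s) - B(s - t), with B a primitive of the i-th
    profile. Its derivative is the profile minus its translate, and it vanishes as soon as the
    window [s - t, s] misses the support of the profile. *)
Lemma sweep_smooth_box n : exists f : 'I_N -> R -> R,
  [/\ (forall j, has_flat_deriv (f j)),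
      (forall j (s : R), f j s != 0 -> a ord0 j - 1 <= s <= b ord0 j + t),
      sweep i t (smooth_box a b n) = tensor f &
      partial i (tensor f) =
        fun x => smooth_box a b n x - smooth_box a b n (x - t *: e)].
Proof.
pose be j := smooth_indic (a ord0 j) (b ord0 j) n.
have abe j : flat_algebra (be j) by exact: flat_algebra_smooth_indic.
have [B dB] : exists B : R -> R, forall s : R, is_derive s 1 B (be i s).
  apply: (@continuous_primitive _ _ (a ord0 i - 1)).
    exact: flat_algebra_continuous.
  move=> s sa; apply: contraTeq sa => /smooth_indic_supp/andP[h _].
  by rewrite -ltNge.
pose c s := B s - B (s - t).
have dBt (s : R) : is_derive s 1 (fun s => B (s - t)) (be i (s - t)).
  have d1 : is_derive s 1 (fun s : R => s - t) 1.
    have := is_deriveB (is_derive_id s (1 : R)) (is_derive_cst t s 1).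
    by move=> h; apply: is_derive_eq h _; rewrite subr0.
  have := @is_derive1_comp _ B (fun s => s - t) s _ _ (dB (s - t)) d1.
  by move=> h; apply: is_derive_eq h _; rewrite mulr1.
have dc (s : R) : is_derive s 1 c (be i s - be i (s - t)) by exact: is_deriveB.
have adc : flat_algebra (fun s => be i s - be i (s - t)).
  (* The translate by t is of flat type again once the shift is absorbed into the constant terms of
     the two affine arguments. *)
  rewrite (_ : (fun s => _) = fun s => be i s + -1 *
    (flat 1 (n.+1%:R ^+ 2 * s + (n.+1%:R - n.+1%:R ^+ 2 * a ord0 i - n.+1%:R ^+ 2 * t)) *
     flat 1 (- n.+1%:R ^+ 2 * s + (n.+1%:R ^+ 2 * b ord0 i + n.+1%:R ^+ 2 * t)))).
    apply: flat_algebraD; first exact: abe.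
    by apply/flat_algebraZ/flat_algebraM; exact: flat_algebra_flat.
  apply/funext => s; rewrite mulN1r; congr (_ - _).
  by rewrite /be /smooth_indic; congr (flat 1 _ * flat 1 _); ring.
have cE s : c s = (\int[mu]_(r in `[0%R, t]) be i (s - r))%R.
  rewrite (@integral_reversed_primitive _ (be i) B)//.
  exact: flat_algebra_continuous.
exists (fun j => if j == i then c else be j); split.
- move=> j; case: eqP => _; last exact: flat_algebra_deriv.
  by exists (fun s => be i s - be i (s - t)).
- move=> j s /=; have [->|_] := eqVneq j i; last first.
    move/smooth_indic_supp => /andP[h1 h2]; apply/andP; split; first exact: ltW.
    by rewrite (le_trans (ltW h2))// lerDl.
  apply: contra_neqT => h; rewrite cE (@eq_Rintegral _ _ _ _ _ (cst 0)).
    by rewrite /Rintegral integral0.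
  move=> r; rewrite inE/= in_itv/= => /andP[r0 rt].
  apply/eqP; apply: contraNT h => /smooth_indic_supp/andP[h1 h2].
  by apply/andP; split; lra.
- apply/funext => x; rewrite /sweep /smooth_box /tensor (bigD1 i)//= eqxx.
  pose p := \prod_(j < N | j != i) be j (x ord0 j).
  rewrite [X in _ * X](_ : _ = p); last by apply: eq_bigr => j /negbTE ->.
  have cbe : continuous (fun r => be i (x ord0 i - r)).
    move=> r; apply: (@continuous_comp _ _ _ (fun r => x ord0 i - r) (be i)).
      by apply: cvgB; [exact: cvg_cst|exact: cvg_id].
    exact: flat_algebra_continuous.
  rewrite cE -RintegralZr//; last first.
    apply: continuous_compact_integrable; first exact: segment_compact.
    exact: continuous_subspaceT.
  apply: eq_Rintegral => r _; rewrite (bigD1 i)//= coordB eqxx; congr (_ * _).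
  by apply: eq_bigr => j /negbTE ji; rewrite coordB ji subr0.
- have dci (s : R) : is_derive s 1 ((fun j => if j == i then c else be j) i)
    (be i s - be i (s - t)) by rewrite eqxx; exact: dc.
  rewrite (partial_tensor dci).
  apply/funext => x; rewrite /smooth_box /tensor (bigD1 i)//= eqxx mulrBl.
  congr (_ - _); rewrite [RHS](bigD1 i)//=.
    by congr (_ * _); apply: eq_bigr => j /negbTE ->.
  rewrite coordB eqxx; congr (_ * _).
  by apply: eq_bigr => j /negbTE ji; rewrite ji coordB ji subr0.
Qed.

End sweep.
End weak_shift.

(** * The weak gradient tested against boxes *)

Section weak_box.
Context {R : realType} {N : nat}.
Local Notation leb := (@lebesgue_measure_rV R N).
Notation mu := (@lebesgue_measure R).
Variables (i : 'I_N) (t : R).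
Hypothesis t0 : 0 <= t.
Let e : 'rV[R]_N := delta_mx ord0 i.
Implicit Types (a b x y : 'rV[R]_N).

Lemma box_in_cube a b : exists M : R, forall n (r : R) x, 0 <= r <= t ->
  smooth_box a b n (x - r *: e) != 0 -> cube M x.
Proof.
have [k hk] := rV_natbound a; have [l hl] := rV_natbound b.
(* The 1 is the margin of the smooth profiles to the left of [a], and t is the largest shift. *)
exists (k%:R + l%:R + 1 + t) => n r x /andP[r0 rt] /smooth_box_supp h j.
have := h j; have := hk j; have := hl j; rewrite !mxE/= !ltr_norml in_itv/=.
have k0 : (0 : R) <= k%:R by []. have l0 : (0 : R) <= l%:R by [].
set d := r * _.
have : 0 <= d <= t.
  by rewrite /d; case: eqP => _; rewrite ?mulr1 ?mulr0 ?r0 ?rt ?lexx ?t0.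
move=> /andP[d0 dt] /andP[b1 b2] /andP[a1 a2] /andP[h1 h2].
by apply/andP; split; lra.
Qed.

Lemma measurable_indic_shift a b y :
  measurable_fun setT (fun x => \1_(box a b) (x - y) : R).
Proof.
have m1 : measurable_fun setT (\1_(box a b) : 'rV[R]_N -> R).
  by apply: measurable_indic; exact: measurable_box.
exact: (measurableT_comp m1 (measurable_rV_shift (- y))).
Qed.

Lemma indic01 (T : Type) (A : set T) (x : T) : 0 <= (\1_A x : R) <= 1.
Proof. by rewrite indicE; case: (_ \in _); rewrite lexx ler01. Qed.

(** Majorants for dominated convergence, uniform in n; those for the sharp box are limits of those
    for the smooth boxes. *)
Lemma box_lim_in_cube a b : exists M : R,
  [/\ 
   forall n x, `|sweep i t (smooth_box a b n) x| <= t * \1_(cube M) x,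
   forall x, 0 <= sweep i t \1_(box a b) x <= t * \1_(cube M) x,
   forall n x r, 0 <= r <= t -> `|smooth_box a b n (x - r *: e)| <= \1_(cube M) x &
   forall x r, 0 <= r <= t -> 0 <= (\1_(box a b) (x - r *: e) : R) <= \1_(cube M) x].
Proof.
have [M hM] := box_in_cube a b; exists M.
have H n x r : 0 <= r <= t -> `|smooth_box a b n (x - r *: e)| <= \1_(cube M) x.
  move=> rt; have /andP[s0 s1] := smooth_box_itv a b n (x - r *: e).
  rewrite ger0_norm//; have [->|/(hM _ _ _ rt) xM] := eqVneq (smooth_box a b n (x - r *: e)) 0.
    by have /andP[] := indic01 (cube M) x.
  by rewrite indicE mem_set.
have S n x : `|sweep i t (smooth_box a b n) x| <= t * \1_(cube M) x.
  have [xM|xM] := pselect (cube M x).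
    rewrite indicE mem_set// mulr1.
    have [//|_ /andP[? ?]] := sweep_bounded i t0 x (measurable_smooth_box a b n) _.
      exact: smooth_box_itv.
    by rewrite ger0_norm.
  rewrite indicE memNset// mulr0 /sweep (@eq_Rintegral _ _ _ _ _ (cst 0)).
    by rewrite /Rintegral integral0 normr0.
  move=> r; rewrite inE/= in_itv/= => rt; apply/eqP; apply: contra_notT xM.
  exact: hM.
split => //.
- move=> x; apply/andP; split.
    by apply: Rintegral_ge0 => r _; have /andP[] := indic01 (box a b) (x - r *: delta_mx ord0 i).
  have C := sweep_smooth_box_cvg (i := i) (a := a) (b := b) t0 (x := x).
  apply: (ler_cvg_to C (cvg_cst (t * \1_(cube M) x))).
  by apply: nearW => n; apply: le_trans (S n x); exact: ler_norm.
- move=> x r rt; have /andP[-> _]/= := indic01 (box a b) (x - r *: e).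
  have C := @smooth_box_cvg _ _ a b (x - r *: e).
 apply: (ler_cvg_to C (cvg_cst (\1_(cube M) x : R))).
  by apply: nearW => n; apply: le_trans (H n x r rt); exact: ler_norm.
Qed.

Lemma measurable_sweep_smooth_box a b n :
  measurable_fun setT (sweep i t (smooth_box a b n)).
Proof.
have [f [hf _ -> _]] := sweep_smooth_box i a b t0 n.
apply: measurable_tensor => j; apply: continuous_measurable_fun.
exact: has_flat_deriv_continuous.
Qed.

Lemma measurable_sweep_indic a b :
  measurable_fun setT (sweep i t \1_(box a b)).
Proof.
apply: (measurable_fun_cvgr (measurable_sweep_smooth_box a b)) => x.
exact: sweep_smooth_box_cvg.
Qed.

(** The fundamental theorem of calculus along an axis, integrated over a box: moving the translation
    onto u turns the left side into minus the integral over the box of u(x + t e) - u(x). Sweeps of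
    smooth boxes are admissible test functions, and dominated convergence leads to the sharp box. *)
Lemma weak_grad_box (u : 'rV[R]_N -> R) (G : 'rV[R]_N -> 'rV[R]_N) a b :
  is_weak_grad u G ->
  \int[leb]_x (u x * (\1_(box a b) x - \1_(box a b) (x - t *: e))) =
  - \int[leb]_x (G x ord0 i * sweep i t \1_(box a b) x).
Proof.
move=> [lu /(_ i) [lG wG]].
have [M [S _ H _]] := box_lim_in_cube a b.
have tt : 0 <= t <= t by rewrite t0 lexx.
have oo : (0 : R) <= 0 <= t by rewrite lexx t0.
have cvR : \int[leb]_x (G x ord0 i * sweep i t (smooth_box a b n) x) @[n --> \oo]
    --> \int[leb]_x (G x ord0 i * sweep i t \1_(box a b) x).
  apply: (Rintegral_loc_cvg lG (@compact_cube _ _ M) (@measurable_cube _ _ M) _ S).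
    exact: measurable_sweep_smooth_box.
  by move=> x; exact: sweep_smooth_box_cvg.
have cvL : \int[leb]_x (u x * (smooth_box a b n x - smooth_box a b n (x - t *: e)))
    @[n --> \oo]
    --> \int[leb]_x (u x * (\1_(box a b) x - \1_(box a b) (x - t *: e))).
  apply: (@Rintegral_loc_cvg _ _ u _ _ (cube M) 2 lu).
  - exact: compact_cube.
  - exact: measurable_cube.
  - move=> n; apply: measurable_funB; first exact: measurable_smooth_box.
    exact: (measurableT_comp (measurable_smooth_box a b n) (measurable_rV_shift _)).
  - move=> n x; rewrite mulr_natl mulr2n; apply: le_trans (ler_normB _ _) _.
    apply: lerD; last exact: H.
    by have := H n x 0 oo; rewrite scale0r subr0.
  - by move=> x; apply: cvgB; exact: smooth_box_cvg.
apply: (cvg_unique _ cvL); first exact: norm_hausdorff.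
rewrite (_ : (fun n => _) = (fun n => - \int[leb]_x (G x ord0 i * sweep i t (smooth_box a b n) x))).
  exact: cvgN.
apply/funext => n; have [f [hf suppf sE pE]] := sweep_smooth_box i a b t0 n.
rewrite sE -wG; first by rewrite pE.
have [k hk] := rV_natbound a; have [l hl] := rV_natbound b.
apply: (@test_function_tensor _ _ _ (- (k%:R + 1)) (l%:R + t)) => // j s.
move=> /suppf; have := hk j; have := hl j; rewrite !ltr_norml.
by move=> /andP[? ?] /andP[? ?] /andP[? ?]; apply/andP; split; lra.
Qed.

End weak_box.

Section integral_indic.
Local Open Scope ereal_scope.
Context d (T : measurableType d) {R : realType} (m : {measure set T -> \bar R}).

Lemma integral_mul_indic (A : set T) (f : T -> \bar R) :
  \int[m]_(x in A) f x = \int[m]_x (f x * (\1_A x)%:E).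
Proof.
rewrite integral_mkcond; apply: eq_integral => x _.
by rewrite patchE indicE; case: (_ \in _); rewrite ?mule1 ?mule0.
Qed.

End integral_indic.

(** * Integration along segments parallel to an axis *)

Section shift_ae.
Local Open Scope ereal_scope.
Context {R : realType} {N : nat}.
Local Notation leb := (@lebesgue_measure_rV R N).
Notation mu := (@lebesgue_measure R).
Variables (i : 'I_N) (t : R).
Hypothesis t0 : (0 <= t)%R.
Let e : 'rV[R]_N := delta_mx ord0 i.

Let line_mul_indic (v : 'rV[R]_N -> \bar R) :=
  fun z : 'rV[R]_N * measurableTypeR R =>
  v (z.1 + (z.2 : R) *: e)%R * (\1_(`[0%R, t]%classic) (z.2 : R))%:E.

Let measurable_line_mul_indic v : measurable_fun setT v ->
  measurable_fun setT (line_mul_indic v).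
Proof.
move=> mv; apply: emeasurable_funM.
  exact: (measurableT_comp mv (measurable_lines i)).
apply/measurable_EFinP.
have m1 : measurable_fun setT (\1_(`[0%R, t]%classic) : measurableTypeR R -> R).
  exact: measurable_indic.
exact: (measurableT_comp m1 measurable_snd).
Qed.

Lemma measurable_line_integral (v : 'rV[R]_N -> \bar R) :
  measurable_fun setT v -> (forall x, 0 <= v x) ->
  measurable_fun setT (fun x : 'rV[R]_N => \int[mu]_(r in `[0%R, t]) v (x + r *: e)%R).
Proof.
move=> mv v0; under eq_fun do rewrite integral_mul_indic.
apply: (measurable_fun_fubini_tonelli_F (m2 := mu) (line_mul_indic v)).
  exact: measurable_line_mul_indic.
by move=> z; rewrite mule_ge0// lee_fin indicE.
Qed.

Lemma integral_line_integral (v : 'rV[R]_N -> \bar R) (k : 'rV[R]_N -> \bar R):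
  measurable_fun setT v -> (forall x, 0 <= v x) ->
  measurable_fun setT k -> (forall x, 0 <= k x) ->
  \int[leb]_x (k x * \int[mu]_(r in `[0%R, t]) v (x + r *: e)%R) =
  \int[mu]_(r in `[0%R, t]) \int[leb]_x (k x * v (x + r *: e)%R).
Proof.
move=> mv v0 mk k0.
have mvr r : measurable_fun setT (fun x : 'rV[R]_N => v (x + r *: e)%R).
  exact: (measurableT_comp mv (measurable_rV_shift _)).
have i0 r : 0 <= (\1_(`[0%R, t]%classic) (r : R))%:E :> \bar R.
  by rewrite lee_fin indicE.
rewrite [RHS]integral_mul_indic.
transitivity (\int[leb]_x \int[mu]_r (k x * line_mul_indic v (x, r))).
  apply: eq_integral => x _; rewrite integral_mul_indic -ge0_integralZl//.
  - apply: emeasurable_funM; last by apply/measurable_EFinP; exact: measurable_indic.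
    exact: (measurableT_comp mv (measurable_line i x)).
  - by move=> r _; rewrite mule_ge0.
rewrite (fubini_tonelli (fun z => k z.1 * line_mul_indic v z)).
- apply: eq_integral => r _; rewrite -ge0_integralZr//.
  + by apply: eq_integral => x _; rewrite /line_mul_indic/= muleA.
  + exact: emeasurable_funM.
  + by move=> x _; rewrite mule_ge0.
- apply: emeasurable_funM; last exact: measurable_line_mul_indic.
  exact: (measurableT_comp mk measurable_fst).
- by move=> z; rewrite mule_ge0// mule_ge0.
Qed.

(** Integrating backwards along e is adjoint to integrating forwards: Tonelli, then translation by r
    e for each fixed r. *)
Lemma integral_sweep (a b : 'rV[R]_N) (v : 'rV[R]_N -> \bar R) :
  measurable_fun setT v -> (forall x, 0 <= v x) ->
  \int[leb]_x (v x * (sweep i t \1_(box a b) x)%:E) =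
  \int[leb]_(x in box a b) \int[mu]_(r in `[0%R, t]) v (x + r *: e)%R.
Proof.
move=> mv v0.
have m1 : measurable_fun setT (\1_(box a b) : 'rV[R]_N -> R).
  by apply: measurable_indic; exact: measurable_box.
have i01 (T : Type) (A : set T) (x : T) : 0 <= (\1_A x)%:E :> \bar R.
  by rewrite lee_fin indicE.
rewrite [RHS]integral_mul_indic.
transitivity (\int[leb]_x ((\1_(box a b) x)%:E *
    \int[mu]_(r in `[0%R, t]) v (x + r *: e)%R)); last first.
  by apply: eq_integral => x _; exact: muleC.
rewrite integral_line_integral//; last exact/measurable_EFinP.
have mki : measurable_fun setT (fun z : 'rV[R]_N * measurableTypeR R =>
    (\1_(box a b) (z.1 - (z.2 : R) *: e))%:E *
    (\1_(`[0%R, t]%classic) (z.2 : R))%:E : \bar R).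
  apply: emeasurable_funM.
    apply/measurable_EFinP; apply: (measurableT_comp m1).
    apply: measurable_fun_rV => j; under eq_fun do rewrite !mxE.
    apply: measurable_funB.
      exact: (measurableT_comp (measurable_coord j) measurable_fst).
    by apply: measurable_funM => //; exact: measurable_snd.
  apply/measurable_EFinP.
  have m2 : measurable_fun setT (\1_(`[0%R, t]%classic) : measurableTypeR R -> R).
    exact: measurable_indic.
  exact: (measurableT_comp m2 measurable_snd).
transitivity (\int[leb]_x \int[mu]_r (v x *
    ((\1_(box a b) (x - r *: e))%:E * (\1_(`[0%R, t]%classic) r)%:E))).
  apply: eq_integral => x _; rewrite ge0_integralZl//; last first.
    exact: (measurableT_comp mki (pair1_measurable x)).
  rewrite -integral_mul_indic /sweep /Rintegral fineK//.
  apply: integrable_fin_num => //.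
  apply: (sweep_bounded i t0 x m1 _).1 => y.
  exact: indic01.
rewrite (fubini_tonelli (fun z : 'rV[R]_N * measurableTypeR R => v z.1 * ((\1_(box a b) (z.1 - (z.2 : R) *: e))%:E *
    (\1_(`[0%R, t]%classic) (z.2 : R))%:E))).
- rewrite [RHS]integral_mul_indic; apply: eq_integral => r _ /=.
  rewrite -(ge0_integral_shift (r *: e)) /=.
  + rewrite -ge0_integralZr//.
    * by apply: eq_integral => x _; rewrite addrK muleA (muleC (v _)).
    * apply: emeasurable_funM; first exact/measurable_EFinP.
      exact: (measurableT_comp mv (measurable_rV_shift _)).
    * by move=> x _; rewrite mule_ge0.
  + apply: emeasurable_funM => //.
    exact: (measurableT_comp mki (pair2_measurable r)).
  + by move=> x; rewrite mule_ge0// mule_ge0.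
- apply: emeasurable_funM => //.
  exact: (measurableT_comp mv measurable_fst).
- by move=> z; rewrite mule_ge0// mule_ge0.
Qed.

End shift_ae.

Section jensen.
Local Open Scope ereal_scope.
Context d (T : measurableType d) {R : realType} (m : {measure set T -> \bar R}).

(** Hoelder's inequality against the indicator of A, whose conjugate norm to the power p is v^(p -
    1) because p = q (p - 1). *)
Lemma integral_powR_le (A : set T) (f : T -> R) (v p : R) :
  measurable A -> m A = v%:E -> (0 <= v)%R -> (1 < p)%R ->
  measurable_fun setT f -> (forall x, 0 <= f x)%R ->
  (\int[m]_(x in A) (f x)%:E) `^ p <=
  (v `^ (p - 1))%:E * \int[m]_(x in A) (f x `^ p)%:E.
Proof.
move=> mA mAv v0 p1 mf f0.
have p0 : (0 < p)%R by apply: lt_trans p1.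
have p_neq0 : p != 0%R by rewrite gt_eqF.
have p1_neq0 : (p - 1 != 0)%R by rewrite gt_eqF// subr_gt0.
pose q := (p / (p - 1))%R.
have q0 : (0 < q)%R by rewrite divr_gt0// subr_gt0.
have q_neq0 : q != 0%R by rewrite gt_eqF.
have pq : (p^-1 + q^-1 = 1)%R by rewrite /q; field; apply/andP.
have m1 : measurable_fun setT (\1_A : T -> R) by exact: measurable_indic.
have mg : measurable_fun setT (fun x => f x * \1_A x)%R by exact: measurable_funM.
have H := hoelder m mg m1 p0 q0 pq.
have g0 x : (0 <= f x * \1_A x)%R by rewrite mulr_ge0// indicE.
have E1 : 'N[m]_1[EFin \o ((fun x => f x * \1_A x) \* \1_A)%R] = \int[m]_(x in A) (f x)%:E.
  rewrite Lnorm1 [RHS]integral_mul_indic; apply: eq_integral => x _ /=.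
  rewrite -EFinM; congr EFin.
  rewrite ger0_norm; last by rewrite mulr_ge0 ?indicE.
  by rewrite indicE; case: (_ \in _); rewrite ?mulr1 ?mulr0.
have E2 : 'N[m]_p%:E[EFin \o (fun x => f x * \1_A x)%R] `^ p =
    \int[m]_(x in A) (f x `^ p)%:E.
  rewrite poweR_Lnorm// [RHS]integral_mul_indic; apply: eq_integral => x _ /=.
  rewrite ger0_norm// -EFinM; congr EFin.
  by rewrite indicE; case: (_ \in _); rewrite ?mulr1 ?mulr0 ?powR0.
have E3 : 'N[m]_q%:E[EFin \o \1_A] `^ p = (v `^ (p - 1))%:E.
  have -> : 'N[m]_q%:E[EFin \o \1_A] `^ p = 'N[m]_q%:E[EFin \o \1_A] `^ (q * (p - 1)).
    by congr (_ `^ _); rewrite /q; field.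
  rewrite poweRrM poweR_Lnorm// -poweR_EFin -mAv; congr (_ `^ _).
  rewrite -[X in _ = m X](setIT A) -integral_indic//; apply: eq_integral => x _ /=.
  by rewrite indicE; case: (_ \in _); rewrite /= ?normr1 ?normr0 ?powR1 ?powR0.
rewrite -E1; apply: le_trans (gt0_ler_poweR (ltW p0) _ _ H) _.
- by rewrite in_itv/= Lnorm_ge0 leey.
- by rewrite in_itv/= mule_ge0 ?Lnorm_ge0// leey.
- by rewrite poweRM ?Lnorm_ge0// E2 E3 muleC.
Qed.

End jensen.

Lemma normr_maxD {R : realType} (z : R) :
  `|z| = Num.max z 0 + Num.max (- z) 0.
Proof.
have [z0|z0] := leP 0 z.
  by rewrite ger0_norm// max_r ?oppr_le0// addr0.
by rewrite ltr0_norm// max_l ?add0r// oppr_ge0 ltW.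
Qed.

Section shift_estimate.
Local Open Scope ereal_scope.
Context {R : realType} {N : nat}.
Local Notation leb := (@lebesgue_measure_rV R N).
Notation mu := (@lebesgue_measure R).
Variables (u : 'rV[R]_N -> R) (G : 'rV[R]_N -> 'rV[R]_N).
Hypothesis uG : is_weak_grad u G.

Let mu_u : measurable_fun setT u. Proof. by case: uG => -[]. Qed.

Let mG i : measurable_fun setT (fun x => G x ord0 i).
Proof. by case: uG => _ /(_ i)[[]]. Qed.

Section direction.
Variables (i : 'I_N) (t : R).
Hypothesis t0 : (0 <= t)%R.
Let e : 'rV[R]_N := delta_mx ord0 i.

(** In u(x + t e) - u(x) = int_0^t G_i(x + r e) dr all negative parts are moved across. The two
    sides [L] and [L'] are then nonnegative, and equality of their integrals over boxes gives
    equality almost everywhere. *)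
Lemma weak_grad_shift_ae : {ae leb, forall x,
  `|u (x + t *: e) - u x|%:E <= \int[mu]_(r in `[0%R, t]) `|G (x + r *: e)%R ord0 i|%:E}.
Proof.
pose up x : R := (Num.max (u x) 0)%R; pose un x : R := (Num.max (- u x) 0)%R.
pose Gp x : R := (Num.max (G x ord0 i) 0)%R; pose Gn x : R := (Num.max (- G x ord0 i) 0)%R.
have up0 x : (0 <= up x)%R by rewrite /up le_max lexx orbT.
have un0 x : (0 <= un x)%R by rewrite /un le_max lexx orbT.
have Gp0 x : (0 <= Gp x)%R by rewrite /Gp le_max lexx orbT.
have Gn0 x : (0 <= Gn x)%R by rewrite /Gn le_max lexx orbT.
have mup : measurable_fun setT up by exact: measurable_funrpos.
have mun : measurable_fun setT un by exact: measurable_funrneg.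
have mGp : measurable_fun setT Gp by exact: (measurable_funrpos (mG i)).
have mGn : measurable_fun setT Gn by exact: (measurable_funrneg (mG i)).
pose S (v : 'rV[R]_N -> R) (x : 'rV[R]_N) : \bar R := \int[mu]_(r in `[0%R, t]) (v (x + r *: e)%R)%:E.
have S0 (v : 'rV[R]_N -> R) x : (forall x, 0 <= v x)%R -> 0 <= S v x.
  by move=> v0; apply: integral_ge0 => r _; rewrite lee_fin.
have mS (v : 'rV[R]_N -> R) : measurable_fun setT v -> (forall x, 0 <= v x)%R -> measurable_fun setT (S v).
  move=> mv v0; apply: (@measurable_line_integral _ _ i t (EFin \o v)).
    exact/measurable_EFinP.
  by move=> x; rewrite lee_fin.
have ms (v : 'rV[R]_N -> R) : measurable_fun setT v ->
    measurable_fun setT (fun x : 'rV[R]_N => (v (x + t *: e)%R)%:E).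
  move=> mv; apply/measurable_EFinP.
  exact: (measurableT_comp mv (measurable_rV_shift _)).
pose L (x : 'rV[R]_N) : \bar R := (up x)%:E + (un (x + t *: e)%R)%:E + S Gp x.
pose L' (x : 'rV[R]_N) : \bar R := (up (x + t *: e)%R)%:E + (un x)%:E + S Gn x.
have key a b : [/\ \int[leb]_(x in box a b) L x < +oo &
   \int[leb]_(x in box a b) L x = \int[leb]_(x in box a b) L' x].
  have mb := @measurable_box _ _ a b.
  have m1 : measurable_fun setT (\1_(box a b) : 'rV[R]_N -> R) by exact: measurable_indic.
  have [M [_ H1 _ H2]] := box_lim_in_cube i t0 a b.
  have cK := @compact_cube R N M; have mK := @measurable_cube R N M.
  have [lu /(_ i) [lG _]] := uG.
  have b1 x : (0 <= (\1_(box a b) x : R) <= 1 * \1_(cube M) x)%R.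
    by have := H2 x 0%R; rewrite scale0r subr0 mul1r; apply; rewrite lexx t0.
  have b2 x : (0 <= (\1_(box a b) (x - t *: e) : R) <= 1 * \1_(cube M) x)%R.
    by have := H2 x t; rewrite mul1r; apply; rewrite lexx t0.
  have [P1 P2 Pu] := Rintegral_posneg lu cK mK m1 b1.
  have [Q1 Q2 Qu] := Rintegral_posneg lu cK mK (measurable_indic_shift a b (t *: e)) b2.
  have [S1 S2 SG] := Rintegral_posneg lG cK mK (measurable_sweep_indic i t0 a b) H1.
  have id1 (v : 'rV[R]_N -> R) :
      \int[leb]_(x in box a b) (v x)%:E = \int[leb]_x (v x * \1_(box a b) x)%:E.
    by rewrite integral_mul_indic; apply: eq_integral => x _; rewrite EFinM.
  have id2 (v : 'rV[R]_N -> R) : measurable_fun setT v -> (forall x, 0 <= v x)%R ->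
      \int[leb]_(x in box a b) (v (x + t *: e)%R)%:E =
      \int[leb]_x (v x * \1_(box a b) (x - t *: e))%:E.
    move=> mv v0; rewrite integral_mul_indic -[RHS](ge0_integral_shift (t *: e)).
    - by apply: eq_integral => x _; rewrite addrK EFinM.
    - apply/measurable_EFinP; apply: measurable_funM => //.
      exact: measurable_indic_shift.
    - by move=> x; rewrite lee_fin mulr_ge0// indicE.
  have id3 (v : 'rV[R]_N -> R) : measurable_fun setT v -> (forall x, 0 <= v x)%R ->
      \int[leb]_(x in box a b) S v x =
      \int[leb]_x (v x * sweep i t \1_(box a b) x)%:E.
    move=> mv v0; rewrite -(@integral_sweep _ _ i t t0 a b (EFin \o v)).
    - by apply: eq_integral => x _; rewrite EFinM.
    - exact/measurable_EFinP.
    - by move=> x; rewrite lee_fin.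
  have spl (v w z : 'rV[R]_N -> \bar R) :
      measurable_fun setT v -> measurable_fun setT w -> measurable_fun setT z ->
      (forall x, 0 <= v x) -> (forall x, 0 <= w x) -> (forall x, 0 <= z x) ->
      \int[leb]_(x in box a b) (v x + w x + z x) =
      \int[leb]_(x in box a b) v x + \int[leb]_(x in box a b) w x + \int[leb]_(x in box a b) z x.
    move=> mv mw mz v0 w0 z0; rewrite ge0_integralD//; last 3 first.
    - by move=> x _; rewrite adde_ge0.
    - by apply: measurable_funS (emeasurable_funD mv mw) => //.
    - exact: measurable_funS mz.
    by rewrite ge0_integralD//; [exact: measurable_funS mv|exact: measurable_funS mw].
  have LE : \int[leb]_(x in box a b) L x =
      \int[leb]_x (up x * \1_(box a b) x)%:E +
      \int[leb]_x (un x * \1_(box a b) (x - t *: e))%:E +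
      \int[leb]_x (Gp x * sweep i t \1_(box a b) x)%:E.
    rewrite /L (spl (fun x => (up x)%:E) (fun x => (un (x + t *: e)%R)%:E) (S Gp)).
    - by rewrite (id2 un)// (id1 up) id3.
    - exact/measurable_EFinP.
    - exact: ms.
    - exact: mS.
    - by move=> x; rewrite lee_fin.
    - by move=> x; rewrite lee_fin.
    - by move=> x; exact: S0.
  have LE' : \int[leb]_(x in box a b) L' x =
      \int[leb]_x (up x * \1_(box a b) (x - t *: e))%:E +
      \int[leb]_x (un x * \1_(box a b) x)%:E +
      \int[leb]_x (Gn x * sweep i t \1_(box a b) x)%:E.
    rewrite /L' (spl (fun x => (up (x + t *: e)%R)%:E) (fun x => (un x)%:E) (S Gn)).
    - by rewrite (id2 up)// (id1 un) id3.
    - exact: ms.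
    - exact/measurable_EFinP.
    - exact: mS.
    - by move=> x; rewrite lee_fin.
    - by move=> x; rewrite lee_fin.
    - by move=> x; exact: S0.
  have W := weak_grad_box i t0 a b uG.
  have := W; rewrite (_ : (\int[leb]_x _)%R =
     (\int[leb]_x (u x * \1_(box a b) x) - \int[leb]_x (u x * \1_(box a b) (x - t *: e)))%R);
    last first.
    rewrite -RintegralB//.
    - by apply: eq_Rintegral => x _; rewrite mulrBr.
    - apply: (integrable_loc_mul lu cK mK m1 (C := 1)) => x.
      by have /andP[/ger0_norm ->] := b1 x.
    - apply: (integrable_loc_mul lu cK mK (measurable_indic_shift a b (t *: e)) (C := 1)) => x.
      by have /andP[/ger0_norm ->] := b2 x.
  rewrite Pu Qu SG => {}W.
  move: P1 P2 Q1 Q2 S1 S2 W LE LE'.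
  move=> P1 P2 Q1 Q2 S1 S2 W LE LE'; rewrite LE LE'; clear LE LE'; move: P1 P2 Q1 Q2 S1 S2 W.
  case: (\int[leb]_x (up x * \1_(box a b) x)%:E) => // p1 _.
  case: (\int[leb]_x (un x * \1_(box a b) x)%:E) => // p2 _.
  case: (\int[leb]_x (up x * \1_(box a b) (x - t *: e))%:E) => // q1 _.
  case: (\int[leb]_x (un x * \1_(box a b) (x - t *: e))%:E) => // q2 _.
  case: (\int[leb]_x (Gp x * sweep i t \1_(box a b) x)%:E) => // s1 _.
  case: (\int[leb]_x (Gn x * sweep i t \1_(box a b) x)%:E) => // s2 _ /= W.
  rewrite -!EFinD ltry; split => //; congr EFin.
  have -> : (p1 + q2 + s1 = (p1 - p2 - (q1 - q2)) + p2 + q1 + s1)%R by ring.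
  by rewrite W; ring.
have : {ae leb, forall x, L x = L' x}.
  apply: (@ge0_ae_eq_pi_system _ _ _ leb (@boxes R N)
    (fun k => box (\row_i - k%:R)%R (\row_i k%:R)%R)).
  - exact: measurable_boxesE.
  - exact: setI_boxes.
  - by move=> k; do 2 eexists.
  - exact: bigcup_box.
  - apply: emeasurable_funD; last exact: mS.
    by apply: emeasurable_funD; [exact/measurable_EFinP|exact: ms].
  - apply: emeasurable_funD; last exact: mS.
    by apply: emeasurable_funD; [exact: ms|exact/measurable_EFinP].
  - move=> x; apply: adde_ge0; last exact: S0.
    by apply: adde_ge0; rewrite lee_fin.
  - move=> x; apply: adde_ge0; last exact: S0.
    by apply: adde_ge0; rewrite lee_fin.
  - by move=> _ [a [b ->]]; have [] := key a b.
  - by move=> k; have [] := key (\row_i - k%:R)%R (\row_i k%:R)%R.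
apply: filterS => x.
rewrite [X in _ -> _ <= X](_ : _ = S Gp x + S Gn x); last first.
  rewrite /S -ge0_integralD//.
  - apply: eq_integral => r _; rewrite -EFinD; congr EFin.
    exact: normr_maxD.
  - by move=> r _; rewrite lee_fin.
  - apply/measurable_EFinP; apply: measurable_funS (measurableT_comp mGp (measurable_line i x)) => //.
  - by move=> r _; rewrite lee_fin.
  - apply/measurable_EFinP; apply: measurable_funS (measurableT_comp mGn (measurable_line i x)) => //.
rewrite /L /L'.
(* If one of the two line integrals is infinite the bound is trivial; otherwise the identity can be
   read in R. *)
have := S0 _ x Gp0; have := S0 _ x Gn0.
case: (S Gp x) => [sp| |]//; case: (S Gn x) => [sn| |]//; last first.
  by move=> _ _ _; rewrite addye// leey.
rewrite !lee_fin => sn0 sp0.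
rewrite -!EFinD => /(congr1 fine)/=; rewrite /up /un => E; rewrite -?EFinD ?lee_fin.
move: E; case: (leP (u x) 0%R) => ?; case: (leP (- u x)%R 0%R) => ?;
  case: (leP (u (x + _)%R) 0%R) => ?; case: (leP (- u (x + _))%R 0%R) => ? E;
  rewrite ler_norml; apply/andP; split; lra.
Qed.

End direction.
End shift_estimate.

(** * The modulus of continuity in L^p *)

Section translation.
Local Open Scope ereal_scope.
Context {R : realType} {N : nat}.
Local Notation leb := (@lebesgue_measure_rV R N).
Notation mu := (@lebesgue_measure R).

(** Each term is at most the largest one, whose p-th power is among the summands on the right. *)
Lemma sum_powR_le n (a : 'I_n -> R) (p : R) : (0 < p)%R ->
  (forall k, 0 <= a k)%R ->
  ((\sum_k a k) `^ p <= n%:R `^ p * \sum_k a k `^ p)%R.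
Proof.
move=> p0 a0; case: n a a0 => [|n] a a0.
  by rewrite !big_ord0 powR0 ?gt_eqF// mulr0.
have [k hk] : exists k, forall j, (a j <= a k)%R.
  by case: (@arg_maxP _ _ _ (ord0 : 'I_n.+1) xpredT a isT) => k _ h; exists k => j; exact: h.
apply: (@le_trans _ _ ((n.+1%:R * a k) `^ p)%R).
  apply: ge0_ler_powR; rewrite ?(ltW p0) ?nnegrE ?sumr_ge0 ?mulr_ge0//.
  have -> : (n.+1%:R * a k = \sum_(j < n.+1) a k)%R.
    by rewrite sumr_const card_ord mulr_natl.
  exact: ler_sum.
rewrite powRM// ler_wpM2l ?powR_ge0// (bigD1 k)//= lerDl.
by apply: sumr_ge0 => j _; exact: powR_ge0.
Qed.

Variables (u : 'rV[R]_N -> R) (G : 'rV[R]_N -> 'rV[R]_N) (p : R).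
Hypotheses (uG : is_weak_grad u G) (p1 : (1 < p)%R).

Let p0 : (0 < p)%R. Proof. exact: lt_trans p1. Qed.

Let mu_u : measurable_fun setT u. Proof. by case: uG => -[]. Qed.

Let mG i : measurable_fun setT (fun x => G x ord0 i).
Proof. by case: uG => _ /(_ i)[[]]. Qed.

Let mpow (v : 'rV[R]_N -> R) : measurable_fun setT v ->
  measurable_fun setT (fun x => (`|v x| `^ p)%:E).
Proof.
move=> mv; apply/measurable_EFinP.
apply: (measurableT_comp (f := fun r : R => r `^ p)%R); first exact: measurable_powR.
exact: measurableT_comp.
Qed.

Let mdiff (y z : 'rV[R]_N) : measurable_fun setT (fun x : 'rV[R]_N => u (x + y)%R - u (x + z)%R)%R.
Proof.
apply: measurable_funB; exact: (measurableT_comp mu_u (measurable_rV_shift _)).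
Qed.

Let mdiff0 (y : 'rV[R]_N) : measurable_fun setT (fun x : 'rV[R]_N => u (x + y)%R - u x)%R.
Proof.
apply: measurable_funB => //.
exact: (measurableT_comp mu_u (measurable_rV_shift _)).
Qed.

(** Jensen on the segment gives t^(p - 1). After integration in x every point of the segment
    contributes the same amount, by translation invariance, which gives one more factor t. *)
Lemma shift_direction_ge0 (i : 'I_N) (t : R) : (0 <= t)%R ->
  \int[leb]_x (`|u (x + t *: delta_mx ord0 i) - u x| `^ p)%:E <=
  (t `^ p)%:E * \int[leb]_x (`|G x ord0 i| `^ p)%:E.
Proof.
move=> t0.
have mGi : measurable_fun setT (fun x => (`|G x ord0 i| `^ p)%:E) by exact: mpow.
have h0 x : 0 <= (`|G x ord0 i| `^ p)%:E by rewrite lee_fin powR_ge0.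
have mL := @measurable_line_integral _ _ i t _ mGi h0.
have tp0 : (0 <= t `^ (p - 1))%R by exact: powR_ge0.
have L0 x : 0 <= \int[mu]_(r in `[0%R, t]) (`|G (x + r *: delta_mx ord0 i)%R ord0 i| `^ p)%:E.
  exact: integral_ge0.
apply: (@le_trans _ _ (\int[leb]_x ((t `^ (p - 1))%:E *
   \int[mu]_(r in `[0%R, t]) (`|G (x + r *: delta_mx ord0 i)%R ord0 i| `^ p)%:E))).
  apply: ae_ge0_le_integral => //.
  - exact: mpow.
  - by move=> x _; rewrite mule_ge0.
  - exact: emeasurable_funM.
  apply: filterS (weak_grad_shift_ae uG i t0) => x hx _.
  have mline : measurable_fun setT (fun r : measurableTypeR R => `|G (x + (r : R) *: delta_mx ord0 i) ord0 i|%R).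
    apply: measurableT_comp => //.
    exact: (measurableT_comp (mG i) (measurable_line i x)).
  have J := @integral_powR_le _ (measurableTypeR R) R mu `[0%R, t]%classic _ t p
    (measurable_itv _) (mu_itv0t t0) t0 p1 mline (fun=> normr_ge0 _).
  apply: le_trans J; rewrite -poweR_EFin.
  apply: gt0_ler_poweR => //; first exact: ltW.
  - by rewrite in_itv/= lee_fin normr_ge0 leey.
  - by rewrite in_itv/= leey andbT integral_ge0// => r _; rewrite lee_fin.
rewrite ge0_integralZl//.
have -> : \int[leb]_x \int[mu]_(r in `[0%R, t])
      (`|G (x + r *: delta_mx ord0 i)%R ord0 i| `^ p)%:E =
    \int[mu]_(r in `[0%R, t]) \int[leb]_x (`|G x ord0 i| `^ p)%:E.
  transitivity (\int[leb]_x (cst 1 x * \int[mu]_(r in `[0%R, t])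
      (`|G (x + r *: delta_mx ord0 i)%R ord0 i| `^ p)%:E)).
    by apply: eq_integral => x _; rewrite /= mul1e.
  rewrite (@integral_line_integral _ _ i t _ (cst 1) mGi h0)//.
  apply: eq_integral => r _.
  rewrite -[RHS](ge0_integral_shift (r *: delta_mx ord0 i) mGi h0).
  by apply: eq_integral => x _; rewrite /= mul1e.
set C := (\int[leb]_x (`|G x ord0 i| `^ p)%:E).
have -> : \int[mu]_(r in `[0%R, t]) C = C * t%:E.
  by rewrite integral_cst//; congr (_ * _); exact: mu_itv0t.
by rewrite (muleC C) muleA -EFinM -(mulr_powRB1 t0 p0) (mulrC t).
Qed.

Lemma shift_direction (i : 'I_N) (t : R) :
  \int[leb]_x (`|u (x + t *: delta_mx ord0 i) - u x| `^ p)%:E <=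
  (`|t| `^ p)%:E * \int[leb]_x (`|G x ord0 i| `^ p)%:E.
Proof.
have [t0|t0] := leP 0%R t.
  by rewrite ger0_norm//; exact: shift_direction_ge0.
rewrite ltr0_norm//; apply: le_trans (shift_direction_ge0 i _); last by rewrite oppr_ge0 ltW.
(* Substituting x + t e_i for x exchanges the two points and makes the shift positive. *)
rewrite -(ge0_integral_shift (t *: delta_mx ord0 i)
  (f := fun x => (`|u (x + (- t) *: delta_mx ord0 i) - u x| `^ p)%:E)).
- rewrite le_eqVlt; apply/orP; left; apply/eqP; apply: eq_integral => x _.
  by rewrite scaleNr addrK distrC.
- exact: mpow.
- by move=> x; rewrite lee_fin powR_ge0.
Qed.

(** The vertices of the path from 0 to y that changes one coordinate at a time. *)
Definition trunc_rV (y : 'rV[R]_N) (k : nat) : 'rV[R]_N :=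
  \row_(j < N) if (j < k)%N then y ord0 j else 0%R.

(** The factor N^p comes from the power of a sum of N increments, and N from adding up their bounds,
    each increment being a shift along one axis. *)
Lemma shift_estimate (y : 'rV[R]_N) (H : R) : (0 <= H)%R ->
  (forall k, `|y ord0 k| <= H)%R ->
  \int[leb]_x (`|u (x + y) - u x| `^ p)%:E <=
  (N%:R `^ p * N%:R * H `^ p)%:E * \int[leb]_x (enorm (G x) `^ p)%:E.
Proof.
move=> H0 yH.
pose D (k : 'I_N) x : R := `|u (x + trunc_rV y k.+1) - u (x + trunc_rV y k)|%R.
have menorm : measurable_fun setT (fun x => enorm (G x)).
  apply: (measurableT_comp (f := @Num.sqrt R)).
    by apply: continuous_measurable_fun; exact: sqrt_continuous.
  by apply: measurable_sum => k; apply: measurable_funX.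
have mpE : measurable_fun setT (fun x => (enorm (G x) `^ p)%:E).
  by apply/measurable_EFinP; apply: (measurableT_comp (f := fun r : R => r `^ p)%R) => //; exact: measurable_powR.
have I0 : 0 <= \int[leb]_x (enorm (G x) `^ p)%:E.
  by apply: integral_ge0 => x _; rewrite lee_fin powR_ge0.
have Dle x : (`|u (x + y) - u x| <= \sum_k D k x)%R.
  have -> : (u (x + y) - u x = \sum_(k < N) (u (x + trunc_rV y k.+1) - u (x + trunc_rV y k)))%R.
    rewrite -(big_mkord xpredT (fun k => u (x + trunc_rV y k.+1) - u (x + trunc_rV y k))%R).
    rewrite telescope_sumr//; congr (u _ - u _)%R.
      by congr (_ + _)%R; apply/rowP => j; rewrite mxE ltn_ord.
    by rewrite (_ : trunc_rV y 0 = 0%R) ?addr0//; apply/rowP => j; rewrite !mxE.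
  exact: ler_norm_sum.
have D0 k x : (0 <= D k x)%R by exact: normr_ge0.
have mD k : measurable_fun setT (fun x => (D k x `^ p)%:E).
  exact: (mpow (mdiff (trunc_rV y k.+1) (trunc_rV y k))).
have step k : \int[leb]_x (D k x `^ p)%:E <= (H `^ p)%:E * \int[leb]_x (enorm (G x) `^ p)%:E.
  (* Translating by the k-th vertex turns the k-th increment into a shift along the k-th axis. *)
  have -> : \int[leb]_x (D k x `^ p)%:E =
      \int[leb]_x (`|u (x + y ord0 k *: delta_mx ord0 k) - u x| `^ p)%:E.
    rewrite -(ge0_integral_shift (trunc_rV y k)
      (f := fun x => (`|u (x + y ord0 k *: delta_mx ord0 k) - u x| `^ p)%:E)).
    - apply: eq_integral => x _; rewrite /D; congr ((`|u _ - _| `^ _)%:E).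
      rewrite -addrA; congr (_ + _)%R; apply/rowP => j; rewrite !mxE/=.
      have [->|jk] := eqVneq j k; first by rewrite ltnSn ltnn add0r mulr1.
      by rewrite mulr0 addr0 ltnS leq_eqVlt (_ : (j == k :> nat) = false)//; apply/negbTE.
    - exact: mpow.
    - by move=> x; rewrite lee_fin powR_ge0.
  apply: le_trans (shift_direction k _) _; apply: lee_pmul.
  - by rewrite lee_fin powR_ge0.
  - by apply: integral_ge0 => x _; rewrite lee_fin powR_ge0.
  - by rewrite lee_fin ge0_ler_powR ?nnegrE ?(ltW p0).
  - apply: ge0_le_integral => //.
    + exact: mpow.
    + move=> x _; rewrite lee_fin ge0_ler_powR ?nnegrE ?(ltW p0) ?sqrtr_ge0//.
      rewrite -sqrtr_sqr ler_wsqrtr// (bigD1 k)//= lerDl.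
      by apply: sumr_ge0 => j _; exact: sqr_ge0.
apply: (@le_trans _ _ (\int[leb]_x ((N%:R `^ p)%:E * \sum_(k < N) (D k x `^ p)%:E))).
  apply: ge0_le_integral => //.
  - exact: mpow.
  - by apply: emeasurable_funM => //; apply: emeasurable_sum => k; exact: mD.
  - move=> x _; rewrite sumEFin -EFinM lee_fin.
    apply: le_trans (sum_powR_le p0 (D0^~ x)).
    by apply: ge0_ler_powR; rewrite ?nnegrE ?(ltW p0) ?sumr_ge0.
rewrite ge0_integralZl//; last 2 first.
- by apply: emeasurable_sum => k; exact: mD.
- by move=> x _; apply: sume_ge0 => k _; rewrite lee_fin powR_ge0.
rewrite ge0_integral_sum//; last by move=> k x _; rewrite lee_fin powR_ge0.
rewrite -mulrA EFinM -muleA lee_wpmul2l ?lee_fin ?powR_ge0//.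
apply: (@le_trans _ _ (\sum_(k < N) ((H `^ p)%:E * \int[leb]_x (enorm (G x) `^ p)%:E))).
  by apply: lee_sum => k _; exact: step.
by rewrite sumr_const card_ord EFinM -muleA mule_natl.
Qed.

End translation.

(** * Grid averages *)

Section cells.
Context {R : realType} {N : nat}.
Local Notation leb := (@lebesgue_measure_rV R N).
Implicit Types (h : R) (x y : 'rV[R]_N).

(* The cell containing [x] of the grid of mesh [h], as a half-open cube. *)
Definition cell h x : set 'rV[R]_N :=
  [set y | forall i, Num.floor (y ord0 i / h) = Num.floor (x ord0 i / h)].

Lemma cell_refl h x : cell h x x. Proof. by []. Qed.

Lemma cell_eq h x y : cell h x y -> cell h y = cell h x.
Proof. by move=> xy; apply/seteqP; split=> z hz i; rewrite hz xy. Qed.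

Lemma floor_div_eq (h s t : R) : 0 < h ->
  (Num.floor (s / h) = Num.floor (t / h)) <->
  ((Num.floor (t / h))%:~R * h <= s < (Num.floor (t / h))%:~R * h + h).
Proof.
move=> h0; set m := Num.floor (t / h); split.
  move=> <-; have /andP[] := floor_itv (s / h).
  rewrite ler_pdivlMr// ltr_pdivrMr// intrD mulrDl mul1r => -> ->//.
move=> /andP[s1 s2]; apply/eqP; rewrite eq_le.
rewrite -ltzD1 floor_lt_int floor_ge_int ler_pdivlMr// s1 andbT.
by rewrite ltr_pdivrMr// intrD mulrDl mul1r.
Qed.

Lemma cellE h x : 0 < h -> cell h x =
  box (\row_i ((Num.floor (x ord0 i / h))%:~R * h))
      (\row_i ((Num.floor (x ord0 i / h))%:~R * h + h)).
Proof.
move=> h0; apply/seteqP; split=> y hy i; have := hy i.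
  by rewrite !mxE => /(floor_div_eq _ _ h0).
by rewrite !mxE => hi; apply/(floor_div_eq _ _ h0).
Qed.

Lemma measurable_cell h x : 0 < h -> measurable (cell h x).
Proof. by move=> h0; rewrite cellE//; exact: measurable_box. Qed.

Lemma lebesgue_measure_cell h x : 0 < h -> leb (cell h x) = (h ^+ N)%:E.
Proof.
move=> h0; rewrite cellE// lebesgue_measure_box; congr EFin.
transitivity (\prod_(i < N) h); last by rewrite prodr_const card_ord.
apply: eq_bigr => i _.
by rewrite !mxE addrC addKr max_r// ltW.
Qed.

Lemma cell_dist h x y : 0 < h -> cell h x y -> forall i, `|y ord0 i - x ord0 i| < h.
Proof.
move=> h0 xy i; have /(floor_div_eq _ _ h0)/andP[y1 y2] := xy i.
have /(floor_div_eq _ _ h0)/andP[x1 x2] := cell_refl h x i.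
by rewrite ltr_norml; apply/andP; split; lra.
Qed.

(** This is what makes the grids of mesh h and 2h nested. *)
Lemma floor_half (s t : R) : Num.floor s = Num.floor t ->
  Num.floor (s / 2) = Num.floor (t / 2).
Proof.
move=> st; suff H (a b : R) : Num.floor a = Num.floor b -> Num.floor (a / 2) <= Num.floor (b / 2 : R).
  by apply/eqP; rewrite eq_le !H.
move=> ab; rewrite floor_ge_int ler_pdivlMr//.
rewrite (_ : _ * 2 = (Num.floor (a / 2) * 2)%:~R); last by rewrite intrM.
rewrite -floor_ge_int -ab floor_ge_int intrM -ler_pdivlMr//; exact: floor_le.
Qed.

Lemma cell_double h x : cell h x `<=` cell (2 * h) x.
Proof.
move=> y xy i; rewrite invfM mulrCA !(mulrC 2^-1).
by have := floor_half (xy i); rewrite !mulrA.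
Qed.

(** Joint measurability in both points lets Tonelli's theorem yield the measurability of cell
    integrals as functions of the centre x. *)
Lemma measurable_cell_rel h :
  measurable [set z : 'rV[R]_N * 'rV[R]_N | cell h z.1 z.2].
Proof.
apply: measurable_forall_ord => i.
pose F (s : R) : R := (Num.floor (s / h))%:~R.
have mF : measurable_fun setT F.
  have [h0|h0] := leP 0 h.
    apply: nondecreasing_measurable => // s t st.
    by rewrite ler_int le_floor// ler_wpM2r// invr_ge0.
  have mm : measurable_fun setT (fun s : R => (Num.floor s)%:~R : R).
    by apply: nondecreasing_measurable => // s t st; rewrite ler_int le_floor.
  apply: (measurableT_comp mm); exact: measurable_funM.
have mc : measurable_fun setT (fun x : 'rV[R]_N => F (x ord0 i)).
  exact: (measurableT_comp mF (measurable_coord i)).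
have := measurable_fun_eqr (measurableT_comp mc measurable_snd)
  (measurableT_comp mc measurable_fst).
move=> /(_ measurableT [set true] _); rewrite setTI => H.
rewrite [X in measurable X](_ : _ = (fun z : 'rV[R]_N * 'rV[R]_N =>
   (F (z.2 ord0 i) == F (z.1 ord0 i))) @^-1` [set true]); first exact: H.
apply/seteqP; split=> z /=.
  by rewrite /F => ->; rewrite eqxx.
by rewrite /F eqr_int => /eqP.
Qed.

Definition cell_avg h (u : 'rV[R]_N -> R) x : R :=
  h ^- N * \int[leb]_(y in cell h x) u y.

Lemma cell_avg_eq h u x y : cell h x y -> cell_avg h u y = cell_avg h u x.
Proof. by move=> xy; rewrite /cell_avg (cell_eq xy). Qed.

Lemma measurable_cell_integral h (v : 'rV[R]_N * 'rV[R]_N -> \bar R) :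
  0 < h -> measurable_fun setT v -> (forall z, 0 <= v z)%E ->
  measurable_fun setT (fun x => \int[leb]_(y in cell h x) v (x, y))%E.
Proof.
move=> h0 mv v0.
have := @measurable_fun_fubini_tonelli_F _ _ _ _ R leb
  (fun z => v z * (\1_[set z : 'rV[R]_N * 'rV[R]_N | cell h z.1 z.2] z)%:E)%E.
move=> H; apply: eq_measurable_fun (H _ _).
- by move=> x _; rewrite [RHS]integral_mul_indic.
- apply: emeasurable_funM => //; apply/measurable_EFinP.
  by apply: measurable_indic; exact: measurable_cell_rel.
- by move=> z; rewrite mule_ge0// lee_fin indicE.
Qed.

Lemma measurable_cell_avg h (u : 'rV[R]_N -> R) : 0 < h ->
  measurable_fun setT u -> measurable_fun setT (cell_avg h u).
Proof.
move=> h0 mu_u; apply: measurable_funM => //.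
rewrite /Rintegral; apply: measurableT_comp => //.
under eq_fun do rewrite integralE.
have mE : measurable_fun setT (EFin \o u) by exact/measurable_EFinP.
apply: emeasurable_funB.
  apply: (@measurable_cell_integral _ (fun z => (EFin \o u)^\+ z.2)%E) => //.
  exact: (measurableT_comp (measurable_funepos mE) measurable_snd).
apply: (@measurable_cell_integral _ (fun z => (EFin \o u)^\- z.2)%E) => //.
exact: (measurableT_comp (measurable_funeneg mE) measurable_snd).
Qed.

End cells.

Section average.
Local Open Scope ereal_scope.
Context d (T : measurableType d) {R : realType} (m : {measure set T -> \bar R}).

Lemma average_powR_le (A : set T) (f : T -> R) (v p : R) :
  measurable A -> m A = v%:E -> (0 < v)%R -> (1 < p)%R ->
  measurable_fun setT f -> (forall x, 0 <= f x)%R ->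
  m.-integrable A (EFin \o f) ->
  ((v^-1 * \int[m]_(x in A) f x)%R `^ p)%:E <=
  v^-1%:E * \int[m]_(x in A) (f x `^ p)%:E.
Proof.
move=> mA mAv v0 p1 mf f0 intf.
have H := integral_powR_le mA mAv (ltW v0) p1 mf f0.
have vp : (v^-1 `^ p * v `^ (p - 1) = v^-1)%R.
  rewrite -(powR_inv1 (ltW v0)) -powRrM -powRD; last by apply/implyP => _; rewrite gt_eqF.
  by congr (_ `^ _)%R; ring.
rewrite powRM ?invr_ge0 ?(ltW v0)//; last exact: Rintegral_ge0.
rewrite -[in leRHS]vp !EFinM -muleA lee_wpmul2l ?lee_fin ?powR_ge0//.
apply: le_trans H; rewrite -poweR_EFin /Rintegral fineK//.
exact: integrable_fin_num.
Qed.

Lemma integrable_cst_lty (A : set T) (c : R) : measurable A -> m A < +oo ->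
  m.-integrable A (cst c%:E).
Proof.
move=> mA Afin.
have := @measurable_bounded_integrable _ _ _ m (cst c) A mA Afin.
by apply => //; exact: bounded_cst.
Qed.

Lemma integrable_powR (A : set T) (f : T -> R) (P : R) :
  measurable A -> m A < +oo -> (1 <= P)%R -> measurable_fun setT f ->
  \int[m]_x (`|f x| `^ P)%:E < +oo -> m.-integrable A (EFin \o f).
Proof.
move=> mA Afin P1 mf fP.
have mfA : measurable_fun A (EFin \o f).
  by apply/measurable_EFinP; exact: measurable_funS mf.
have mfP : measurable_fun setT (fun x => (`|f x| `^ P)%:E).
  apply/measurable_EFinP; apply: (measurableT_comp (f := fun r : R => r `^ P)%R).
    exact: measurable_powR.
  exact: measurableT_comp.
have i1 : m.-integrable A (cst 1) by exact: integrable_cst_lty.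
have iP : m.-integrable A (fun x => (`|f x| `^ P)%:E).
  apply: (integrableS measurableT) => //; apply/integrableP; split => //.
  by under eq_integral => x _ do rewrite gee0_abs ?lee_fin ?powR_ge0//.
apply: (le_integrable _ _ _ (integrableD mA i1 iP)) => //.
move=> x _; change (`|f x|%R%:E <= (`|1 + `|f x| `^ P|%R)%:E).
rewrite lee_fin [leRHS]ger0_norm ?addr_ge0 ?powR_ge0//.
have [f1|f1] := leP `|f x|%R 1%R; first by rewrite (le_trans f1)// lerDl powR_ge0.
by rewrite (le_trans (le1r_powR (ltW f1) P1))// lerDr.
Qed.

End average.

Section sobolev_data.
Context {R : realType} {N : nat}.
Local Notation leb := (@lebesgue_measure_rV R N).

(* The only features of a function in a ball of radius M of the space V that
   are needed: K bounds its L^p modulus of continuity under translations. *)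
Definition sobolev_data (p P Q K M : R) (u : 'rV[R]_N -> R) : Prop :=
  [/\ measurable_fun setT u,
      (forall (y : 'rV[R]_N) (H : R), 0 <= H -> (forall k, `|y ord0 k| <= H) ->
        (\int[leb]_x (`|u (x + y)%R - u x| `^ p)%:E <= ((K * H * M) `^ p)%:E)%E),
      (\int[leb]_x (`|u x| `^ P)%:E < +oo)%E &
      (\int[leb]_x (`|u x| `^ Q)%:E <= (M `^ Q)%:E)%E].

Variables (p P Q K M : R) (u : 'rV[R]_N -> R).
Hypotheses (p1 : 1 < p) (P1 : 1 <= P) (K0 : 0 <= K) (M0 : 0 < M).
Hypothesis uE : sobolev_data p P Q K M u.

Let mu_u : measurable_fun setT u. Proof. by case: uE. Qed.

Let p0 : 0 < p. Proof. exact: lt_trans p1. Qed.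

Lemma measurable_powR_norm d (T : measurableType d) (v : T -> R) (s : R) :
  measurable_fun setT v -> measurable_fun setT (fun x => (`|v x| `^ s)%:E).
Proof.
move=> mv; apply/measurable_EFinP.
apply: (measurableT_comp (f := fun r : R => r `^ s)); first exact: measurable_powR.
exact: measurableT_comp.
Qed.

Lemma integrable_cell h x : 0 < h -> leb.-integrable (cell h x) (EFin \o u).
Proof.
move=> h0; apply: (@integrable_powR _ _ _ _ _ _ P) => //.
- exact: measurable_cell.
- by rewrite [X in (X < _)%E](lebesgue_measure_cell x h0) ltry.
- by case: uE.
Qed.

(** The left side involves the average of u(x) - u(y) over y in the cell, to which Jensen
    applies. *)
Lemma cell_avg_diff_le h x : 0 < h ->
  ((`|u x - cell_avg h u x| `^ p)%:E <=
   (h ^- N)%:E * \int[leb]_(y in cell h x) (`|u x - u y| `^ p)%:E)%E.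
Proof.
move=> h0.
have hN : 0 < h ^+ N by exact: exprn_gt0.
have mc := measurable_cell x h0; have vc := lebesgue_measure_cell x h0.
have iu := integrable_cell x h0.
have ic : leb.-integrable (cell h x) (fun=> (u x)%:E).
  by apply: integrable_cst_lty => //; rewrite [X in (X < _)%E]vc ltry.
have id : leb.-integrable (cell h x) (fun y => (u x - u y)%:E).
  by have := integrableB mc ic iu; apply: eq_integrable => // y _.
have mf : measurable_fun setT (fun y => `|u x - u y|).
  by apply: measurableT_comp => //; exact: measurable_funB.
have := @average_powR_le _ _ R leb (cell h x) (fun y => `|u x - u y|) (h ^+ N) p
  mc vc hN p1 mf (fun=> normr_ge0 _) _.
move=> /(_ (integrable_norm id)); apply: le_trans.
rewrite lee_fin ge0_ler_powR ?nnegrE ?(ltW p0)//.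
  by rewrite mulr_ge0 ?invr_ge0 ?(ltW hN)//; exact: Rintegral_ge0.
have -> : u x - cell_avg h u x = (h ^+ N)^-1 * \int[leb]_(y in cell h x) (u x - u y).
  rewrite RintegralB// mulrBr Rintegral_cst//; congr (_ - _).
  by rewrite [X in fine X]vc /= mulrCA mulVf ?mulr1// gt_eqF.
rewrite normrM ger0_norm ?invr_ge0 ?(ltW hN)// ler_wpM2l ?invr_ge0 ?(ltW hN)//.
exact: le_normr_Rintegral.
Qed.

(** Jensen leads to a double integral over pairs in a common cell. In the variable z = y - x, which
    stays in a cube of side 2h, the integral in x for fixed z is bounded by the modulus of
    continuity; the volume ratio (2h)^N / h^N gives 2^N. *)
Lemma poincare_cell h : 0 < h ->
  (\int[leb]_x (`|u x - cell_avg h u x| `^ p)%:E <=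
   (2 ^+ N * (K * h * M) `^ p)%:E)%E.
Proof.
move=> h0.
have hN : 0 < h ^+ N by exact: exprn_gt0.
have hN0 : (0 <= (h ^- N)%:E :> \bar R)%E by rewrite lee_fin invr_ge0 ltW.
pose f (z : 'rV[R]_N * 'rV[R]_N) : \bar R := (`|u z.1 - u z.2| `^ p)%:E.
have mf : measurable_fun setT f.
  apply: measurable_powR_norm => //; apply: measurable_funB.
    exact: (measurableT_comp mu_u measurable_fst).
  exact: (measurableT_comp mu_u measurable_snd).
have f0 z : (0 <= f z)%E by rewrite lee_fin powR_ge0.
have mcf := measurable_cell_integral h0 mf f0.
apply: (@le_trans _ _ (\int[leb]_x ((h ^- N)%:E *
    \int[leb]_(y in cell h x) f (x, y))))%E.
  apply: ge0_le_integral => //.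
  - apply: measurable_powR_norm => //; apply: measurable_funB => //.
    exact: measurable_cell_avg.
  - exact: emeasurable_funM.
  - by move=> x _; exact: cell_avg_diff_le.
rewrite ge0_integralZl//; last by move=> x _; exact: integral_ge0.
pose C : set 'rV[R]_N := box (\row_i (- h)) (\row_i h).
have mC : measurable C by exact: measurable_box.
have vC : leb C = ((2 * h) ^+ N)%:E.
  rewrite /C lebesgue_measure_box; congr EFin.
  transitivity (\prod_(i < N) (2 * h)); last by rewrite prodr_const card_ord.
  apply: eq_bigr => i _; rewrite !mxE opprK max_r; first by ring.
  by rewrite addr_ge0 ?ltW.
pose g (z : 'rV[R]_N * 'rV[R]_N) : \bar R :=
  ((`|u (z.1 + z.2)%R - u z.1| `^ p)%:E * (\1_C z.2)%:E)%E.
have mg : measurable_fun setT g.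
  apply: emeasurable_funM.
    apply: measurable_powR_norm => //; apply: measurable_funB.
      apply: (measurableT_comp mu_u); apply: measurable_fun_rV => i.
      under eq_fun do rewrite mxE.
      apply: measurable_funD.
        exact: (measurableT_comp (measurable_coord i) measurable_fst).
      exact: (measurableT_comp (measurable_coord i) measurable_snd).
    exact: (measurableT_comp mu_u measurable_fst).
  apply/measurable_EFinP.
  have m1 : measurable_fun setT (\1_C : 'rV[R]_N -> R) by exact: measurable_indic.
  exact: (measurableT_comp m1 measurable_snd).
have g0 z : (0 <= g z)%E by rewrite mule_ge0// lee_fin ?powR_ge0 ?indicE.
have le1 : (\int[leb]_x \int[leb]_(y in cell h x) f (x, y) <=
    \int[leb]_x \int[leb]_z g (x, z))%E.
  apply: ge0_le_integral => //.
  - by move=> x _; exact: integral_ge0.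
  - exact: (measurable_fun_fubini_tonelli_F g).
  - move=> x _; rewrite integral_mul_indic.
    have mi : measurable_fun setT (\1_(cell h x) : 'rV[R]_N -> R).
      by apply: measurable_indic; exact: measurable_cell.
    have mfx : measurable_fun setT (fun y => f (x, y) * (\1_(cell h x) y)%:E)%E.
      apply: emeasurable_funM; last exact/measurable_EFinP.
      exact: (measurableT_comp mf (pair1_measurable x)).
    have fx0 y : (0 <= f (x, y) * (\1_(cell h x) y)%:E)%E by rewrite mule_ge0// lee_fin indicE.
    (* The change of variable y = z + x; membership in the cell forces z into [C]. *)
    rewrite -(ge0_integral_shift x mfx fx0).
    apply: ge0_le_integral => //.
    + exact: (measurableT_comp mfx (measurable_rV_shift x)).
    + exact: (measurableT_comp mg (pair1_measurable x)).
    + move=> z _; rewrite /f /g /= distrC (addrC x z).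
      rewrite lee_wpmul2l ?lee_fin ?powR_ge0// !indicE.
      have [/set_mem xz|] := boolP (_ \in cell h x); last by rewrite ler0n.
      rewrite mem_set// => i; rewrite !mxE.
      have := cell_dist h0 xz i; rewrite !mxE addrK ltr_norml.
      by move=> /andP[/ltW -> ->].
apply: (@le_trans _ _ ((h ^- N)%:E * \int[leb]_x \int[leb]_z g (x, z)))%E.
  exact: lee_wpmul2l.
rewrite fubini_tonelli//.
apply: (@le_trans _ _ ((h ^- N)%:E * \int[leb]_z (((K * h * M) `^ p)%:E * (\1_C z)%:E)))%E.
  apply: lee_wpmul2l => //; apply: ge0_le_integral => //.
  - by move=> z _; exact: integral_ge0.
  - exact: (measurable_fun_fubini_tonelli_G g).
  - by apply: emeasurable_funM => //; apply/measurable_EFinP; exact: measurable_indic.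
  - move=> z _; rewrite /g /=.
    have i0 : (0 <= (\1_C z)%:E :> \bar R)%E by rewrite lee_fin indicE.
    rewrite ge0_integralZr//; last first.
      apply: measurable_powR_norm => //; apply: measurable_funB => //.
      exact: (measurableT_comp mu_u (measurable_rV_shift z)).
    have [zC|zC] := pselect (C z); last by rewrite indicE memNset// !mule0.
    apply: lee_wpmul2r => //.
    case: uE => _ H _ _; apply: H; first exact: ltW.
    move=> k; have := zC k; rewrite !mxE => /andP[z1 z2].
    by rewrite ler_norml z1 ltW.
rewrite -integral_mul_indic integral_cst// [X in (_ * (_ * X))%E]vC -!EFinM lee_fin.
by rewrite mulrCA exprMn [h ^- N * _]mulrCA mulVf ?gt_eqF// mulr1 mulrC.
Qed.

End sobolev_data.

(** * Inequalities for powers and geometric series *)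

Section powR_facts.
Context {R : realType}.
Implicit Types a b p q s t M : R.

Lemma powR_le_inv p a b : 0 < p -> 0 <= a -> 0 <= b -> a `^ p <= b `^ p -> a <= b.
Proof.
move=> p0 a0 b0; apply: contraTT; rewrite -!ltNge => ba.
by apply: gt0_ltr_powR; rewrite ?nnegrE.
Qed.

(** The first term dominates when t <= M, the second when t > M. *)
Lemma powR_between p s q M t : 0 < p -> p <= s -> s <= q -> 0 < M -> 0 <= t ->
  t `^ s <= M `^ (s - p) * t `^ p + M `^ (s - q) * t `^ q.
Proof.
move=> p0 ps sq M0; rewrite le_eqVlt => /predU1P[<-|t0].
  rewrite powR0 ?addr_ge0 ?mulr_ge0 ?powR_ge0// gt_eqF//.
  exact: lt_le_trans ps.
have E r : t `^ s = t `^ (s - r) * t `^ r.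
  by rewrite -powRD ?subrK//; apply/implyP => _; rewrite gt_eqF.
have [tM|tM] := leP t M.
  apply: (@le_trans _ _ (M `^ (s - p) * t `^ p)); last first.
    by rewrite lerDl mulr_ge0 ?powR_ge0.
  rewrite (E p) ler_wpM2r ?powR_ge0//.
  by apply: ge0_ler_powR; rewrite ?nnegrE ?subr_ge0 ?(ltW t0) ?(ltW M0).
apply: (@le_trans _ _ (M `^ (s - q) * t `^ q)); last first.
  by rewrite lerDr mulr_ge0 ?powR_ge0.
rewrite (E q) ler_wpM2r ?powR_ge0// -(opprB q s) !powRN lef_pV2 ?posrE ?powR_gt0//.
by apply: ge0_ler_powR; rewrite ?nnegrE ?subr_ge0 ?(ltW t0) ?(ltW M0) ?(ltW tM).
Qed.

Lemma sum_geometric_le (r : R) n : 0 <= r -> r < 1 ->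
  \sum_(k < n) r ^+ k <= (1 - r)^-1.
Proof.
move=> r0 r1; have r10 : 0 < 1 - r by rewrite subr_gt0.
rewrite -(mul1r (1 - r)^-1) ler_pdivlMr// mulrC.
by rewrite -opprB mulNr -subrX1 opprB lerBlDr lerDl exprn_ge0.
Qed.

Lemma nneseries_geometric_le (f : nat -> \bar R) (c r : R) : 0 <= c -> 0 <= r -> r < 1 ->
  (forall k, (0 <= f k)%E) -> (forall k, (f k <= (c * r ^+ k)%:E)%E) ->
  (\sum_(k <oo) f k <= (c / (1 - r))%:E)%E.
Proof.
move=> c0 r0 r1 f0 fc; apply: lime_le; first exact: is_cvg_nneseries.
apply: nearW => n; apply: (@le_trans _ _ (\sum_(0 <= k < n) (c * r ^+ k)%:E)%E).
  by apply: lee_sum => k _; exact: fc.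
rewrite sumEFin lee_fin -mulr_sumr ler_wpM2l// big_mkord.
exact: sum_geometric_le.
Qed.

Lemma nneseries_ge_term (f : nat -> \bar R) k : (forall n, (0 <= f n)%E) ->
  (f k <= \sum_(n <oo) f n)%E.
Proof.
move=> f0; apply: le_trans (nneseries_lim_ge k.+1 _) => //.
by rewrite big_nat_recr//= leeDr// sume_ge0.
Qed.

End powR_facts.

(** * Uniform bounds for the averages *)

Section sobolev_sup.
Context {R : realType} {N : nat}.
Local Notation leb := (@lebesgue_measure_rV R N).
Variables (p P Q K : R).
Hypotheses (p1 : 1 < p) (pN : p < N%:R) (P1 : 1 < P) (K0 : 0 <= K).

Let p0 : 0 < p. Proof. exact: lt_trans p1. Qed.

Let alpha : R := 1 - N%:R / p.

Let alpha0 : alpha < 0.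
Proof. by rewrite subr_lt0 ltr_pdivlMr// mul1r. Qed.

(** The factor by which the bound for the averages shrinks when the mesh doubles; below 1 because p
    < N. *)
Definition dyadic_ratio : R := 2 `^ (1 - N%:R / p).

Lemma dyadic_ratio_gt0 : 0 < dyadic_ratio.
Proof. exact: powR_gt0. Qed.

Lemma dyadic_ratio_lt1 : dyadic_ratio < 1.
Proof.
rewrite /dyadic_ratio -/alpha -(opprK alpha) powRN invf_lt1 ?powR_gt0//.
have : (1 : R) `^ (- alpha) < 2 `^ (- alpha).
  by apply: gt0_ltr_powR; rewrite ?nnegrE ?oppr_gt0 ?ltr1n.
by rewrite powR1.
Qed.

(** The constant of one doubling step, multiplied by the sum of the geometric series over all
    doublings. *)
Definition avg_const : R := 2 `^ (N%:R / p) * (2 * K) / (1 - dyadic_ratio).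

Lemma avg_const_ge0 : 0 <= avg_const.
Proof.
rewrite divr_ge0 ?mulr_ge0 ?powR_ge0// subr_ge0 ltW//.
exact: dyadic_ratio_lt1.
Qed.

Variables (M : R) (u : 'rV[R]_N -> R).
Hypotheses (M0 : 0 < M) (uE : sobolev_data p P Q K M u).

Let P1' : 1 <= P. Proof. exact: ltW. Qed.

Let mu_u : measurable_fun setT u. Proof. by case: uE. Qed.

Let N_gt0 : (0 < N)%N.
Proof. by rewrite -(ltr_nat R); exact: lt_trans pN. Qed.

(** The average at mesh 2h is constant on a cell of mesh h, so the difference is an average over
    that cell of u minus its average at mesh 2h. Jensen and the Poincare bound at mesh 2h apply, and
    the volume of the small cell leaves the factor h^(-N/p). *)
Lemma cell_avg_step h x : 0 < h ->
  `|cell_avg h u x - cell_avg (2 * h) u x| <=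
  2 `^ (N%:R / p) * (2 * K) * M * h `^ (1 - N%:R / p).
Proof.
move=> h0.
have h20 : 0 < 2 * h by rewrite mulr_gt0.
have hN : 0 < h ^+ N by exact: exprn_gt0.
have mc := measurable_cell x h0; have vc := lebesgue_measure_cell x h0.
have iu := integrable_cell P1' uE x h0.
pose c := cell_avg (2 * h) u x.
have ic : leb.-integrable (cell h x) (fun=> c%:E).
  by apply: integrable_cst_lty => //; rewrite [X in (X < _)%E]vc ltry.
have id : leb.-integrable (cell h x) (fun y => (u y - c)%:E).
  by have := integrableB mc iu ic; apply: eq_integrable.
have mE := measurable_cell_avg h20 mu_u.
have mf : measurable_fun setT (fun y => `|u y - cell_avg (2 * h) u y|).
  by apply: measurableT_comp => //; exact: measurable_funB.
have cc y : cell h x y -> cell_avg (2 * h) u y = c.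
  by move=> xy; apply: cell_avg_eq; exact: cell_double.
have iN : leb.-integrable (cell h x) (EFin \o (fun y => `|u y - cell_avg (2 * h) u y|)).
  have := integrable_norm id; apply: eq_integrable => // y /set_mem xy /=.
  by rewrite cc.
have A := @average_powR_le _ _ R leb (cell h x) _ (h ^+ N) p
  mc vc hN p1 mf (fun=> normr_ge0 _) iN.
have B := poincare_cell p1 P1' uE h20.
apply: (powR_le_inv p0) => //.
  by rewrite !mulr_ge0 ?powR_ge0 ?(ltW M0).
apply: (@le_trans _ _ ((h ^- N * \int[leb]_(y in cell h x) `|u y - cell_avg (2 * h) u y|) `^ p)).
  apply: ge0_ler_powR; rewrite ?nnegrE ?(ltW p0)//.
    by rewrite mulr_ge0 ?invr_ge0 ?(ltW hN)//; exact: Rintegral_ge0.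
  have -> : cell_avg h u x - c = (h ^+ N)^-1 * \int[leb]_(y in cell h x) (u y - c).
    rewrite RintegralB// mulrBr Rintegral_cst//; congr (_ - _).
    by rewrite [X in fine X]vc /= mulrCA mulVf ?mulr1// gt_eqF.
  rewrite normrM ger0_norm ?invr_ge0 ?(ltW hN)// ler_wpM2l ?invr_ge0 ?(ltW hN)//.
  rewrite [leRHS](@eq_Rintegral _ _ _ _ _ (fun y => `|u y - c|)).
    exact: le_normr_Rintegral.
  by move=> y /set_mem xy; rewrite cc.
rewrite -lee_fin; apply: (le_trans A).
apply: (@le_trans _ _ ((h ^- N)%:E * (2 ^+ N * (K * (2 * h) * M) `^ p)%:E)%E).
  apply: lee_wpmul2l; first by rewrite lee_fin invr_ge0 ltW.
  apply: le_trans B; apply: ge0_subset_integral => //.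
  by apply: measurable_powR_norm; exact: measurable_funB.
rewrite -EFinM lee_fin le_eqVlt; apply/orP; left; apply/eqP.
(* The right side is arranged so that its p-th power is 2^N h^-N (K (2h) M)^p. *)
have E : (2 `^ (N%:R / p) * (2 * K) * M * h `^ (1 - N%:R / p)) =
   2 `^ (N%:R / p) * h `^ (- (N%:R / p)) * (K * (2 * h) * M).
  rewrite powRD ?powRr1 ?(ltW h0)//; first by ring.
  by apply/implyP => _; rewrite gt_eqF.
rewrite E [RHS]powRM ?mulr_ge0 ?powR_ge0 ?(ltW h0) ?(ltW M0)// [LHS]mulrA; congr (_ * _).
rewrite powRM ?powR_ge0// -!powRrM mulNr divfK ?gt_eqF// powRN.
by rewrite !powR_mulrn ?(ltW h0)// mulrC.
Qed.

(** Jensen with the exponent P: the P-th power of the average over a cell of side k is at most k^-N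
    times the integral of |u|^P. *)
Lemma cell_avg_cvg0 (e : R) h x : 0 < e -> 0 < h ->
  exists n : nat, `|cell_avg (2 ^+ n * h) u x| <= e.
Proof.
move=> e0 h0.
have [_ _ ufin _] := uE.
pose I := fine (\int[leb]_x (`|u x| `^ P)%:E).
have I0 : 0 <= I by apply: fine_ge0; apply: integral_ge0 => y _; rewrite lee_fin powR_ge0.
have IE : (\int[leb]_x (`|u x| `^ P)%:E)%E = I%:E.
  by rewrite fineK// ge0_fin_numE//; apply: integral_ge0 => y _; rewrite lee_fin powR_ge0.
have eP : 0 < e `^ P by exact: powR_gt0.
(* Since n < 2^n, the side k = 2^n h is at least 1 + I / e^P; the 1 is there to ensure k^N >= k. *)
pose n := Num.truncn ((1 + I / e `^ P) / h).
exists n; set k := 2 ^+ n * h.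
have kge : 1 + I / e `^ P <= k.
  rewrite -ler_pdivrMr//; apply/ltW/(lt_le_trans (truncnS_gt _)).
  by rewrite -natrX ler_nat -/n ltn_expl.
have k1 : 1 <= k by apply: le_trans kge; rewrite lerDl divr_ge0// ltW.
have k0 : 0 < k by apply: lt_le_trans k1.
have kN : 0 < k ^+ N by exact: exprn_gt0.
have mc := measurable_cell x k0; have vc := lebesgue_measure_cell x k0.
have iu := integrable_cell P1' uE x k0.
have mn : measurable_fun setT (fun y => `|u y|) by exact: measurableT_comp.
have A := @average_powR_le _ _ R leb (cell k x) _ (k ^+ N) P
  mc vc kN P1 mn (fun=> normr_ge0 _) (integrable_norm iu).
have P0 : 0 < P by apply: lt_trans P1.
apply: (powR_le_inv P0) => //; first exact: ltW.
apply: (@le_trans _ _ ((k ^- N * \int[leb]_(y in cell k x) `|u y|) `^ P)).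
  apply: ge0_ler_powR; rewrite ?nnegrE ?(ltW P0)//.
    by rewrite mulr_ge0 ?invr_ge0 ?(ltW kN)//; exact: Rintegral_ge0.
  rewrite normrM ger0_norm ?invr_ge0 ?(ltW kN)// ler_wpM2l ?invr_ge0 ?(ltW kN)//.
  exact: le_normr_Rintegral.
rewrite -lee_fin; apply: (le_trans A).
apply: (@le_trans _ _ ((k ^- N)%:E * I%:E)%E).
  apply: lee_wpmul2l; first by rewrite lee_fin invr_ge0 ltW.
  rewrite -IE; apply: ge0_subset_integral => //.
  exact: measurable_powR_norm.
rewrite -EFinM lee_fin mulrC ler_pdivrMr// mulrC -ler_pdivrMr//.
apply: (@le_trans _ _ k); first by apply: le_trans kge; rewrite lerDr.
by rewrite -{1}(expr1 k); exact: ler_weXn2l.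
Qed.

Lemma cell_avg_le h x : 0 < h ->
  `|cell_avg h u x| <= avg_const * M * h `^ (1 - N%:R / p).
Proof.
move=> h0; pose c := 2 `^ (N%:R / p) * (2 * K) * M.
have c0 : 0 <= c by rewrite !mulr_ge0 ?powR_ge0 ?(ltW M0).
have r0 := dyadic_ratio_gt0; have r1 := dyadic_ratio_lt1.
have tel n : `|cell_avg h u x| <=
    c * h `^ alpha * (\sum_(k < n) dyadic_ratio ^+ k) + `|cell_avg (2 ^+ n * h) u x|.
  elim: n => [|n IH]; first by rewrite big_ord0 mulr0 add0r mul1r.
  apply: (le_trans IH); rewrite big_ord_recr/= mulrDr -addrA lerD2l.
  have hn : 0 < 2 ^+ n * h by rewrite mulr_gt0// exprn_gt0.
  have := cell_avg_step x hn; rewrite mulrA -exprS.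
  rewrite powRM ?exprn_ge0 ?(ltW h0)// -/c -/alpha.
  have -> : (2 ^+ n : R) `^ alpha = dyadic_ratio ^+ n.
    by rewrite -powR_mulrn// -powRrM mulrC powRrM powR_mulrn ?powR_ge0.
  set a := cell_avg _ _ _; set b := cell_avg _ _ _ => hab.
  rewrite -lerBlDr; apply: (@le_trans _ _ `|a - b|); last first.
    by apply: (le_trans hab); rewrite le_eqVlt; apply/orP; left; apply/eqP; ring.
  exact: lerB_dist.
apply/ler_addgt0Pr => e e0.
have [n hn] := cell_avg_cvg0 x e0 h0.
apply: (le_trans (tel n)); apply: lerD => //.
rewrite (_ : avg_const * M * _ = c * h `^ alpha * (1 - dyadic_ratio)^-1); last first.
  by rewrite /avg_const /c /alpha; ring.
apply: ler_wpM2l; first by rewrite mulr_ge0 ?powR_ge0.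
by apply: sum_geometric_le => //; exact: ltW.
Qed.

End sobolev_sup.

(** * Interpolation between the gradient bound and L^Q *)

Section sobolev_interpolation.
Context {R : realType} {N : nat}.
Local Notation leb := (@lebesgue_measure_rV R N).
Variables (p P Q K s : R).
Hypotheses (p1 : 1 < p) (pN : p < N%:R) (P1 : 1 < P) (K0 : 0 <= K).
Hypotheses (ps : N%:R * p < s * (N%:R - p)) (sQ : s <= Q).

Let p0 : 0 < p. Proof. exact: lt_trans p1. Qed.

Let p_lt_s : p < s.
Proof.
have Np : 0 < N%:R - p by rewrite subr_gt0.
rewrite -(ltr_pM2r Np); apply: le_lt_trans ps.
by rewrite mulrC ler_wpM2r ?(ltW p0)// gerBl ltW.
Qed.

Let theta : R := dyadic_ratio (N := N) p.

Let theta0 : 0 < theta. Proof. exact: dyadic_ratio_gt0. Qed.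

Let theta1 : theta < 1. Proof. exact: dyadic_ratio_lt1. Qed.

(** Where |u| >= D M theta^k, the average at scale 2^k is at most half of |u|; the summand 1 keeps D
    positive. *)
Let D : R := 1 + 2 * avg_const (N := N) p K.

Let D0 : 0 < D.
Proof. by rewrite ltr_pwDl// mulr_ge0//; exact: avg_const_ge0. Qed.

(** The sum covers two uses of a term: 2^p above the top level, and 2^p (D/theta)^(s - p) between
    two levels, where 1/theta is the cost of replacing level k - 1 by level k. *)
Let A : R := 2 `^ p * (1 + (D / theta) `^ (s - p)).

Let A0 : 0 <= A. Proof. by rewrite mulr_ge0 ?addr_ge0 ?powR_ge0. Qed.

(** The ratio of the series: theta^(s - p) comes from the levels, 2^p from the oscillation at scale
    2^k. *)
Let rho : R := theta `^ (s - p) * 2 `^ p.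

Let rho0 : 0 <= rho. Proof. by rewrite mulr_ge0 ?powR_ge0. Qed.

(** As a power of 2, rho has the exponent (N p - s (N - p)) / p, negative since s > p^*. *)
Let rho1 : rho < 1.
Proof.
rewrite /rho /theta /dyadic_ratio -powRrM -powRD; last by rewrite pnatr_eq0 implybT.
rewrite -(opprK ((1 - _) * _ + _)) powRN invf_lt1 ?powR_gt0//.
have : (1 : R) `^ (- ((1 - N%:R / p) * (s - p) + p)) < 2 `^ (- ((1 - N%:R / p) * (s - p) + p)).
  apply: gt0_ltr_powR; rewrite ?nnegrE ?ltr1n// oppr_gt0.
  rewrite (_ : _ + _ = (N%:R * p - s * (N%:R - p)) / p); last first.
    by field; rewrite gt_eqF.
  by rewrite pmulr_llt0 ?invr_gt0// subr_lt0.
by rewrite powR1.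
Qed.

(** The 1 pays for the L^Q part, the fraction for the sum over the scales. *)
Definition sobolev_const : R := 1 + A * 2 ^+ N * K `^ p / (1 - rho).

Lemma sobolev_const_gt0 : 0 < sobolev_const.
Proof.
rewrite ltr_pwDl//; apply: divr_ge0; last by rewrite subr_ge0 ltW.
by apply: mulr_ge0; [apply: mulr_ge0 => //; exact: exprn_ge0|exact: powR_ge0].
Qed.

Variables (M : R) (u : 'rV[R]_N -> R).
Hypotheses (M0 : 0 < M) (uE : sobolev_data p P Q K M u).

Let mu_u : measurable_fun setT u. Proof. by case: uE. Qed.

Let term k x : \bar R := (A * M `^ (s - p) * (theta `^ (s - p)) ^+ k *
  `|u x - cell_avg (2 ^+ k) u x| `^ p)%:E.

Let coef0 k : 0 <= A * M `^ (s - p) * (theta `^ (s - p)) ^+ k.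
Proof.
exact: mulr_ge0 (mulr_ge0 A0 (powR_ge0 _ _)) (exprn_ge0 _ (powR_ge0 _ _)).
Qed.

Let term0 k x : (0 <= term k x)%E.
Proof. by rewrite lee_fin mulr_ge0 ?powR_ge0. Qed.

Let exp2_gt0 k : (0 : R) < 2 ^+ k. Proof. exact: exprn_gt0. Qed.

Let theta_exp k : (2 ^+ k : R) `^ (1 - N%:R / p) = theta ^+ k.
Proof.
by rewrite -powR_mulrn// -powRrM mulrC powRrM powR_mulrn ?powR_ge0.
Qed.

Let half_le k x : D * M * theta ^+ k <= `|u x| ->
  `|u x| `^ p <= 2 `^ p * `|u x - cell_avg (2 ^+ k) u x| `^ p.
Proof.
move=> h; rewrite -powRM//; apply: ge0_ler_powR; rewrite ?nnegrE ?(ltW p0) ?mulr_ge0//.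
have := cell_avg_le p1 pN P1 K0 M0 uE x (exp2_gt0 k).
rewrite theta_exp; set a := cell_avg _ _ _ => ha.
have tM : 0 <= M * theta ^+ k by rewrite mulr_ge0 ?exprn_ge0 ?(ltW M0) ?(ltW theta0).
have := lerB_dist (u x) a.
have : 2 * `|a| <= `|u x|.
  by apply: le_trans h; rewrite /D -mulrA mulrDl mul1r mulrA; lra.
lra.
Qed.

(* At a level between consecutive sup bounds of the dyadic averages, half of
   |u x| comes from the oscillation of u at that dyadic scale. *)
Lemma powR_le_dyadic x : ((`|u x| `^ s)%:E <=
  (M `^ (s - Q) * `|u x| `^ Q)%:E + \sum_(k <oo) term k x)%E.
Proof.
have s0 : 0 < s by exact: lt_trans p_lt_s.
have S0 : (0 <= \sum_(k <oo) term k x)%E by apply: nneseries_ge0.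
have Q0 : (0 <= (M `^ (s - Q) * `|u x| `^ Q)%:E :> \bar R)%E.
  by rewrite lee_fin mulr_ge0 ?powR_ge0.
have [u0|ux0] := eqVneq (u x) 0.
  have -> : `|u x| `^ s = 0 by rewrite u0 normr0 powR0 ?gt_eqF.
  exact: adde_ge0.
have t0 : 0 < `|u x| by rewrite normr_gt0.
(* Above the top level no level bounds |u| from above; [powR_between] splits |u|^s there, and this
   is where the L^Q part is spent. *)
have [hT|hT] := leP (D * M) `|u x|.
  apply: (@le_trans _ _ ((M `^ (s - Q) * `|u x| `^ Q)%:E + term 0 x))%E; last first.
    by rewrite leeD2l//; exact: nneseries_ge_term.
  rewrite -EFinD lee_fin addrC.
  apply: le_trans (powR_between p0 (ltW p_lt_s) sQ M0 (ltW t0)) _.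
  rewrite lerD2r expr0 mulr1 (mulrC A) -mulrA ler_wpM2l ?powR_ge0//.
  have := @half_le 0 x; rewrite expr0 mulr1 => /(_ hT) H; apply: (le_trans H).
  rewrite ler_wpM2r ?powR_ge0// /A ler_peMr ?powR_ge0// lerDl powR_ge0//.
have [n hn] : exists n, D * M * theta ^+ n <= `|u x|.
  have : theta ^+ n @[n --> \oo] --> (0 : R).
    by apply: cvg_expr; rewrite ger0_norm// ltW.
  move=> /cvgr0Pnorm_le /(_ (`|u x| / (D * M))).
  rewrite divr_gt0 ?mulr_gt0// => /(_ isT) [n _ /(_ n (leqnn n))]/= h.
  exists n; rewrite mulrC -ler_pdivlMr ?mulr_gt0//.
  by apply: le_trans h; exact: ler_norm.
(* The least such k is positive, so that |u| also lies below the level with index k - 1. *)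
pose k := ex_minn (ex_intro (fun n => D * M * theta ^+ n <= `|u x|) n hn).
have [hk kmin] : D * M * theta ^+ k <= `|u x| /\
    forall m, D * M * theta ^+ m <= `|u x| -> (k <= m)%N.
  by rewrite /k; case: ex_minnP.
have k0 : (0 < k)%N.
  rewrite lt0n; apply/eqP => k0; move: hk; rewrite k0 expr0 mulr1.
  by rewrite leNgt hT.
have hk1 : `|u x| < D * M * theta ^+ k.-1.
  rewrite ltNge; apply/negP => /kmin; rewrite -ltnS prednK// ltnn//.
apply: (@le_trans _ _ (term k x)); last first.
  apply: le_trans (nneseries_ge_term k (term0^~ x)) _.
  by rewrite leeDr.
rewrite lee_fin.
have -> : `|u x| `^ s = `|u x| `^ (s - p) * `|u x| `^ p.
  by rewrite -powRD ?subrK//; apply/implyP => _; rewrite gt_eqF.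
apply: (@le_trans _ _ ((D * M * theta ^+ k.-1) `^ (s - p) *
   (2 `^ p * `|u x - cell_avg (2 ^+ k) u x| `^ p))).
  apply: ler_pM; rewrite ?powR_ge0//; last exact: half_le.
  by apply: ge0_ler_powR; rewrite ?nnegrE ?subr_ge0 ?(ltW p_lt_s) ?(ltW hk1)//
     ?mulr_ge0 ?exprn_ge0 ?(ltW D0) ?(ltW M0) ?(ltW theta0).
rewrite mulrA ler_wpM2r ?powR_ge0//.
have -> : D * M * theta ^+ k.-1 = D / theta * M * theta ^+ k.
  rewrite -{2}(prednK k0) exprS.
  have E (d m t e : R) : t != 0 -> d * m * e = d / t * m * (t * e) by move=> ?; field.
  by apply: E; rewrite gt_eqF.
have Dt : 0 <= D / theta by rewrite divr_ge0 ?(ltW D0) ?(ltW theta0).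
rewrite powRM ?exprn_ge0 ?(ltW theta0)//; last by rewrite mulr_ge0 ?(ltW M0).
rewrite (powRM _ Dt (ltW M0)).
have -> : (theta ^+ k) `^ (s - p) = (theta `^ (s - p)) ^+ k.
  rewrite -(powR_mulrn k (ltW theta0)) -(powR_mulrn k (powR_ge0 theta (s - p))) -!powRrM.
  by rewrite (mulrC k%:R).
rewrite mulrC !mulrA.
rewrite !ler_wpM2r ?exprn_ge0 ?powR_ge0//.
by rewrite /A ler_wpM2l ?powR_ge0// lerDr.
Qed.

(** By the Poincare bound at scale 2^k, the k-th term integrates to at most a constant times rho^k
    M^s, which is summable in k. *)
Lemma sobolev_interpolation :
  (\int[leb]_x (`|u x| `^ s)%:E <= (sobolev_const * M `^ s)%:E)%E.
Proof.
have [_ _ _ uQ] := uE.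
have mterm k : measurable_fun setT (term k).
  apply/measurable_EFinP; apply: measurable_funM => //.
  apply/measurable_EFinP; apply: measurable_powR_norm; apply: measurable_funB => //.
  exact: measurable_cell_avg.
have mQ : measurable_fun setT (fun x => (M `^ (s - Q) * `|u x| `^ Q)%:E).
  by apply/measurable_EFinP; apply: measurable_funM => //; exact/measurable_EFinP/measurable_powR_norm.
have mS : measurable_fun setT (fun x => \sum_(k <oo) term k x)%E.
  by apply: ge0_emeasurable_sum => // k _.
apply: (@le_trans _ _ (\int[leb]_x ((M `^ (s - Q) * `|u x| `^ Q)%:E + \sum_(k <oo) term k x)))%E.
  apply: ge0_le_integral => //.
  - exact: measurable_powR_norm.
  - exact: emeasurable_funD.
  - by move=> x _; exact: powR_le_dyadic.
rewrite ge0_integralD//; last 2 first.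
- by move=> x _; rewrite lee_fin mulr_ge0 ?powR_ge0.
- by move=> x _; exact: nneseries_ge0.
rewrite /sobolev_const mulrDl mul1r EFinD; apply: leeD.
  under eq_integral do rewrite EFinM.
  rewrite ge0_integralZl//; last 2 first.
  - exact: measurable_powR_norm.
  - by rewrite lee_fin powR_ge0.
  apply: (@le_trans _ _ ((M `^ (s - Q))%:E * (M `^ Q)%:E)%E).
    by rewrite lee_wpmul2l// lee_fin powR_ge0.
  rewrite -EFinM -powRD ?subrK//; apply/implyP => _; rewrite gt_eqF//.
rewrite integral_nneseries//.
rewrite mulrAC.
apply: nneseries_geometric_le => //.
- exact: mulr_ge0 (mulr_ge0 (mulr_ge0 A0 (exprn_ge0 _ _)) (powR_ge0 _ _)) (powR_ge0 _ _).
- by move=> k; exact: integral_ge0.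
move=> k; rewrite /term; under eq_integral do rewrite EFinM.
rewrite ge0_integralZl//; last 2 first.
- by apply: measurable_powR_norm; apply: measurable_funB => //; exact: measurable_cell_avg.
- by rewrite lee_fin.
have B := poincare_cell p1 (ltW P1) uE (exp2_gt0 k).
apply: le_trans (lee_wpmul2l _ B) _.
  by rewrite lee_fin.
rewrite -EFinM lee_fin !powRM ?mulr_ge0 ?(ltW M0)//.
have -> : (2 ^+ k : R) `^ p = (2 `^ p) ^+ k.
  by rewrite -(powR_mulrn k (ler0n R 2)) -(powR_mulrn k (powR_ge0 2 p)) -!powRrM mulrC.
have -> : M `^ s = M `^ (s - p) * M `^ p.
  by rewrite -powRD ?subrK//; apply/implyP => _; rewrite gt_eqF.
rewrite /rho exprMn le_eqVlt; apply/orP; left; apply/eqP.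
by move: (A) (theta `^ _) => a t; ring.
Qed.

End sobolev_interpolation.

(** * Weighted estimates *)

Section spaceV_data.
Context {R : realType} {N : nat}.
Local Notation leb := (@lebesgue_measure_rV R N).
Implicit Types (u : 'rV[R]_N -> R).

Lemma Lnorm_le_powR d (T : measurableType d) (m : {measure set T -> \bar R})
    (f : T -> R) (s M : R) : 0 < s -> 0 <= M ->
  ('N[m]_(s%:E) [EFin \o f] <= M%:E)%E ->
  (\int[m]_x (`|f x| `^ s)%:E <= (M `^ s)%:E)%E.
Proof.
move=> s0 M0 fM.
rewrite (_ : \int[m]_x _ = 'N[m]_(s%:E) [EFin \o f] `^ s)%E; last first.
  by rewrite poweR_Lnorm ?gt_eqF//; apply: eq_integral => x _.
rewrite -poweR_EFin; apply: gt0_ler_poweR => //; first exact: ltW.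
- by rewrite in_itv/= Lnorm_ge0 leey.
- by rewrite in_itv/= lee_fin M0 leey.
Qed.

Lemma enorm_ge0 (x : 'rV[R]_N) : 0 <= enorm x. Proof. exact: sqrtr_ge0. Qed.

Lemma coord_le_enorm (x : 'rV[R]_N) i : `|x ord0 i| <= enorm x.
Proof.
rewrite /enorm -sqrtr_sqr ler_wsqrtr// (bigD1 i)//= lerDl.
by apply: sumr_ge0 => j _; exact: sqr_ge0.
Qed.

Lemma measurable_enorm : measurable_fun setT (@enorm R N).
Proof.
apply: (measurableT_comp (f := @Num.sqrt R)).
  by apply: continuous_measurable_fun; exact: sqrt_continuous.
by apply: measurable_sum => k; apply: measurable_funX; exact: measurable_coord.
Qed.

(** Its p-th power is the factor N^p N of [shift_estimate]. *)
Definition translation_const (p : R) : R := N%:R * N%:R `^ p^-1.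

Lemma translation_const_ge0 p : 0 <= translation_const p.
Proof. by rewrite mulr_ge0 ?powR_ge0. Qed.

Lemma spaceV_sobolev_data (p q M : R) u : 1 < p -> 0 < star N p -> 0 < star2 N q ->
  0 < M -> spaceV p q u -> (normV p q u <= M%:E)%E ->
  sobolev_data p (star N p) (star2 N q) (translation_const p) M u.
Proof.
move=> p1 P0 Q0 M0 [[uP exG ugp] uQ] nM.
have p0 : 0 < p by exact: lt_trans p1.
have uG : is_weak_grad u (weak_grad u) by exact: (xgetPex (fun=> 0) exG).
have n0 : (0 <= 'N[leb]_(p%:E) [EFin \o norm_grad u])%E by exact: Lnorm_ge0.
have n1 : (0 <= 'N[leb]_((star2 N q)%:E) [EFin \o u])%E by exact: Lnorm_ge0.
have gM : ('N[leb]_(p%:E) [EFin \o norm_grad u] <= M%:E)%E.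
  by apply: le_trans nM; rewrite /normV leeDl.
have qM : ('N[leb]_((star2 N q)%:E) [EFin \o u] <= M%:E)%E.
  by apply: le_trans nM; rewrite /normV leeDr.
split.
- by case: uG => -[].
- move=> y H H0 yH; apply: le_trans (shift_estimate uG p1 H0 yH) _.
  have := Lnorm_le_powR p0 (ltW M0) gM => gp.
  apply: (@le_trans _ _ ((N%:R `^ p * N%:R * H `^ p)%:E * (M `^ p)%:E)%E).
    apply: lee_wpmul2l; first by rewrite lee_fin !mulr_ge0 ?powR_ge0.
    apply: le_trans gp; rewrite le_eqVlt; apply/orP; left; apply/eqP.
    by apply: eq_integral => x _; rewrite /norm_grad ger0_norm// enorm_ge0.
  rewrite -EFinM lee_fin /translation_const !powRM ?mulr_ge0 ?powR_ge0 ?(ltW M0)//.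
  by rewrite -powRrM mulVf ?gt_eqF// powRr1.
- move: uP; rewrite inE => /andP[_]; rewrite inE /finite_norm => h.
  have := lty_poweRy; rewrite (_ : \int[leb]_x _ = 'N[leb]_((star N p)%:E) [EFin \o u] `^ star N p)%E; last first.
    by rewrite poweR_Lnorm ?gt_eqF//; apply: eq_integral => x _.
  by move=> _; exact: poweR_lty.
- exact: Lnorm_le_powR Q0 (ltW M0) qM.
Qed.

End spaceV_data.

(** * Power weights near the origin and at infinity *)

Section weights.
Context {R : realType} {N : nat}.
Local Notation leb := (@lebesgue_measure_rV R N).

Lemma measurable_enorm_powR (a : R) :
  measurable_fun setT (fun x : 'rV[R]_N => (enorm x `^ a)%:E).
Proof.
apply/measurable_EFinP; apply: (measurableT_comp (f := fun r : R => r `^ a)).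
  exact: measurable_powR.
exact: measurable_enorm.
Qed.

(** The cube is closed, so it is placed in the larger half-open box of side 4r. *)
Lemma lebesgue_measure_cube_le (r : R) : 0 < r ->
  (leb (cube r) <= ((4 * r) ^+ N)%:E)%E.
Proof.
move=> r0.
have : (leb (cube r) <= leb (box (\row_i (- (2 * r))) (\row_i (2 * r)))%R)%E.
  apply: le_measure; rewrite ?inE; [exact: measurable_cube|exact: measurable_box|].
  move=> x xr i; rewrite !mxE; have := xr i; rewrite /= in_itv/= => /andP[x1 x2].
  by apply/andP; split; lra.
move=> /le_trans; apply; rewrite lebesgue_measure_box lee_fin le_eqVlt.
apply/orP; left; apply/eqP.
transitivity (\prod_(i < N) (4 * r)); last by rewrite prodr_const card_ord.
by apply: eq_bigr => i _; rewrite !mxE opprK max_r; [ring|lra].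
Qed.

(** On D, [g] is dominated by the sum of [c k] times the indicator of the k-th cube, and the volumes
    make the integrals geometric. It serves both with cubes shrinking to the origin and with cubes
    growing to infinity. *)
Lemma integral_cover_le (D : set 'rV[R]_N) (g : 'rV[R]_N -> R) (c r_ : nat -> R) (A r : R) :
  measurable D -> measurable_fun setT (EFin \o g) -> (forall x, 0 <= g x) ->
  (forall k, 0 <= c k) -> (forall k, 0 < r_ k) -> 0 <= A -> 0 <= r -> r < 1 ->
  (forall k, c k * (4 * r_ k) ^+ N <= A * r ^+ k) ->
  (forall x, D x -> g x != 0 -> exists k, g x <= c k /\ cube (r_ k) x) ->
  (\int[leb]_(x in D) (g x)%:E <= (A / (1 - r))%:E)%E.
Proof.
move=> mD mg g0 c0 r0 A0 rg0 r1 cA cov.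
pose f k (x : 'rV[R]_N) : \bar R := ((c k)%:E * (\1_(cube (r_ k)) x)%:E)%E.
have f0 k x : (0 <= f k x)%E by rewrite mule_ge0// lee_fin ?indicE.
have mf k : measurable_fun setT (f k).
  apply: emeasurable_funM => //; apply/measurable_EFinP.
  by apply: measurable_indic; exact: measurable_cube.
have mS : measurable_fun setT (fun x => \sum_(k <oo) f k x)%E.
  by apply: ge0_emeasurable_sum => // k _.
apply: (@le_trans _ _ (\int[leb]_(x in D) \sum_(k <oo) f k x)%E).
  apply: ge0_le_integral => //.
  - by move=> x _; rewrite lee_fin.
  - exact: measurable_funS mg.
  - exact: measurable_funS mS.
  - move=> x Dx; have [->|gx] := eqVneq (g x) 0; first exact: nneseries_ge0.
    have [k [gk xk]] := cov x Dx gx.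
    apply: le_trans (nneseries_ge_term k (f0^~ x)).
    by rewrite /f indicE mem_set// mule1 lee_fin.
rewrite integral_nneseries//; last by move=> k; exact: measurable_funS (mf k).
apply: nneseries_geometric_le => // k; first exact: integral_ge0.
apply: (@le_trans _ _ (\int[leb]_x f k x)%E).
  exact: ge0_subset_integral.
rewrite /f ge0_integralZl//; last 2 first.
- by apply/measurable_EFinP; apply: measurable_indic; exact: measurable_cube.
- by rewrite lee_fin.
rewrite integral_indic//; last exact: measurable_cube.
rewrite setIT; apply: (@le_trans _ _ ((c k)%:E * ((4 * r_ k) ^+ N)%:E)%E).
  by apply: lee_wpmul2l; rewrite ?lee_fin//; exact: lebesgue_measure_cube_le.
by rewrite -EFinM lee_fin.
Qed.

Lemma powR2_itv (a : R) : a < 0 -> 0 < (2 : R) `^ a < 1.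
Proof.
move=> a0; rewrite powR_gt0//= -(opprK a) powRN invf_lt1 ?powR_gt0//.
have : (1 : R) `^ (- a) < 2 `^ (- a).
  by apply: gt0_ltr_powR; rewrite ?nnegrE ?ltr1n// oppr_gt0.
by rewrite powR1.
Qed.

Lemma exists_pow2_lt (x : R) : 0 < x -> exists n : nat, 2 ^- n < x.
Proof.
move=> x0; exists (Num.truncn x^-1).
rewrite -[ltRHS]invrK ltf_pV2 ?posrE ?exprn_gt0 ?invr_gt0//.
apply: lt_le_trans (truncnS_gt _) _.
by rewrite -natrX ler_nat ltn_expl.
Qed.

Lemma powR_exprn2 (a : R) n : (2 ^+ n : R) `^ a = (2 `^ a) ^+ n.
Proof.
by rewrite -(powR_mulrn n (ler0n R 2)) -(powR_mulrn n (powR_ge0 2 a)) -!powRrM mulrC.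
Qed.

Lemma exprn_powR2 n k : (2 ^+ n : R) ^+ k = (2 `^ k%:R) ^+ n.
Proof. by rewrite powR_mulrn// -!exprM mulnC. Qed.

Definition in_cube (r : R) (x : 'rV[R]_N) : bool := [forall i, `|x ord0 i| <= r].

Lemma in_cubeP r x : reflect (cube r x) (in_cube r x).
Proof.
apply: (iffP forallP) => h i; first by rewrite /= in_itv/= -ler_norml.
by have := h i; rewrite /= in_itv/= -ler_norml.
Qed.

Lemma notin_cube_enorm r x : ~~ in_cube r x -> r < enorm x.
Proof.
rewrite negb_forall => /existsP[i]; rewrite -ltNge => /lt_le_trans; apply.
exact: coord_le_enorm.
Qed.

Lemma powRN_le (s t a : R) : 0 < s -> s <= t -> 0 <= a -> t `^ (- a) <= s `^ (- a).
Proof.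
move=> s0 st a0; have t0 : 0 < t by exact: lt_le_trans st.
rewrite !powRN lef_pV2 ?posrE ?powR_gt0//.
by apply: ge0_ler_powR; rewrite ?nnegrE ?(ltW s0) ?(ltW t0).
Qed.

(** A point of the k-th shell lies in the cube of radius 2^-(m+k) and outside the next one. The
    weight is at most 2^(a (m+k+1)) on a volume of order 2^(-N (m+k)), which is summable for a <
    N. *)
Lemma integral_weight_inner (a : R) : 0 < a -> a < N%:R ->
  exists2 A : R, 0 <= A & forall m : nat,
  (\int[leb]_(x in cube (2 ^- m)) (enorm x `^ (- a))%:E <=
   (A * (2 `^ (a - N%:R)) ^+ m)%:E)%E.
Proof.
move=> a0 aN; set r := 2 `^ (a - N%:R).
have /andP[r0 r1] : 0 < r < 1 by apply: powR2_itv; rewrite subr_lt0.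
pose A := 2 `^ a * 4 ^+ N.
have A0 : 0 <= A by rewrite mulr_ge0 ?powR_ge0 ?exprn_ge0.
exists (A / (1 - r)); first by rewrite divr_ge0// subr_ge0 ltW.
move=> m; rewrite mulrAC.
have Am0 : 0 <= A * r ^+ m by rewrite mulr_ge0// exprn_ge0 ?ltW.
apply: (@integral_cover_le _ _ (fun k => (2 ^+ (m + k).+1) `^ a)
  (fun k => 2 ^- (m + k)) _ _ (@measurable_cube _ _ _) (measurable_enorm_powR _)
  (fun x => powR_ge0 _ _) (fun k => powR_ge0 _ _) _ Am0 (ltW r0) r1).
- by move=> k; rewrite invr_gt0 exprn_gt0.
- move=> k; rewrite -mulrA -exprD; set n := (m + k)%N.
  rewrite powR_exprn2 exprMn exprVn exprn_powR2 /r /A powRD ?pnatr_eq0 ?implybT//.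
  rewrite powRN exprMn exprVn exprS le_eqVlt; apply/orP; left; apply/eqP.
  by move: (2 `^ a) (_^-1) (_ ^+ n) => ? ? ?; ring.
- move=> x xm gx.
  (* At the origin the weight takes the default value 0, so a point where it is nonzero has positive
     norm. *)
  have x0 : 0 < enorm x.
    rewrite lt_neqAle eq_sym enorm_ge0 andbT; apply: contra_neq gx => ->.
    by rewrite powR0// oppr_eq0 gt_eqF.
  have [i xi0] : exists i, x ord0 i != 0.
    apply/existsP; rewrite -negb_forall; apply: contraTN x0 => /forallP xi0.
    rewrite -leNgt /enorm big1 ?sqrtr0// => i _.
    by have /eqP -> := xi0 i; rewrite expr0n.
  have [n0 hn0] : exists n, ~~ in_cube (2 ^- (m + n)) x.
    have [n hn] : exists n : nat, 2 ^- n < `|x ord0 i| by apply: exists_pow2_lt; rewrite normr_gt0.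
    exists n; rewrite negb_forall; apply/existsP; exists i; rewrite -ltNge.
    apply: le_lt_trans hn; rewrite lef_pV2 ?posrE ?exprn_gt0//.
    by apply: ler_weXn2l; [rewrite ler1n|rewrite leq_addl].
  have [j hj jmin] := ex_minnP (ex_intro (fun n => ~~ in_cube (2 ^- (m + n)) x) n0 hn0).
  case: j hj jmin => [|k] hj jmin.
    by move: hj; rewrite addn0 => /negP; case; exact/in_cubeP.
  exists k; split.
    have h := notin_cube_enorm hj.
    apply: (@le_trans _ _ ((2 ^- (m + k.+1)) `^ (- a))).
      by apply: powRN_le; rewrite ?invr_gt0 ?exprn_gt0 ?(ltW h) ?(ltW a0).
    rewrite addnS -(powR_inv1 (exprn_ge0 _ (ler0n R 2))) -powRrM mulrNN mul1r//.
  apply/in_cubeP; apply/negPn/negP => /jmin; rewrite ltnn//.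
Qed.

(** A point of the k-th shell has norm above 2^(m+k) and lies in the cube of radius 2^(m+k+1); this
    extra 2 times the 4 of the volume bound gives the 8. *)
Lemma integral_weight_outer (b : R) : N%:R < b ->
  exists2 A : R, 0 <= A & forall m : nat,
  (\int[leb]_(x in ~` cube (2 ^+ m)) (enorm x `^ (- b))%:E <=
   (A * (2 `^ (N%:R - b)) ^+ m)%:E)%E.
Proof.
move=> Nb; set r := 2 `^ (N%:R - b).
have b0 : 0 <= b by apply: le_trans (ltW Nb).
have /andP[r0 r1] : 0 < r < 1 by apply: powR2_itv; rewrite subr_lt0.
pose A : R := 8 ^+ N.
have A0 : 0 <= A by rewrite exprn_ge0.
exists (A / (1 - r)); first by rewrite divr_ge0// subr_ge0 ltW.
move=> m; rewrite mulrAC.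
have Am0 : 0 <= A * r ^+ m by rewrite mulr_ge0// exprn_ge0 ?ltW.
apply: (@integral_cover_le _ _ (fun k => (2 ^+ (m + k)) `^ (- b))
  (fun k => 2 ^+ (m + k).+1) _ _ (measurableC (@measurable_cube _ _ _)) (measurable_enorm_powR _)
  (fun x => powR_ge0 _ _) (fun k => powR_ge0 _ _) _ Am0 (ltW r0) r1).
- by move=> k; rewrite exprn_gt0.
- move=> k; rewrite -mulrA -exprD; set n := (m + k)%N.
  rewrite powR_exprn2 exprS mulrA (_ : 4 * 2 = 8 :> R); last by rewrite -natrM.
  rewrite exprMn exprn_powR2 /r /A powRD ?pnatr_eq0 ?implybT//.
  rewrite exprMn le_eqVlt; apply/orP; left; apply/eqP.
  by rewrite mulrCA (mulrC (_ ^+ n)).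
- move=> x xm gx.
  have xm' : ~~ in_cube (2 ^+ m) x by apply/negP => /in_cubeP.
  have [n0 hn0] : exists n, in_cube (2 ^+ (m + n)) x.
    have [n hn] := rV_natbound x; exists n; apply/forallP => i.
    apply: (le_trans (ltW (hn i))); rewrite -natrX ler_nat.
    by apply: (leq_trans (ltnW (ltn_expl n (ltnSn 1)))); rewrite leq_exp2l ?leq_addl.
  have [j hj jmin] := ex_minnP (ex_intro (fun n => in_cube (2 ^+ (m + n)) x) n0 hn0).
  case: j hj jmin => [|k] hj jmin.
    by move: hj; rewrite addn0 (negbTE xm').
  exists k; split; last by apply/in_cubeP; rewrite -addnS.
  have hk : ~~ in_cube (2 ^+ (m + k)) x by apply/negP => /jmin; rewrite ltnn.
  by apply: powRN_le; rewrite ?exprn_gt0 ?(ltW (notin_cube_enorm hk)).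
Qed.

(** Decided by comparing w with (t/L)^(q - r): at equality t^r w and both terms on the right
    coincide. *)
Lemma powR_mul_le (t w r q L : R) : 0 <= t -> 0 <= w -> 0 < r -> r < q -> 0 < L ->
  t `^ r * w <= L `^ (r - q) * t `^ q + L `^ r * w `^ (q / (q - r)).
Proof.
move=> t0 w0 r0 rq L0.
have qr0 : 0 < q - r by rewrite subr_gt0.
have q0 : 0 < q by exact: lt_trans rq.
have tL0 : 0 <= t / L by rewrite divr_ge0// ltW.
have [h|h] := leP w ((t / L) `^ (q - r)).
  apply: (@le_trans _ _ (L `^ (r - q) * t `^ q)); last by rewrite lerDl mulr_ge0 ?powR_ge0.
  apply: (@le_trans _ _ (t `^ r * (t / L) `^ (q - r))); first by rewrite ler_wpM2l ?powR_ge0.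
  rewrite powRM ?invr_ge0 ?(ltW L0)// mulrA -powRD; last by rewrite addrC subrK gt_eqF.
  rewrite addrC subrK mulrC -(powR_inv1 (ltW L0)) -powRrM mulN1r opprB//.
apply: (@le_trans _ _ (L `^ r * w `^ (q / (q - r)))); last by rewrite lerDr mulr_ge0 ?powR_ge0.
have wE : w `^ (q / (q - r)) = w `^ (r / (q - r)) * w.
  rewrite -{3}(powRr1 w0) -powRD; first by congr (_ `^ _); field; rewrite gt_eqF.
  by rewrite gt_eqF// ltr_pwDr// divr_ge0// ltW.
rewrite wE mulrA ler_wpM2r//.
have -> : t `^ r = L `^ r * (t / L) `^ r.
  by rewrite -powRM ?(ltW L0)//; congr (_ `^ _); field; rewrite gt_eqF.
rewrite ler_wpM2l ?powR_ge0//.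
have -> : (t / L) `^ r = ((t / L) `^ (q - r)) `^ (r / (q - r)).
  by rewrite -powRrM; congr (_ `^ _); field; rewrite gt_eqF.
apply: ge0_ler_powR; rewrite ?nnegrE ?powR_ge0 ?(ltW h)//.
by rewrite divr_ge0// ltW.
Qed.

Lemma integral_weighted_le (D : set 'rV[R]_N) (u : 'rV[R]_N -> R) (eta r q L B I : R) :
  measurable D -> measurable_fun setT u -> 0 < r -> r < q -> 0 < L ->
  (\int[leb]_x (`|u x| `^ q)%:E <= B%:E)%E ->
  (\int[leb]_(x in D) (enorm x `^ (- (eta * q / (q - r))))%:E <= I%:E)%E ->
  (\int[leb]_(x in D) (`|u x| `^ r * enorm x `^ (- eta))%:E <=
   (L `^ (r - q) * B + L `^ r * I)%:E)%E.
Proof.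
move=> mD mu_u r0 rq L0 uB wI.
have m1 : measurable_fun D (fun x => (`|u x| `^ q)%:E).
  by apply: measurable_funS (measurable_powR_norm q mu_u).
have m2 a : measurable_fun D (fun x : 'rV[R]_N => (enorm x `^ a)%:E).
  by apply: measurable_funS (measurable_enorm_powR a).
have mr : measurable_fun D (fun x => (`|u x| `^ r)%:E).
  by apply: measurable_funS (measurable_powR_norm r mu_u).
apply: (@le_trans _ _ (\int[leb]_(x in D) ((L `^ (r - q))%:E * (`|u x| `^ q)%:E +
    (L `^ r)%:E * (enorm x `^ (- (eta * q / (q - r))))%:E))%E).
  apply: ge0_le_integral => //.
  - by move=> x _; rewrite lee_fin mulr_ge0 ?powR_ge0.
  - by under eq_fun do rewrite EFinM; apply: emeasurable_funM.
  - by apply: emeasurable_funD; apply: emeasurable_funM.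
  - move=> x _; rewrite -!EFinM -EFinD lee_fin.
    apply: le_trans (powR_mul_le (normr_ge0 _) (powR_ge0 _ _) r0 rq L0) _.
    by rewrite -powRrM mulNr mulrA.
have c0 a : (0 <= (L `^ a)%:E :> \bar R)%E by rewrite lee_fin powR_ge0.
have f0 (b : R) a x : D x -> (0 <= (b `^ a)%:E :> \bar R)%E by rewrite lee_fin powR_ge0.
rewrite ge0_integralD//; last 4 first.
- by move=> x _; rewrite mule_ge0// lee_fin powR_ge0.
- by apply: emeasurable_funM.
- by move=> x _; rewrite mule_ge0// lee_fin powR_ge0.
- by apply: emeasurable_funM.
have E (f : 'rV[R]_N -> \bar R) a : measurable_fun D f -> (forall x, 0 <= f x)%E ->
    (\int[leb]_(x in D) ((L `^ a)%:E * f x) = (L `^ a)%:E * \int[leb]_(x in D) f x)%E.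
  by move=> mf fx0; rewrite ge0_integralZl.
rewrite !E//; last by move=> x; rewrite lee_fin powR_ge0.
rewrite EFinD !EFinM; apply: leeD.
  apply: lee_wpmul2l; first by rewrite lee_fin powR_ge0.
  apply: le_trans uB; apply: ge0_subset_integral => //.
  exact: measurable_powR_norm.
by apply: lee_wpmul2l; first by rewrite lee_fin powR_ge0.
Qed.

End weights.

(** * Weighted estimates, uniform on balls of V *)

Section weighted_embedding.
Context {R : realType} {N : nat}.
Local Notation leb := (@lebesgue_measure_rV R N).
Variables (p P Q K eta r : R).
Hypotheses (p1 : 1 < p) (pN : p < N%:R) (P1 : 1 < P) (K0 : 0 <= K) (PQ : P < Q).
Hypotheses (PE : P * (N%:R - p) = N%:R * p).
Hypotheses (eta0 : 0 < eta) (etaN : eta < N%:R) (r1 : 1 <= r).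
Hypotheses (Pr : P * (N%:R - eta) < r * N%:R) (rQ : r * N%:R < Q * (N%:R - eta)).

Let N0 : (0 : R) < N%:R. Proof. exact: lt_trans etaN. Qed.
Let Neta : 0 < N%:R - eta. Proof. by rewrite subr_gt0. Qed.
Let r0 : 0 < r. Proof. exact: lt_le_trans r1. Qed.
Let P0 : 0 < P. Proof. exact: lt_trans P1. Qed.
Let Q0 : 0 < Q. Proof. exact: lt_trans PQ. Qed.

Lemma weighted_exponent_lt : r < Q.
Proof.
rewrite -(ltr_pM2r N0); apply: (lt_trans rQ).
by rewrite ltr_pM2l// gtrBl.
Qed.

Let rltQ := weighted_exponent_lt.

(** The last condition says eta s / (s - r) > N, that is, integrability at infinity. An admissible s
    exists because r and P both lie below Q and below r N / (N - eta): for r this uses eta > 0, for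
    P the lower bound on r. *)
Lemma exists_outer_exponent : exists s, [/\ r < s, P < s, s < Q & s * (N%:R - eta) < r * N%:R].
Proof.
pose a := Num.max r P; pose b := Num.min Q (r * N%:R / (N%:R - eta)).
have ab : a < b.
  rewrite lt_min !gt_max rltQ PQ /= !ltr_pdivlMr// Pr andbT.
  by rewrite ltr_pM2l// gtrBl.
exists ((a + b) / 2).
have [ha hb] := midf_lt ab.
have ra : r <= a by rewrite le_max lexx.
have Pa : P <= a by rewrite le_max lexx orbT.
have bQ : b <= Q by rewrite ge_min lexx.
have bN : b <= r * N%:R / (N%:R - eta) by rewrite ge_min lexx orbT.
split.
- exact: le_lt_trans ha.
- exact: le_lt_trans ha.
- exact: lt_le_trans bQ.
- by rewrite -ltr_pdivlMr//; exact: lt_le_trans bN.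
Qed.

Lemma near_geometric_le (A q e : R) : 0 <= q -> q < 1 -> 0 < e ->
  \forall m \near \oo, A * q ^+ m <= e.
Proof.
move=> q0 q1 e0.
have : A * q ^+ n @[n --> \oo] --> (0 : R).
  rewrite -[X in _ --> X](mulr0 A); apply: cvgM; first exact: cvg_cst.
  by apply: cvg_expr; rewrite ger0_norm.
move=> /cvgr0Pnorm_le /(_ e e0); apply: filterS => n.
by apply: le_trans; exact: ler_norm.
Qed.

(** The parameter L of Young's inequality is fixed before m, and neither depends on u: hence a tail
    bound uniform in u. *)
Lemma weighted_tail (D : nat -> set 'rV[R]_N) (q A g B e : R) :
  (forall m, measurable (D m)) -> r < q -> 0 <= g -> g < 1 -> 0 < B -> 0 < e ->
  (forall m, (\int[leb]_(x in D m) (enorm x `^ (- (eta * q / (q - r))))%:E <=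
     (A * g ^+ m)%:E)%E) ->
  \forall m \near \oo, forall u : 'rV[R]_N -> R, measurable_fun setT u ->
    (\int[leb]_x (`|u x| `^ q)%:E <= B%:E)%E ->
    (\int[leb]_(x in D m) (`|u x| `^ r * enorm x `^ (- eta))%:E <= e%:E)%E.
Proof.
move=> mD rq g0 g1 B0 e0 wA.
have qr : 0 < q - r by rewrite subr_gt0.
(* Solves L^(r - q) B = e / 2, the first half of the budget; m large takes care of the other
   half. *)
pose L := (2 * B / e) `^ (q - r)^-1.
have Be : 0 < 2 * B / e by rewrite divr_gt0 ?mulr_gt0.
have L0 : 0 < L by exact: powR_gt0.
have LE : L `^ (r - q) * B = e / 2.
  rewrite /L -powRrM (_ : (q - r)^-1 * (r - q) = -1); last first.
    by field; rewrite gt_eqF.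
  rewrite powR_inv1 ?(ltW Be)//.
  by field; rewrite !gt_eqF.
have e20 : 0 < e / 2 by rewrite divr_gt0.
apply: filterS (near_geometric_le (L `^ r * A) g0 g1 e20) => m hm u mu_u uB.
apply: le_trans (integral_weighted_le (mD m) mu_u r0 rq L0 uB (wA m)) _.
by rewrite lee_fin LE mulrA [leRHS](splitr e) lerD2l.
Qed.

(** A rewriting of [rQ]: the upper bound on r says that the power of the weight paired with L^Q is
    integrable at the origin. *)
Let aN : 0 < eta * Q / (Q - r) < N%:R.
Proof.
have Qr : 0 < Q - r by rewrite subr_gt0.
rewrite divr_gt0 ?mulr_gt0//= ltr_pdivrMr//; move: rQ.
rewrite !mulrBr !(mulrC _ N%:R) (mulrC Q eta); lra.
Qed.

Let bN s : r < s -> s * (N%:R - eta) < r * N%:R -> N%:R < eta * s / (s - r).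
Proof.
move=> rs; have sr : 0 < s - r by rewrite subr_gt0.
rewrite ltr_pdivlMr// !mulrBr (mulrC r) (mulrC s N%:R) (mulrC s eta); lra.
Qed.

Let ratio_ge0 (a : R) : 0 <= (2 : R) `^ a. Proof. exact: powR_ge0. Qed.

Lemma weighted_integral_tails (M e : R) : 0 < M -> 0 < e ->
  exists m : nat, forall u, sobolev_data p P Q K M u ->
  (\int[leb]_(x in cube (2 ^- m)) (`|u x| `^ r * enorm x `^ (- eta))%:E <= e%:E)%E /\
  (\int[leb]_(x in ~` cube (2 ^+ m)) (`|u x| `^ r * enorm x `^ (- eta))%:E <= e%:E)%E.
Proof.
move=> M0 e0.
have /andP[a0 aN'] := aN.
have [A1 A10 inn] := integral_weight_inner a0 aN'.
have [s [rs Ps sQ sN]] := exists_outer_exponent.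
have Nb := bN rs sN.
have [A2 A20 out] := integral_weight_outer Nb.
have ps : N%:R * p < s * (N%:R - p) by rewrite -PE ltr_pM2r// subr_gt0.
have C0 := sobolev_const_gt0 K p1 ps.
have q1 : 0 < (2 : R) `^ (eta * Q / (Q - r) - N%:R) < 1.
  by apply: powR2_itv; rewrite subr_lt0.
have q2 : 0 < (2 : R) `^ (N%:R - eta * s / (s - r)) < 1.
  by apply: powR2_itv; rewrite subr_lt0.
have T1 := weighted_tail (fun m => @measurable_cube R N (2 ^- m)) rltQ
  (ratio_ge0 _) (andP q1).2 (powR_gt0 Q M0) e0 inn.
have T2 := weighted_tail (fun m => measurableC (@measurable_cube R N (2 ^+ m))) rs
  (ratio_ge0 _) (andP q2).2 (mulr_gt0 C0 (powR_gt0 s M0)) e0 out.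
have [m _ /(_ m (leqnn m))/= [h1 h2]] := filterI T1 T2.
exists m => u uE; have [mu_u _ _ uQ] := uE; split.
  exact: h1.
apply: h2 => //.
exact: (sobolev_interpolation p1 pN P1 K0 ps (ltW sQ) M0 uE).
Qed.

Lemma weighted_integral_le : exists2 C : R, 0 < C & forall M u, 0 < M ->
  sobolev_data p P Q K M u ->
  (\int[leb]_x (`|u x| `^ r * enorm x `^ (- eta))%:E <= (C * M `^ r)%:E)%E.
Proof.
have /andP[a0 aN'] := aN.
have [A1 A10 inn] := integral_weight_inner a0 aN'.
have [s [rs Ps sQ sN]] := exists_outer_exponent.
have Nb := bN rs sN.
have [A2 A20 out] := integral_weight_outer Nb.
have ps : N%:R * p < s * (N%:R - p) by rewrite -PE ltr_pM2r// subr_gt0.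
have C0 := sobolev_const_gt0 K p1 ps.
exists (1 + A1 + (sobolev_const (N:=N) p K s + A2)).
  by apply: addr_gt0; apply: ltr_wpDr.
move=> M u M0 uE; have [mu_u _ _ uQ] := uE.
have us := sobolev_interpolation p1 pN P1 K0 ps (ltW sQ) M0 uE.
have mf : measurable_fun setT (fun x => (`|u x| `^ r * enorm x `^ (- eta))%:E).
  under eq_fun do rewrite EFinM; apply: emeasurable_funM.
    exact: measurable_powR_norm.
  exact: measurable_enorm_powR.
have mc := @measurable_cube R N 1.
have := inn 0; rewrite expr0 invr1 mulr1 => inn0.
have := out 0; rewrite !expr0 mulr1 => out0.
(* Young's inequality is used with L = M, which makes all terms homogeneous of degree r in M. *)
have I1 := integral_weighted_le mc mu_u r0 rltQ M0 uQ inn0.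
have I2 := integral_weighted_le (measurableC mc) mu_u r0 rs M0 us out0.
rewrite -(setUv (cube 1)) ge0_integral_setU//; last 4 first.
- exact: measurableC.
- by rewrite setUv.
- by move=> x _; rewrite lee_fin mulr_ge0 ?powR_ge0.
- by rewrite disj_set2E setICr.
apply: le_trans (leeD I1 I2) _.
rewrite -EFinD lee_fin le_eqVlt; apply/orP; left; apply/eqP.
have E (q : R) : M `^ (r - q) * M `^ q = M `^ r.
  by rewrite -powRD ?subrK//; apply/implyP => _; rewrite gt_eqF.
rewrite E mulrCA E; ring.
Qed.

End weighted_embedding.

(** * Compactness *)

Section subsequences.
Context {R : realType}.

Lemma leq_homo_ltn (s : nat -> nat) : {homo s : m n / (m < n)%N} -> forall n, (n <= s n)%N.
Proof.
by move=> hs; elim=> // n IH; apply: leq_ltn_trans IH _; exact: hs.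
Qed.

(** The argument n of [next] is the stage, so that a property imposed at stage n holds at [s n]; m
    is the previous term. *)
Lemma homo_ltn_chain (next : nat -> nat -> nat) : (forall n m, (m < next n m)%N) ->
  exists s : nat -> nat, {homo s : m n / (m < n)%N} /\
    forall n, exists m, s n = next n m.
Proof.
move=> hn; pose s := fix s n := if n is k.+1 then next k.+1 (s k) else next 0 0.
exists s; split; last by case=> [|n]; eexists.
by apply: homo_ltn; [exact: ltn_trans|move=> n; exact: hn].
Qed.

(** A sequence in a product of compact intervals has a cluster point f by Tychonoff's theorem. Stage
    n picks an index at which all coordinates up to n are within 1/(n+1) of f, so each fixed
    coordinate converges. *)
Lemma diagonal_subsequence (a : nat -> nat -> R) (B : nat -> R) :
  (forall n k, `|a n k| <= B k) ->
  exists s : nat -> nat, {homo s : m n / (m < n)%N} /\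
    forall k, cvgn (fun n => a (s n) k).
Proof.
move=> aB.
pose A k : set R := [set` `[- B k, B k]].
have cA : compact ([set f | forall k, A k (f k)] : set {ptws nat -> R}).
  by apply: (@tychonoff nat (fun=> R : topologicalType) A) => k; exact: segment_compact.
pose F : set_system {ptws nat -> R} := a @ \oo.
have FA : F [set f : nat -> R | forall k, A k (f k)].
  by exists 0%N => // n _ k; rewrite /A /= in_itv/= -ler_norml.
have [f [_ fF]] := cA F _ FA.
have near_f n m : exists i, (m < i)%N /\ forall k, (k <= n)%N -> `|a i k - f k| < n.+1%:R^-1.
  pose V := [set g : nat -> R | forall k, (k <= n)%N -> `|g k - f k| < n.+1%:R^-1].
  have ff : Filter (nbhs (f : {ptws nat -> R})) by exact: nbhs_filter.
  have fV : nbhs (f : {ptws nat -> R}) V.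
    have H k : nbhs (f : {ptws nat -> R}) [set g : nat -> R | `|g k - f k| < n.+1%:R^-1].
      have pc := @proj_continuous nat (fun=> R : topologicalType) k f
        [set t : R | `|t - f k| < n.+1%:R^-1].
      apply: pc; apply/nbhs_ballP; exists n.+1%:R^-1 => /=; first by rewrite invr_gt0 ltr0n.
      by move=> t; rewrite /ball/= distrC.
    have HV j : nbhs (f : {ptws nat -> R})
        [set g : nat -> R | forall k, (k < j)%N -> `|g k - f k| < n.+1%:R^-1].
      elim: j => [|j IH]; first by apply: filterE => g k; rewrite ltn0.
      apply: filterS (filterI IH (H j)) => g [g1 g2] k.
      by rewrite ltnS leq_eqVlt => /predU1P[->//|]; exact: g1.
    exact: (HV n.+1).
  have Fm : F [set g | exists2 i, (m < i)%N & g = a i].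
    by exists m.+1 => // i /= mi; exists i.
  have [_ [[i mi ->] hi]] := fF _ _ Fm fV.
  by exists i.
have /choice[next hnext] : forall nm : nat * nat, exists i, (nm.2 < i)%N /\
    forall k, (k <= nm.1)%N -> `|a i k - f k| < nm.1.+1%:R^-1.
  by move=> [n m]; exact: near_f.
have [s [hs sE]] := @homo_ltn_chain (fun n m => next (n, m)) (fun n m => (hnext (n, m)).1).
exists s; split=> // k; apply/cvg_ex; exists (f k).
apply/cvgrPdist_lt => e e0.
near=> n.
have kn : (k <= n)%N by near: n; exact: nbhs_infty_ge.
have ne : n.+1%:R^-1 < e by near: n; exact: near_infty_natSinv_lt (PosNum e0).
have [m ->] := sE n; rewrite distrC.
exact: lt_trans ((hnext (n, m)).2 k kn) ne.
Unshelve. all: by end_near. Qed.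

End subsequences.

(** * Completeness of weighted L^r spaces *)

Section completeness.
Context d (T : measurableType d) {R : realType} (m : {measure set T -> \bar R}).
Variables (w : T -> R) (r : R).
Hypotheses (mw : measurable_fun setT w) (w0 : forall x, 0 <= w x) (r0 : 0 < r).

Lemma measurable_weighted (f : T -> R) : measurable_fun setT f ->
  measurable_fun setT (fun x => (`|f x| `^ r * w x)%:E).
Proof.
move=> mf; under eq_fun do rewrite EFinM.
by apply: emeasurable_funM; [exact: measurable_powR_norm|exact/measurable_EFinP].
Qed.

(** Away from 0 the power is exp(r ln t); the limit 0 needs a separate argument. *)
Lemma cvg_powR_norm (u : nat -> R) (l : R) : u k @[k --> \oo] --> l ->
  `|u k| `^ r @[k --> \oo] --> `|l| `^ r.
Proof.
move=> ul; have nl : `|u k| @[k --> \oo] --> `|l| by exact: cvg_norm.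
have [l0|l0] := eqVneq l 0.
  rewrite l0 normr0 powR0 ?gt_eqF//; apply/cvgrPdist_lt => e e0.
  have er : 0 < e `^ r^-1 by exact: powR_gt0.
  move: ul; rewrite l0 => /cvgr0Pnorm_lt /(_ _ er); apply: filterS => k hk.
  rewrite sub0r normrN ger0_norm ?powR_ge0//.
  have -> : e = (e `^ r^-1) `^ r by rewrite -powRrM mulVf ?gt_eqF// powRr1// ltW.
  by apply: gt0_ltr_powR; rewrite ?nnegrE ?powR_ge0.
have l0' : 0 < `|l| by rewrite normr_gt0.
have h1 := cvg_comp _ _ nl (continuous_ln l0').
have h2 : r * ln `|u k| @[k --> \oo] --> r * ln `|l| by apply: cvgM; [exact: cvg_cst|exact: h1].
have h3 := cvg_comp _ _ h2 (@continuous_expR R _).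
rewrite [X in _ --> X]/powR gt_eqF//; apply: cvg_trans h3; apply: near_eq_cvg.
near=> k; have hk : 0 < `|u k| by near: k; exact: (cvgr_gt _ nl).
by rewrite /= /powR gt_eqF.
Unshelve. all: by end_near. Qed.

Lemma summable_increments_cvg (u : nat -> R) (A : R) : 0 <= A ->
  (forall k, `|u k.+1 - u k| <= A * 2 ^- k) -> cvgn u.
Proof.
move=> A0 uA.
have -> : u = (fun n => u 0%N + series (telescope u) n).
  by apply/funext => n; exact: eq_sum_telescope.
apply: is_cvgD; first exact: is_cvg_cst.
apply: normed_cvg.
apply: (@series_le_cvg _ _ (geometric A 2^-1)) => [n|n|n|].
- exact: normr_ge0.
- by rewrite /geometric/= mulr_ge0// exprn_ge0// invr_ge0.
- by rewrite /geometric/= exprVn; exact: uA.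
- by apply: is_cvg_geometric_series; rewrite ger0_norm ?invr_ge0// invf_lt1// ltr1n.
Qed.

Lemma weighted_complete (f : nat -> T -> R) :
  (forall n, measurable_fun setT (f n)) ->
  (forall e : R, 0 < e -> exists n0, forall i j, (n0 <= i)%N -> (n0 <= j)%N ->
     (\int[m]_x (`|f i x - f j x| `^ r * w x)%:E <= e%:E)%E) ->
  exists2 v : T -> R, measurable_fun setT v &
   forall e : R, 0 < e -> exists n0, forall i, (n0 <= i)%N ->
     (\int[m]_x (`|f i x - v x| `^ r * w x)%:E <= e%:E)%E.
Proof.
move=> mf fC.
(* Divided by (2^-k)^r these bounds are still summable. So [H] below is finite almost everywhere,
   and where w > 0 its finiteness makes the increments of the subsequence decay like 2^-k. *)
pose c k : R := 2 ^- k * (2 ^- k) `^ r.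
have c0 k : 0 < c k by rewrite mulr_gt0 ?powR_gt0// invr_gt0 exprn_gt0.
have /choice[g hg] : forall k, exists n0, forall i j, (n0 <= i)%N -> (n0 <= j)%N ->
     (\int[m]_x (`|f i x - f j x| `^ r * w x)%:E <= (c k)%:E)%E.
  by move=> k; exact: fC.
have [s [hs sE]] := @homo_ltn_chain (fun n k => maxn k.+1 (g n))
  (fun n k => leq_maxl k.+1 (g n)).
have gs k : (g k <= s k)%N by have [l ->] := sE k; rewrite leq_max leqnn orbT.
pose F k := f (s k).
pose D k x : \bar R := (((2 ^- k) `^ r)^-1%:E * (`|F k.+1 x - F k x| `^ r * w x)%:E)%E.
have D0 k x : (0 <= D k x)%E.
  by rewrite mule_ge0// lee_fin ?invr_ge0 ?mulr_ge0 ?powR_ge0.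
have mFF i j : measurable_fun setT (fun x => F i x - F j x) by apply: measurable_funB; exact: mf.
have mD k : measurable_fun setT (D k).
  by apply: emeasurable_funM => //; exact: measurable_weighted.
pose H x : \bar R := (\sum_(k <oo) D k x)%E.
have H0 x : (0 <= H x)%E by exact: nneseries_ge0.
have mH : measurable_fun setT H by apply: ge0_emeasurable_sum => // k _.
have iH : m.-integrable setT H.
  apply/integrableP; split=> //.
  under eq_integral do rewrite gee0_abs//.
  rewrite integral_nneseries//.
  apply: (@le_lt_trans _ _ (1 / (1 - 2^-1))%:E); last exact: ltry.
  apply: nneseries_geometric_le => //.
  - by rewrite invf_lt1// ltr1n.
  - by move=> k; exact: integral_ge0.
  - move=> k; rewrite /D ge0_integralZl//; last 2 first.
    + exact: measurable_weighted.
    + by move=> x _; rewrite lee_fin mulr_ge0 ?powR_ge0.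
    apply: (@le_trans _ _ (((2 ^- k) `^ r)^-1%:E * (c k)%:E)%E).
      apply: lee_wpmul2l; first by rewrite lee_fin invr_ge0 powR_ge0.
      by apply: hg => //; apply: leq_trans (gs k) _; exact/ltnW/hs.
    rewrite -EFinM lee_fin /c mul1r exprVn mulrCA mulVf ?mulr1//.
have Hfin := integrable_ae measurableT iH.
(* The upper limit is measurable without any convergence. Convergence to v is shown only where w is
   nonzero; elsewhere the weighted integrand is 0. *)
pose v x := fine (limn_esup (fun k => (F k x)%:E)).
have mv : measurable_fun setT v.
  apply: measurableT_comp => //; apply: measurable_fun_limn_esup => k.
  by apply/measurable_EFinP; exact: mf.
have vE x : H x \is a fin_num -> w x != 0 -> F k x @[k --> \oo] --> v x.
  move=> Hx wx; have wx0 : 0 < w x by rewrite lt_neqAle eq_sym wx w0.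
  have cF : cvgn (F^~ x).
    apply: (@summable_increments_cvg _ ((fine (H x) / w x) `^ r^-1)) => [|k].
      exact: powR_ge0.
    have k0 : 0 < 2 ^- k :> R by rewrite invr_gt0 exprn_gt0.
    have H1 : (D k x <= (fine (H x))%:E)%E.
      by rewrite fineK//; exact: nneseries_ge_term.
    have fH0 : 0 <= fine (H x) by exact: fine_ge0.
    move: H1; rewrite /D -EFinM lee_fin mulrC ler_pdivrMr ?powR_gt0//.
    rewrite -ler_pdivlMr// mulrAC => H1.
    apply: (powR_le_inv r0) => //; first by rewrite mulr_ge0 ?powR_ge0 ?(ltW k0).
    rewrite powRM ?powR_ge0 ?(ltW k0)// -powRrM mulVf ?gt_eqF// powRr1 ?divr_ge0//.
  have cE : (F k x)%:E @[k --> \oo] --> (limn (F^~ x))%:E by apply: cvg_EFin => //; exact: nearW.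
  rewrite /v is_cvg_limn_esupE; last by apply/cvg_ex; eexists; exact: cE.
  by rewrite (cvg_lim _ cE).
exists v => // e e0; have [n0 hn0] := fC e e0; exists n0 => i n0i.
pose G k x : \bar R := (`|f i x - F k x| `^ r * w x)%:E.
have G0 k x : (0 <= G k x)%E by rewrite lee_fin mulr_ge0 ?powR_ge0.
have mG k : measurable_fun setT (G k).
  by apply: measurable_weighted; apply: measurable_funB; exact: mf.
have mE : measurable_fun setT (fun x => limn_einf (G^~ x)).
  have -> : (fun x => limn_einf (G^~ x)) = (fun x => - limn_esup (fun k => - G k x))%E by [].
  apply: measurableT_comp => //; apply: measurable_fun_limn_esup => k.
  exact: measurableT_comp.
rewrite (@ge0_ae_eq_integral _ _ _ m setT _ (fun x => limn_einf (G^~ x)))//; first last.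
- apply: filterS Hfin => x /(_ Logic.I) Hx _ /=.
  have [wx|wx] := eqVneq (w x) 0.
    rewrite wx mulr0 (_ : G^~ x = cst 0%E); last first.
      by apply/funext => k; rewrite /G wx mulr0.
    rewrite is_cvg_limn_einfE; last exact: is_cvg_cst.
    by rewrite lim_cst.
  have hv := vE x Hx wx.
  have hG : G k x @[k --> \oo] --> (`|f i x - v x| `^ r * w x)%:E.
    apply: cvg_EFin; first exact: nearW.
    apply: cvgM; last exact: cvg_cst.
    apply: cvg_powR_norm => //.
    by apply: cvgB => //; exact: cvg_cst.
  rewrite is_cvg_limn_einfE; last by apply/cvg_ex; eexists; exact: hG.
  by rewrite (cvg_lim _ hG).
- move=> x _; rewrite limn_einf_lim; apply: lime_ge; first exact: is_cvg_einfs.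
  by apply: nearW => k; apply: le_ereal_inf_tmp => _ [l _ <-]; exact: G0.
- by move=> x _; rewrite lee_fin mulr_ge0 ?powR_ge0.
- by apply: measurable_weighted; exact: measurable_funB.
apply: (le_trans (fatou m measurableT mG _)) => //.
rewrite limn_einf_lim; apply: lime_le; first exact: is_cvg_einfs.
apply: nearW => k.
(* The index has to be at least k, to belong to the k-th tail, and at least n0, for the Cauchy bound
   to apply. *)
have le : ((\int[m]_x G (maxn k n0) x) <= e%:E)%E.
  apply: hn0 => //; apply: leq_trans (leq_homo_ltn hs _).
  exact: leq_maxr.
apply: le_trans le; apply: ereal_inf_lbound.
by exists (maxn k n0) => //=; exact: leq_maxl.
Qed.

End completeness.

Section difference_estimates.
Context d (T : measurableType d) {R : realType} (m : {measure set T -> \bar R}).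

Lemma powR_normB_le (a b r : R) : 0 <= r ->
  `|a - b| `^ r <= 2 `^ r * (`|a| `^ r + `|b| `^ r).
Proof.
move=> r0; wlog ab : a b / `|b| <= `|a|.
  move=> H; have [/H//|/ltW/H] := leP `|b| `|a|.
  by rewrite distrC [`|b| `^ r + _]addrC.
apply: (@le_trans _ _ ((2 * `|a|) `^ r)).
  apply: ge0_ler_powR; rewrite ?nnegrE ?mulr_ge0//.
  by apply: le_trans (ler_normB a b) _; rewrite mulrDl mul1r lerD2l.
by rewrite powRM// ler_wpM2l ?powR_ge0// lerDl powR_ge0.
Qed.

Lemma integral_powR_normB_le (D : set T) (w u v : T -> R) (r : R) : 0 <= r ->
  measurable D -> measurable_fun setT w -> (forall x, 0 <= w x) ->
  measurable_fun setT u -> measurable_fun setT v ->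
  (\int[m]_(x in D) (`|u x - v x| `^ r * w x)%:E <=
   (2 `^ r)%:E * (\int[m]_(x in D) (`|u x| `^ r * w x)%:E +
                  \int[m]_(x in D) (`|v x| `^ r * w x)%:E))%E.
Proof.
move=> r0 mD mw w0 mu mv.
have mf (f : T -> R) : measurable_fun setT f ->
    measurable_fun D (fun x => (`|f x| `^ r * w x)%:E).
  move=> h; have hT : measurable_fun setT (fun x => (`|f x| `^ r * w x)%:E).
    exact: measurable_weighted.
  exact: measurable_funS hT.
have g0 (f : T -> R) x : (0 <= (`|f x| `^ r * w x)%:E :> \bar R)%E.
  by rewrite lee_fin mulr_ge0 ?powR_ge0.
rewrite -ge0_integralD//; last 2 first.
- exact: mf.
- exact: mf.
rewrite -ge0_integralZl//; last 2 first.
- by apply: emeasurable_funD; exact: mf.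
- by move=> x _; rewrite adde_ge0.
apply: ge0_le_integral => //.
- by move=> x _; rewrite lee_fin mulr_ge0 ?powR_ge0.
- exact: (mf (fun x => u x - v x) (measurable_funB mu mv)).
- by apply: emeasurable_funM => //; apply: emeasurable_funD; exact: mf.
- move=> x _; rewrite -EFinD -EFinM lee_fin -mulrDl mulrA.
  by apply: ler_wpM2r => //; exact: powR_normB_le.
Qed.

(** Turns smallness in L^p into smallness in L^1 on sets of finite measure; k is a free
    threshold. *)
Lemma powR_linear_le (p t k : R) : 1 <= p -> 0 < k -> 0 <= t ->
  t <= k + k `^ (1 - p) * t `^ p.
Proof.
move=> p1 k0 t0; have [tk|kt] := leP t k.
  by rewrite (le_trans tk)// lerDl mulr_ge0 ?powR_ge0.
have t0' : 0 < t by exact: lt_trans kt.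
rewrite (@le_trans _ _ (k `^ (1 - p) * t `^ p))//; last by rewrite lerDr ltW.
have tE : t = t `^ (1 - p) * t `^ p.
  by rewrite -powRD ?subrK ?powRr1//; apply/implyP => _; rewrite gt_eqF.
rewrite [leLHS]tE ler_wpM2r ?powR_ge0//.
rewrite -(opprB p 1); apply: powRN_le => //; first exact: ltW.
by rewrite subr_ge0.
Qed.

End difference_estimates.

(** * Convergence of the averages and Cauchy property in L^1 of cubes *)

Section averages_subsequence.
Context {R : realType} {N : nat}.
Local Notation leb := (@lebesgue_measure_rV R N).
Variables (p P Q K M : R) (u : nat -> 'rV[R]_N -> R).
Hypotheses (p1 : 1 < p) (pN : p < N%:R) (P1 : 1 < P) (K0 : 0 <= K) (M0 : 0 < M).
Hypothesis uE : forall n, sobolev_data p P Q K M (u n).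

(** The averages at all meshes 2^-j form countably many numbers per function: a cell is given by j
    and an integer vector, encoded by [pickle]. The sup bound makes each of them bounded in n. *)
Lemma cell_avg_subsequence : exists s : nat -> nat, {homo s : m n / (m < n)%N} /\
  forall j x, cvgn (fun n => cell_avg (2 ^- j) (u (s n)) x).
Proof.
pose corner j (t : {ffun 'I_N -> int}) : 'rV[R]_N := \row_i ((t i)%:~R * 2 ^- j).
pose a n k := if unpickle k is Some (j, t) then
  cell_avg (2 ^- j) (u n) (corner j t) else 0.
pose B k : R := if @unpickle (nat * {ffun 'I_N -> int})%type k is Some (j, t) then
  avg_const (N := N) p K * M * (2 ^- j) `^ (1 - N%:R / p) else 0.
have h0 j : 0 < 2 ^- j :> R by rewrite invr_gt0 exprn_gt0.
have [n k|s [hs sa]] := @diagonal_subsequence R a B.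
  rewrite /a /B; case: unpickle => [[j t]|]; last by rewrite normr0.
  exact: (cell_avg_le p1 pN P1 K0 M0 (uE n)).
exists s; split=> // j x.
pose t : {ffun 'I_N -> int} := [ffun i => Num.floor (x ord0 i / 2 ^- j)].
have tx : cell (2 ^- j) x (corner j t).
  by move=> i; rewrite mxE ffunE mulfK ?gt_eqF// intrKfloor.
have := sa (pickle (j, t)); rewrite /a pickleK.
by under eq_fun do rewrite (cell_avg_eq _ tx).
Qed.

Hypothesis u_avg : forall j x, cvgn (fun n => cell_avg (2 ^- j) (u n) x).

Let mu_u n : measurable_fun setT (u n). Proof. by case: (uE n). Qed.

Let h0 j : 0 < 2 ^- j :> R. Proof. by rewrite invr_gt0 exprn_gt0. Qed.

Let leb_cube_lty b : 0 < b -> (leb (cube b) < +oo)%E.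
Proof. by move=> b0; rewrite (le_lt_trans (lebesgue_measure_cube_le b0))// ltry. Qed.

Let E j n := cell_avg (2 ^- j) (u n).

Let mE j n : measurable_fun setT (E j n).
Proof. exact: measurable_cell_avg. Qed.

(** At a fixed mesh the averages are bounded by one constant, so on a cube pointwise convergence
    gives convergence in L^1. *)
Lemma cell_avg_cauchy (b e : R) j : 0 < b -> 0 < e ->
  exists2 F : 'rV[R]_N -> R, measurable_fun setT F &
  exists n0, forall n, (n0 <= n)%N -> (\int[leb]_(x in cube b) `|E j n x - F x|%:E <= e%:E)%E.
Proof.
move=> b0 e0; pose F x := limn (fun n => E j n x).
have EF x : E j n x @[n --> \oo] --> F x by exact: u_avg.
have mF : measurable_fun setT F := measurable_fun_cvgr (mE j) EF.
exists F => //.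
have [] // := @dominated_convergence _ _ _ leb (cube b) (measurable_cube b)
  (fun n x => (E j n x)%:E) (fun x => (F x)%:E)
  (cst (avg_const (N := N) p K * M * (2 ^- j) `^ (1 - N%:R / p))%:E).
- by move=> n; apply: (@measurable_funS _ _ _ _ setT) => //; exact/measurable_EFinP.
- by apply: (@measurable_funS _ _ _ _ setT) => //; exact/measurable_EFinP.
- by apply: aeW => x _; apply: cvg_EFin; [exact: nearW|exact: EF].
- by apply: integrable_cst_lty; [exact: measurable_cube|exact: leb_cube_lty].
- by apply: aeW => x n _; rewrite lee_fin (cell_avg_le p1 pN P1 K0 M0 (uE n)).
move=> _ /(_ [set y | (y < e%:E)%E]) [].
  by apply: open_nbhs_nbhs; split; [exact: open_ereal_lt_ereal|rewrite /= lte_fin].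
move=> n0 _ hn0 _; exists n0 => n /hn0 /= /ltW; apply: le_trans.
by rewrite le_eqVlt; apply/orP; left; apply/eqP; apply: eq_integral => x _.
Qed.

(** The mesh can be chosen uniformly in n because the Poincare bound carries the factor 2^(-p j). *)
Lemma cell_avg_error (b e : R) : 0 < b -> 0 < e ->
  exists j, forall n, (\int[leb]_(x in cube b) `|u n x - E j n x|%:E <= e%:E)%E.
Proof.
move=> b0 e0; pose V : R := (4 * b) ^+ N.
have V0 : 0 < V by rewrite exprn_gt0// mulr_gt0.
(* V bounds the volume of the cube, so the threshold k contributes at most k V = e / 2. *)
pose k := e / (2 * V); have k0 : 0 < k by rewrite divr_gt0// mulr_gt0.
have e20 : 0 < e / 2 by rewrite divr_gt0.
have /andP[q0 q1] : 0 < (2 : R) `^ (- p) < 1.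
  by apply: powR2_itv; rewrite oppr_lt0; exact: lt_trans p1.
have [j _ /(_ j (leqnn j))/= hj] :=
  near_geometric_le (k `^ (1 - p) * 2 ^+ N * (K * M) `^ p) (ltW q0) q1 e20.
exists j => n.
have mD : measurable_fun setT (fun x => u n x - E j n x) by exact: measurable_funB.
have mp := measurable_powR_norm p mD.
have mc := @measurable_cube R N b.
apply: (@le_trans _ _ (\int[leb]_(x in cube b)
  (k%:E + (k `^ (1 - p))%:E * (`|u n x - E j n x| `^ p)%:E)))%E.
  apply: ge0_le_integral => //.
  - apply: (@measurable_funS _ _ _ _ setT) => //.
    by apply/measurable_EFinP; exact: measurableT_comp.
  - apply: emeasurable_funD => //; apply: emeasurable_funM => //.
    exact: measurable_funS mp.
  - by move=> x _; rewrite -EFinM -EFinD lee_fin powR_linear_le// ltW.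
rewrite ge0_integralD//; last 3 first.
- by move=> x _; rewrite lee_fin ltW.
- by move=> x _; rewrite mule_ge0// lee_fin powR_ge0.
- by apply: emeasurable_funM => //; exact: measurable_funS mp.
rewrite [e]splitr EFinD; apply: leeD.
  rewrite integral_cst//; apply: (@le_trans _ _ (k%:E * V%:E)%E).
    by apply: lee_wpmul2l; [rewrite lee_fin ltW|exact: lebesgue_measure_cube_le].
  by rewrite -EFinM lee_fin /k invfM mulrA divfK// gt_eqF.
rewrite ge0_integralZl//; last 2 first.
- exact: measurable_funS mp.
- by rewrite lee_fin powR_ge0.
apply: (@le_trans _ _ ((k `^ (1 - p))%:E * (2 ^+ N * (K * 2 ^- j * M) `^ p)%:E)%E).
  apply: lee_wpmul2l; first by rewrite lee_fin powR_ge0.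
  apply: le_trans (poincare_cell p1 (ltW P1) (uE n) (h0 j)).
  exact: ge0_subset_integral.
rewrite -EFinM lee_fin; apply: le_trans hj.
rewrite le_eqVlt; apply/orP; left; apply/eqP.
have -> : K * 2 ^- j * M = K * M * 2 ^- j by ring.
rewrite (powRM p (_ : 0 <= K * M)) ?mulr_ge0 ?(ltW M0) ?(ltW (h0 j))//.
have -> : (2 ^- j : R) `^ p = (2 `^ (- p)) ^+ j.
  by rewrite -powR_exprn2 -(powR_inv1 (exprn_ge0 _ (ler0n R 2))) -powRrM mulN1r.
by rewrite !mulrA.
Qed.

Lemma cauchy_on_cube (b e : R) : 0 < b -> 0 < e ->
  exists n0, forall i j, (n0 <= i)%N -> (n0 <= j)%N ->
    (\int[leb]_(x in cube b) `|u i x - u j x|%:E <= e%:E)%E.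
Proof.
move=> b0 e0; have e40 : 0 < e / 4 by rewrite divr_gt0.
have [k hk] := cell_avg_error b0 e40.
have [F mF [n0 hn0]] := cell_avg_cauchy k b0 e40.
exists n0 => i j n0i n0j.
have mc := @measurable_cube R N b.
have mabs (f : 'rV[R]_N -> R) : measurable_fun setT f ->
    measurable_fun (cube b) (fun x => `|f x|%:E).
  move=> mf; apply: (@measurable_funS _ _ _ _ setT) => //.
  by apply/measurable_EFinP; exact: measurableT_comp.
have mUE n : measurable_fun (cube b) (fun x => `|u n x - E k n x|%:E).
  by apply: mabs; exact: measurable_funB.
have mEF n : measurable_fun (cube b) (fun x => `|E k n x - F x|%:E).
  by apply: mabs; exact: measurable_funB.
apply: (@le_trans _ _ (\int[leb]_(x in cube b)
  ((`|u i x - E k i x|%:E + `|E k i x - F x|%:E) +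
   (`|u j x - E k j x|%:E + `|E k j x - F x|%:E))))%E.
  apply: ge0_le_integral => //.
  - by apply: mabs; exact: measurable_funB.
  - by apply: emeasurable_funD; apply: emeasurable_funD.
  - move=> x _; rewrite -!EFinD lee_fin.
    have -> : u i x - u j x = (u i x - E k i x + (E k i x - F x)) -
      (u j x - E k j x + (E k j x - F x)) by ring.
    by apply: le_trans (ler_normB _ _) _; apply: lerD; exact: ler_normD.
rewrite ge0_integralD//; last 4 first.
- by move=> x _; rewrite adde_ge0.
- exact: emeasurable_funD.
- by move=> x _; rewrite adde_ge0.
- exact: emeasurable_funD.
rewrite !ge0_integralD//.
apply: (@le_trans _ _ (((e / 4)%:E + (e / 4)%:E) + ((e / 4)%:E + (e / 4)%:E))%E).
  by apply: leeD; apply: leeD => //; exact: hn0.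
by rewrite -!EFinD lee_fin le_eqVlt; apply/orP; left; apply/eqP; field.
Qed.

End averages_subsequence.

(** * Precompactness in the weighted space *)

Section weighted_compactness.
Context {R : realType} {N : nat}.
Local Notation leb := (@lebesgue_measure_rV R N).
Variables (p P Q K M eta r : R).
Hypotheses (p1 : 1 < p) (pN : p < N%:R) (P1 : 1 < P) (K0 : 0 <= K) (PQ : P < Q).
Hypotheses (PE : P * (N%:R - p) = N%:R * p).
Hypotheses (eta0 : 0 < eta) (etaN : eta < N%:R) (r1 : 1 <= r).
Hypotheses (Pr : P * (N%:R - eta) < r * N%:R) (rQ : r * N%:R < Q * (N%:R - eta)).
Hypothesis M0 : 0 < M.

Let weight (x : 'rV[R]_N) : R := enorm x `^ (- eta).

Let mw : measurable_fun setT weight.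
Proof. by apply/measurable_EFinP; exact: measurable_enorm_powR. Qed.

Let w0 x : 0 <= weight x. Proof. exact: powR_ge0. Qed.

Let r0 : 0 < r. Proof. exact: lt_le_trans r1. Qed.

Let r_lt_Q : r < Q.
Proof. exact: (weighted_exponent_lt P1 PQ eta0 etaN rQ). Qed.

(** Off the cube of radius b the weight is at most b^-eta, and |v|^r is split between |v| and |v|^Q
    at the level L. Since r < Q, a large L makes the second term small under a mere bound in L^Q. *)
Lemma integral_middle_le (b c L : R) (v : 'rV[R]_N -> R) : 0 < b -> 0 < L ->
  measurable_fun setT v ->
  (\int[leb]_(x in ~` cube b `&` cube c) (`|v x| `^ r * weight x)%:E <=
   (b `^ (- eta) * L `^ (r - 1))%:E * \int[leb]_(x in cube c) `|v x|%:E +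
   (b `^ (- eta) * L `^ (r - Q))%:E * \int[leb]_x (`|v x| `^ Q)%:E)%E.
Proof.
move=> b0 L0 mv.
pose A : R := b `^ (- eta) * L `^ (r - 1); pose B : R := b `^ (- eta) * L `^ (r - Q).
have A0 : 0 <= A by rewrite mulr_ge0 ?powR_ge0.
have B0 : 0 <= B by rewrite mulr_ge0 ?powR_ge0.
have mb := @measurable_cube R N b; have mc := @measurable_cube R N c.
have mD : measurable (~` cube b `&` cube c : set 'rV[R]_N).
  by apply: measurableI => //; exact: measurableC.
have m1 : measurable_fun setT (fun x => `|v x|%:E).
  by apply/measurable_EFinP; exact: measurableT_comp.
have mQ := measurable_powR_norm Q mv.
have mS (D E : set 'rV[R]_N) (f : 'rV[R]_N -> \bar R) : measurable_fun setT f -> measurable_fun D f.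
  by move=> mf; exact: measurable_funS mf.
apply: (@le_trans _ _ (\int[leb]_(x in ~` cube b `&` cube c)
    (A%:E * `|v x|%:E + B%:E * (`|v x| `^ Q)%:E)))%E.
  apply: ge0_le_integral => //.
  - by move=> x _; rewrite lee_fin mulr_ge0 ?powR_ge0.
  - apply: (@measurable_funS _ _ _ _ setT) => //.
    exact: measurable_weighted.
  - apply: (@measurable_funS _ _ _ _ setT) => //.
    by apply: emeasurable_funD; apply: emeasurable_funM.
  - move=> x [xb _].
    rewrite -!EFinM -EFinD lee_fin.
    have wb : weight x <= b `^ (- eta).
      apply: powRN_le => //; last exact: ltW.
      by apply/ltW/notin_cube_enorm/negP => /in_cubeP.
    have := powR_between (ltr01 : (0 : R) < 1) r1 (ltW r_lt_Q) L0 (normr_ge0 (v x)).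
    rewrite powRr1// => vr.
    apply: (@le_trans _ _ (`|v x| `^ r * b `^ (- eta))); first by rewrite ler_wpM2l ?powR_ge0.
    by rewrite mulrC /A /B -!mulrA -mulrDr ler_wpM2l ?powR_ge0.
have f1 x : (0 <= A%:E * `|v x|%:E :> \bar R)%E by rewrite mule_ge0 ?lee_fin.
have f2 x : (0 <= B%:E * (`|v x| `^ Q)%:E :> \bar R)%E by rewrite mule_ge0 ?lee_fin ?powR_ge0.
rewrite ge0_integralD//; last 2 first.
- by apply: (@measurable_funS _ _ _ _ setT) => //; exact: emeasurable_funM.
- by apply: (@measurable_funS _ _ _ _ setT) => //; exact: emeasurable_funM.
rewrite -/A -/B; apply: leeD.
  rewrite -ge0_integralZl//; last 1 first.
  - exact: (@measurable_funS _ _ _ _ setT).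
  apply: ge0_subset_integral => //.
  by apply: (@measurable_funS _ _ _ _ setT) => //; exact: emeasurable_funM.
rewrite -ge0_integralZl//.
by apply: ge0_subset_integral => //; exact: emeasurable_funM.
Qed.

Lemma weighted_cauchy (u : nat -> 'rV[R]_N -> R) (e : R) :
  (forall n, sobolev_data p P Q K M (u n)) ->
  (forall j x, cvgn (fun n => cell_avg (2 ^- j) (u n) x)) -> 0 < e ->
  exists n0, forall i j, (n0 <= i)%N -> (n0 <= j)%N ->
    (\int[leb]_x (`|u i x - u j x| `^ r * weight x)%:E <= e%:E)%E.
Proof.
move=> uE uavg e0.
have mu_u n : measurable_fun setT (u n) by case: (uE n).
(* Chosen so that the tail of a difference is at most 2^r (e' + e') = e / 4. *)
pose e' := e / (8 * 2 `^ r).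
have e'0 : 0 < e' by rewrite divr_gt0// mulr_gt0// powR_gt0.
have [m hm] := weighted_integral_tails p1 pN P1 K0 PQ PE eta0 etaN r1 Pr rQ M0 e'0.
pose b : R := 2 ^- m; pose c : R := 2 ^+ m.
have b0 : 0 < b by rewrite invr_gt0 exprn_gt0.
have c0 : 0 < c by rewrite exprn_gt0.
(* Bounds the integral of |u_i - u_j|^Q. *)
pose BQ : R := 2 `^ Q * (M `^ Q + M `^ Q).
have BQ0 : 0 < BQ by apply: mulr_gt0; rewrite ?addr_gt0 ?powR_gt0.
pose W : R := b `^ (- eta); have W0 : 0 < W by exact: powR_gt0.
(* Solves W L^(r - Q) BQ = e / 4. Only then is closeness in L^1 prescribed, with a constant [A] that
   depends on L. *)
pose L := (4 * W * BQ / e) `^ (Q - r)^-1.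
have L1 : 0 < 4 * W * BQ / e := divr_gt0 (mulr_gt0 (mulr_gt0 (ltr0n R 4) W0) BQ0) e0.
have L0 : 0 < L by exact: powR_gt0.
have LE : W * L `^ (r - Q) * BQ = e / 4.
  have Qr : 0 < Q - r by rewrite subr_gt0.
  rewrite /L -powRrM (_ : (Q - r)^-1 * (r - Q) = -1); last by field; rewrite gt_eqF.
  rewrite powR_inv1 ?(ltW L1)//.
  by move: W BQ W0 BQ0 {L L1 L0} => W' B' W0 B0; field; rewrite !gt_eqF.
pose A : R := W * L `^ (r - 1).
have A0 : 0 < A by rewrite mulr_gt0// powR_gt0.
have eA : 0 < e / (4 * A) by rewrite divr_gt0// mulr_gt0.
have [n0 hn0] := cauchy_on_cube p1 pN P1 K0 M0 uE uavg c0 eA.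
exists n0 => i j n0i n0j.
have mb := @measurable_cube R N b; have mc := @measurable_cube R N c.
pose f x : \bar R := (`|u i x - u j x| `^ r * weight x)%:E.
have mD : measurable_fun setT (fun x => u i x - u j x) by exact: measurable_funB.
have mf : measurable_fun setT f by exact: measurable_weighted.
have f0 x : (0 <= f x)%E by rewrite lee_fin mulr_ge0 ?powR_ge0.
have tail (D : set 'rV[R]_N) : measurable D ->
    (forall n, (\int[leb]_(x in D) (`|u n x| `^ r * weight x)%:E <= e'%:E)%E) ->
    (\int[leb]_(x in D) f x <= (e / 4)%:E)%E.
  move=> mD' hD.
  apply: (le_trans (integral_powR_normB_le leb (ltW r0) mD' mw w0 (mu_u i) (mu_u j))).
  apply: (@le_trans _ _ ((2 `^ r)%:E * (e'%:E + e'%:E))%E).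
    by apply: lee_wpmul2l; [rewrite lee_fin powR_ge0|exact: leeD].
  rewrite -EFinD -EFinM lee_fin le_eqVlt; apply/orP; left; apply/eqP.
  rewrite /e'; have : 2 `^ r != 0 :> R by rewrite gt_eqF// powR_gt0.
  by move: (2 `^ r) => t t0; field.
have T1 : (\int[leb]_(x in cube b) f x <= (e / 4)%:E)%E.
  by apply: tail => // n; exact: (hm _ (uE n)).1.
have T3 : (\int[leb]_(x in ~` cube c) f x <= (e / 4)%:E)%E.
  apply: tail; first exact: measurableC.
  by move=> n; exact: (hm _ (uE n)).2.
have T2 : (\int[leb]_(x in ~` cube b `&` cube c) f x <= (e / 4 + e / 4)%:E)%E.
  apply: le_trans (integral_middle_le c b0 L0 mD) _.
  rewrite EFinD; apply: leeD.
    apply: (@le_trans _ _ (A%:E * (e / (4 * A))%:E)%E).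
      by apply: lee_wpmul2l; [rewrite lee_fin ltW|exact: hn0].
    rewrite -EFinM lee_fin le_eqVlt; apply/orP; left; apply/eqP.
    by move: A A0 {eA hn0} => A' A0; field; rewrite gt_eqF.
  apply: (@le_trans _ _ ((W * L `^ (r - Q))%:E * BQ%:E)%E); last by rewrite -EFinM LE.
  apply: lee_wpmul2l; first by rewrite lee_fin mulr_ge0 ?powR_ge0.
  have Q0 : 0 <= Q by rewrite (le_trans (ltW r0))// ltW.
  have := integral_powR_normB_le leb Q0 measurableT
    (measurable_cst (1 : R) : measurable_fun setT (fun=> 1 : R)) (fun=> ler01) (mu_u i) (mu_u j).
  have E1 (g : 'rV[R]_N -> R) : (\int[leb]_x (g x * 1)%:E = \int[leb]_x (g x)%:E)%E.
    by apply: eq_integral => x _; rewrite mulr1.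
  rewrite (E1 (fun x => `|u i x - u j x| `^ Q)) (E1 (fun x => `|u i x| `^ Q)).
  rewrite (E1 (fun x => `|u j x| `^ Q)).
  move=> /le_trans; apply; rewrite /BQ EFinM EFinD; apply: lee_wpmul2l.
    by rewrite lee_fin powR_ge0.
  by apply: leeD; [case: (uE i)|case: (uE j)].
change (\int[leb]_x f x <= e%:E)%E.
rewrite -(setUv (cube b)) ge0_integral_setU//; last 3 first.
- exact: measurableC.
- by rewrite setUv.
- by rewrite disj_set2E setICr.
have -> : ~` cube b = (~` cube b `&` cube c) `|` (~` cube b `&` ~` cube c) :> set 'rV[R]_N.
  by rewrite -setIUr setUv setIT.
rewrite ge0_integral_setU//; last 4 first.
- by apply: measurableI => //; exact: measurableC.
- by apply: measurableI; exact: measurableC.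
- exact: (@measurable_funS _ _ _ _ setT).
- by rewrite disj_set2E setIACA setICr setI0.
apply: (@le_trans _ _ ((e / 4)%:E + ((e / 4 + e / 4)%:E + (e / 4)%:E))%E).
  apply: leeD => //; apply: leeD => //; apply: le_trans T3.
  apply: ge0_subset_integral => //.
  - by apply: measurableI; exact: measurableC.
  - exact: measurableC.
  - exact: (@measurable_funS _ _ _ _ setT).
by rewrite -!EFinD lee_fin le_eqVlt; apply/orP; left; apply/eqP; field.
Qed.

Lemma weighted_compact (u : nat -> 'rV[R]_N -> R) :
  (forall n, sobolev_data p P Q K M (u n)) ->
  exists (s : nat -> nat) (v : 'rV[R]_N -> R),
  [/\ {homo s : m n / (m < n)%N}, measurable_fun setT v,
      (\int[leb]_x (`|v x| `^ r * enorm x `^ (- eta))%:E < +oo)%E &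
      forall e : R, 0 < e -> exists n0, forall n, (n0 <= n)%N ->
        (\int[leb]_x (`|u (s n) x - v x| `^ r * enorm x `^ (- eta))%:E <= e%:E)%E].
Proof.
move=> uE; have [s [hs savg]] := cell_avg_subsequence p1 pN P1 K0 M0 uE.
have mus n : measurable_fun setT (u (s n)) by case: (uE (s n)).
have [v mv hv] := weighted_complete mw w0 r0 mus
  (fun e e0 => weighted_cauchy (fun n => uE (s n)) savg e0).
exists s, v; split => //.
(* The limit has finite weighted norm because v = u - (u - v), for one term u at distance at most 1
   in the weighted integral. *)
have [n0 /(_ n0 (leqnn n0)) h1] := hv 1 ltr01.
have [C C0 hC] := weighted_integral_le p1 pN P1 K0 PQ PE eta0 etaN r1 Pr rQ.
have h2 := hC _ _ M0 (uE (s n0)).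
have := integral_powR_normB_le leb (ltW r0) measurableT mw w0 (mus n0)
  (measurable_funB (mus n0) mv).
under eq_integral do rewrite opprB addrCA subrr addr0.
move=> /le_lt_trans; apply.
apply: (@le_lt_trans _ _ ((2 `^ r)%:E * ((C * M `^ r)%:E + 1%:E))%E).
  by apply: lee_wpmul2l; [rewrite lee_fin powR_ge0|exact: leeD].
by rewrite -EFinD -EFinM ltry.
Qed.

End weighted_compactness.

(** * Conclusion *)

Section exponent_arithmetic.
Context {R : realType} {N : nat}.
Variables (p q eta r : R).
Hypotheses (q1 : 1 < q) (qN : q < N%:R / 2) (p1 : 1 < p) (pq : p < star N q).

Let q0 : 0 < q. Proof. exact: lt_trans q1. Qed.

Let Nq2 : 0 < N%:R - 2 * q.
Proof. by rewrite subr_gt0 mulrC -ltr_pdivlMr. Qed.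

Let Nq : 0 < N%:R - q. Proof. by move: Nq2 q0; lra. Qed.

Let N0 : 0 < N%:R :> R. Proof. by move: Nq2 q0; lra. Qed.

Let pNq : p * (N%:R - q) < N%:R * q.
Proof. by move: pq; rewrite /star ltr_pdivlMr. Qed.

(** The bound q < N/2 gives q < N - q, hence q^* < N. *)
Lemma exponent_lt_dim : p < N%:R.
Proof.
rewrite -(ltr_pM2r Nq); apply: lt_trans pNq _.
by rewrite ltr_pM2l//; move: Nq2; lra.
Qed.

Let Np : 0 < N%:R - p. Proof. by rewrite subr_gt0; exact: exponent_lt_dim. Qed.

Lemma star_gt1 : 1 < star N p.
Proof.
rewrite /star ltr_pdivlMr// mul1r; apply: (@lt_trans _ _ N%:R).
  by rewrite gtrBl (lt_trans _ p1).
by rewrite ltr_pMr.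
Qed.

Lemma starE : star N p * (N%:R - p) = N%:R * p.
Proof. by rewrite /star divfK// gt_eqF. Qed.

Lemma star2_gt0 : 0 < star2 N q.
Proof. by rewrite /star2 divr_gt0// mulr_gt0. Qed.

(** After clearing denominators this is p (N - 2q) < q (N - p), that is p (N - q) < N q, which is p
    < q^*. *)
Lemma star_lt_star2 : star N p < star2 N q.
Proof.
rewrite /star /star2 ltr_pdivrMr// mulrAC ltr_pdivlMr// -!mulrA ltr_pM2l//.
by rewrite mulrBr mulrBr; move: pNq; rewrite mulrBr; nra.
Qed.

(** The bound on eta equals N + 2 - N/q, which is below N since q < N/2. *)
Lemma eta_lt_dim : eta < 2 + N%:R / conj_exp q -> eta < N%:R.
Proof.
move=> /lt_trans; apply; rewrite /conj_exp invf_div mulrA -ltrBrDl ltr_pdivrMr// mulrBl; move: Nq2; lra.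
Qed.

(** The weighted exponent is p^* (N - eta) / N, and the one for q is obtained from q^{**} in the
    same way. *)
Lemma wstar_ltE : wstar N eta p < r -> star N p * (N%:R - eta) < r * N%:R.
Proof.
rewrite -(ltr_pM2r N0); apply: le_lt_trans.
by rewrite /wstar /star le_eqVlt; apply/orP; left; apply/eqP; field; rewrite gt_eqF.
Qed.

Lemma wstar2_gtE : r < wstar2 N eta q -> r * N%:R < star2 N q * (N%:R - eta).
Proof.
rewrite -(ltr_pM2r N0) => /lt_le_trans; apply.
by rewrite /wstar2 /star2 le_eqVlt; apply/orP; left; apply/eqP; field; rewrite gt_eqF.
Qed.

End exponent_arithmetic.

Section embedding.
Context {R : realType} {N : nat}.
Local Notation leb := (@lebesgue_measure_rV R N).
Variables (p q eta r : R).
Hypotheses (p1 : 1 < p) (P0 : 0 < star N p) (Q0 : 0 < star2 N q) (r0 : 0 < r).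

Lemma normV_fin_num (u : 'rV[R]_N -> R) : spaceV p q u -> normV p q u \is a fin_num.
Proof.
move=> [[_ _ ug] uQ].
rewrite ge0_fin_numE; last by rewrite adde_ge0 ?Lnorm_ge0.
apply: lte_add_pinfty.
  by move: ug; rewrite inE => /andP[_]; rewrite inE.
by move: uQ; rewrite /= inE => /andP[_]; rewrite inE.
Qed.

Lemma wLnorm_le (C M : R) (u : 'rV[R]_N -> R) : 0 <= C -> 0 <= M ->
  (\int[leb]_x (`|u x| `^ r * enorm x `^ (- eta))%:E <= (C * M `^ r)%:E)%E ->
  (wLnorm eta r u <= (C `^ r^-1 * M)%:E)%E.
Proof.
move=> C0 M0 uCM.
have -> : C `^ r^-1 * M = (C * M `^ r) `^ r^-1.
  by rewrite powRM ?powR_ge0// -powRrM mulfV ?gt_eqF// powRr1.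
rewrite -poweR_EFin /wLnorm; apply: gt0_ler_poweR => //.
- by rewrite invr_ge0 ltW.
- rewrite in_itv/= leey andbT; apply: integral_ge0 => x _.
  by rewrite lee_fin mulr_ge0 ?powR_ge0.
- by rewrite in_itv/= leey andbT lee_fin mulr_ge0 ?powR_ge0.
Qed.

Lemma wLnorm_ge0 (u : 'rV[R]_N -> R) : (0 <= wLnorm eta r u)%E.
Proof. exact: poweR_ge0. Qed.

Lemma continuous_embedding (C : R) : 0 < C ->
  (forall M u, 0 < M ->
    sobolev_data p (star N p) (star2 N q) (translation_const (N := N) p) M u ->
    (\int[leb]_x (`|u x| `^ r * enorm x `^ (- eta))%:E <= (C * M `^ r)%:E)%E) ->
  continuously_embedded (@spaceV R N p q) (normV p q) (wLspace eta r) (wLnorm eta r).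
Proof.
move=> C0 H.
have C'0 : 0 < C `^ r^-1 by exact: powR_gt0.
have bound (u : 'rV[R]_N -> R) : spaceV p q u -> (wLnorm eta r u <= (C `^ r^-1)%:E * normV p q u)%E.
  move=> uV; have nfin := normV_fin_num uV.
  have n0 : (0 <= normV p q u)%E by rewrite adde_ge0 ?Lnorm_ge0.
  apply/lee_addgt0Pr => e e0.
  have f0 : 0 <= fine (normV p q u) by exact: fine_ge0.
  (* The norm may be 0 while the estimates ask for M > 0; the excess contributes exactly e, which is
     arbitrary. *)
  pose M := fine (normV p q u) + e / C `^ r^-1.
  have M0 : 0 < M by rewrite ltr_wpDl// divr_gt0.
  have nM : (normV p q u <= M%:E)%E.
    by rewrite -(fineK nfin) lee_fin lerDl ltW// divr_gt0.
  have := wLnorm_le (ltW C0) (ltW M0) (H _ _ M0 (spaceV_sobolev_data p1 P0 Q0 M0 uV nM)).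
  move=> /le_trans; apply.
  rewrite -(fineK nfin) -EFinM -EFinD lee_fin mulrDr lerD2l.
  by rewrite mulrCA mulfV ?mulr1// gt_eqF.
split; last by exists (C `^ r^-1); split.
move=> u uV; split; first by case: uV => -[_ [G [[]]]].
by apply: le_lt_trans (bound u uV) _; rewrite -(fineK (normV_fin_num uV)) -EFinM ltry.
Qed.

Lemma wLnorm_cvg0 (f : nat -> 'rV[R]_N -> R) :
  (forall e : R, 0 < e -> exists n0, forall n, (n0 <= n)%N ->
    (\int[leb]_x (`|f n x| `^ r * enorm x `^ (- eta))%:E <= e%:E)%E) ->
  wLnorm eta r (f n) @[n --> \oo] --> 0%E.
Proof.
move=> H.
have H' (e : R) : 0 < e -> \forall n \near \oo, (wLnorm eta r (f n) <= e%:E)%E.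
  move=> e0; have [n0 hn0] := H (e `^ r) (powR_gt0 r e0).
  exists n0 => // n /= n0n.
  have -> : e = 1 `^ r^-1 * e by rewrite powR1 mul1r.
  apply: wLnorm_le => //; first exact: ltW.
  by rewrite mul1r; exact: hn0.
have fin : \forall n \near \oo, wLnorm eta r (f n) \is a fin_num.
  apply: filterS (H' 1 ltr01) => n hn; rewrite ge0_fin_numE ?wLnorm_ge0//.
  exact: le_lt_trans hn (ltry _).
apply/fine_cvgP; split=> //; apply/cvgrPdist_le => e e0.
apply: filterS2 fin (H' e e0) => n hf hn.
rewrite /= sub0r normrN ger0_norm ?fine_ge0 ?wLnorm_ge0//.
by rewrite -lee_fin fineK.
Qed.

End embedding.

Unset Implicit Arguments.

Theorem lemma2p2 (R : realType) (N : nat) (p q eta : R) :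
  1 < q -> q < N%:R / 2 ->
  1 < p -> p < star N q ->
  p != q -> q != star N p ->
  0 <= eta -> eta < 2 + N%:R / conj_exp q ->
  (forall r : R, 1 <= r -> wstar N eta p < r -> r < wstar2 N eta q ->
     continuously_embedded (@spaceV R N p q) (normV p q)
       (wLspace eta r) (wLnorm eta r)) /\
  (0 < eta ->
   forall r : R, 1 <= r -> wstar N eta p < r -> r < wstar2 N eta q ->
     compactly_embedded (@spaceV R N p q) (normV p q)
       (wLspace eta r) (wLnorm eta r)).
Proof.
move=> q1 qN p1 pq _ _ eta0 etaq.
have pN := exponent_lt_dim q1 qN pq.
have P1 := star_gt1 q1 qN p1 pq.
have PE := starE q1 qN pq.
have Q0 := star2_gt0 q1 qN.
have PQ := star_lt_star2 q1 qN pq.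
have etaN := eta_lt_dim q1 qN etaq.
have K0 := @translation_const_ge0 R N p.
have P0 : 0 < star N p by exact: lt_trans P1.
have cont r : 1 <= r -> wstar N eta p < r -> r < wstar2 N eta q ->
    continuously_embedded (@spaceV R N p q) (normV p q) (wLspace eta r) (wLnorm eta r).
  move=> r1 /(wstar_ltE q1 qN pq) Pr /(wstar2_gtE q1 qN) rQ.
  have r0 : 0 < r by exact: lt_le_trans r1.
  (* For eta = 0 the weight gives no decay at infinity, but r itself lies strictly between P and Q,
     so the interpolation applies with s = r. *)
  move: eta0; rewrite le_eqVlt => /predU1P[eta0|eta_gt0]; last first.
    have [C C0 HC] := weighted_integral_le p1 pN P1 K0 PQ PE eta_gt0 etaN r1 Pr rQ.
    exact: continuous_embedding C0 HC.
  have N0 : 0 < N%:R :> R by apply: lt_trans pN; exact: lt_trans p1.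
  rewrite -eta0 subr0 ltr_pM2r// in Pr; rewrite -eta0 subr0 ltr_pM2r// in rQ.
  have ps : N%:R * p < r * (N%:R - p) by rewrite -PE ltr_pM2r// subr_gt0.
  apply: (continuous_embedding p1 P0 Q0 r0 (sobolev_const_gt0 _ p1 ps)) => M u M0 uE.
  apply: le_trans (sobolev_interpolation p1 pN P1 K0 ps (ltW rQ) M0 uE).
  rewrite le_eqVlt; apply/orP; left; apply/eqP; apply: eq_integral => x _.
  (* The power with exponent 0 is 1 at the origin too, so the weight is identically 1. *)
  by rewrite -eta0 oppr0 powRr0 mulr1.
split=> // eta_gt0 r r1 Pr rQ; split; first exact: cont.
move=> u uV [M uM].
have r0 : 0 < r by exact: lt_le_trans r1.
(* The given bound on the norms may fail to be positive. *)
have M0 : 0 < Num.max M 1 by rewrite lt_max ltr01 orbT.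
have uE n : sobolev_data p (star N p) (star2 N q) (translation_const (N := N) p)
    (Num.max M 1) (u n).
  apply: spaceV_sobolev_data => //.
  by apply: le_trans (uM n) _; rewrite lee_fin le_max lexx.
have [s [v [hs mv vfin v_cvg]]] := weighted_compact p1 pN P1 K0 PQ PE eta_gt0 etaN r1
  (wstar_ltE q1 qN pq Pr) (wstar2_gtE q1 qN rQ) M0 uE.
exists s, v; split=> //.
  by split=> //; rewrite /wLnorm; exact: poweR_lty.
exact: wLnorm_cvg0.
Qed.
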